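(* Let $r \ge 1$. The map $\Phi = \pi \circ \omega$ restricts to a bijection between the set of degree-two $\mathfrak{sl}_r$-webs that are forests (i.e., contain no cycle) and the set of permutations in $S_r$ that avoid each of the patterns $132$, $4321$ and $3214$.
   Context: An $r$-hourglass plabic graph of standard type and Plücker degree $d$ is a planar, properly bicolored (black/white) graph embedded in a disk, considered up to planar isotopy fixing the boundary circle, such that: there are $dr$ boundary vertices, all black and of degree one, labeled $1,\dots,dr$ in order around the circle; each edge has a positive integer multiplicity (an edge of multiplicity $m>1$ is called an hourglass); and the multiplicities of the edges at each interior vertex sum to $r$. A degree-two $\mathfrak{sl}_r$-web is a contracted, fully reduced $r$-hourglass plabic graph of standard type and Plücker degree two (contracted and fully reduced in the sense of Gaetz–Pechenik–Pfannerer–Striker–Swanson). In such a web every interior white vertex is adjacent to a boundary vertex, every interior black vertex has exactly three incident hourglasses, and the number of white vertices exceeds the number of interior black vertices by exactly $2$. Such a web is a forest if and only if it has at most $3$ white vertices; so a forest web has either $2$ white vertices and no interior black vertex, or $3$ white vertices and exactly one interior black vertex. The map $\omega$ from forest degree-two $\mathfrak{sl}_r$-webs $G$ to $r\times 2$ standard Young tableaux (fillings of an $r$-row, $2$-column rectangle with $1,\dots,2r$ increasing along rows and down columns) is: (1) replace each hourglass by a single edge weighted by its multiplicity; (2) form a polygon on the white vertices: if there are three white vertices, take the triangle on them (containing the interior black vertex), weight each triangle edge by the multiplicity of the black vertex's edge not incident to that triangle edge, then delete the black vertex and its edges; if there are two white vertices, join them by one edge of weight $r$; (3) replace each polygon edge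 of weight $m$ by $m$ parallel strands, delete the white vertices and join each boundary edge to the strands on the opposite side of its white vertex so as to obtain a noncrossing perfect matching of $\{1,\dots,2r\}$; (4) for each matched pair $i<j$ put $i$ in column $1$ and $j$ in column $2$, ordering each column increasingly; this gives $\omega(G)$. The map $\pi$ from $r\times 2$ standard Young tableaux to $S_r$: given $T$, let $\mathrm{path}(T)$ be the lattice path from $(1,0)$ to $(r+1,r)$ whose $i$-th unit step is north if $i$ is in the first column of $T$ and east otherwise (it never passes below the line $y=x-1$). Place a marker at each northwest corner of the path (the endpoint of a north step that is followed by an east step) and draw rays east and south from each marker. Then repeatedly place a marker at a northwest-most point of $\{1,\dots,r\}^2$ lying on or below the path that is not yet marked or covered by a ray, and draw rays east and south from it. This stops after $r$ markers, and $\pi(T)=w$ is defined by $w(r+1-y)=x$ for each marker $(x,y)$. The map $\pi$ is a bijection onto the $132$-avoiding permutations of $S_r$. A permutation $w\in S_r$ avoids a pattern $p$ if no subsequence of the one-line notation $w(1)\cdots w(r)$ is in the same relative order as $p$. *)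

(* Defs.v *)
From mathcomp Require Import all_boot.
From mathcomp Require Import perm matrix.
Set Implicit Arguments.
Unset Strict Implicit.
Unset Printing Implicit Defensive.

(* A graph embedded in a disk is encoded by its rotation system.  Darts are
   half-edges: [opp x] is the other half of the edge of [x], and [rot x] is the
   dart following [x] in clockwise order around the same vertex, so the vertices
   are the orbits of [rot] and the edges those of [opp].  The boundary vertices
   have a single dart; [bdry i] is the dart at the boundary vertex with label
   i+1, the labels being read clockwise.  An isotopy fixing the boundary circle
   amounts to an isomorphism of this data.  (The encoding forgets the face in
   which a component disjoint from the boundary lies; fully reduced graphs have
   no such component.) *)
Record hgraph (n : nat) := HGraph {
  dart :> finType;
  rot : {perm dart};
  opp : dart -> dart;
  white : pred dart;
  mult : dart -> nat;
  bdry : 'I_n -> dart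
}.

Section HGraph.
Variables (n : nat) (G : hgraph n).
Implicit Types (x y : G).

Definition vtx x : {set G} := porbit (rot G) x.

Definition is_bdry x : bool := x \in codom (@bdry n G).

Definition degree x : nat := \sum_(y in vtx x) mult y.

(* The disk with its boundary circle collapsed to one point is a sphere; the
   boundary vertices become a single vertex, around which the boundary darts
   occur clockwise in decreasing order of their labels. *)
Definition closed_rot x : G :=
  if [pick i | bdry G i == x] is Some i then bdry G (ord_pred i) else rot G x.

Definition closed_link : rel G :=
  [rel x y | (y == closed_rot x) || (y == opp x)].

(* Euler's formula V + F = E + 2C, where |darts| = 2E and E = #orbits of opp. *)
Definition planar : Prop :=
  fcard closed_rot G + fcard (@opp n G) G + fcard (closed_rot \o @opp n G) G
  = #|G| + (n_comp closed_link G).*2.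

Record is_hourglass_plabic (r : nat) : Prop := {
  opp_involutive : involutive (@opp n G);
  opp_neq : forall x, opp x != x;
  bdry_inj : injective (@bdry n G);
  bdry_simple : forall i, rot G (bdry G i) = bdry G i;
  bdry_black : forall i, ~~ white (bdry G i);
  bdry_mult : forall i, mult (bdry G i) = 1;
  white_rot : forall x, white (rot G x) = white x;
  white_opp : forall x, white (opp x) = ~~ white x;
  mult_gt0 : forall x, 0 < mult x;
  mult_opp : forall x, mult (opp x) = mult x;
  interior_degree : forall x, ~~ is_bdry x -> degree x = r;
  planarity : planar
}.

(* A contraction move deletes an interior vertex of simple degree two and merges
   its two neighbours, which have to be interior; contracted means that no such
   move applies. *)
Definition contracted : Prop :=
  forall x, ~~ is_bdry x -> #|vtx x| = 2 ->
  exists2 y, y \in vtx x & is_bdry (opp y).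

Definition no_isolated_component : Prop :=
  forall x, exists i,
    connect [rel y z | (z == rot G y) || (z == opp y)] x (bdry G i).

(* [(x, k)] with [k < mult x] is the k-th strand, in clockwise order, of the
   hourglass of [x].  Hourglasses are twisted so that the clockwise orders of
   their strands at both ends agree, hence [opp_strand] keeps [k]. *)
Definition strand : Type := (G * nat)%type.

Definition opp_strand (s : strand) : strand := (opp s.1, s.2).

Definition cw_strand (s : strand) : strand :=
  if s.2.+1 < mult s.1 then (s.1, s.2.+1) else (rot G s.1, 0).

(* The a-th leftmost turn is a clockwise steps away from the incoming strand;
   at a vertex of degree r, a counterclockwise steps are r - a clockwise ones. *)
Definition trip_step (r a : nat) (s : strand) : strand :=
  let t := opp_strand s in
  iter (if white t.1 then a else r - a) cw_strand t.

Definition at_bdry (s : strand) : bool := is_bdry (opp s.1).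

(* [p] lists the darts traversed by the trip_a-strand starting at [bdry i]. *)
Definition is_trip (r a : nat) (i : 'I_n) (p : seq G) : Prop :=
  exists t : seq strand,
    [/\ fpath (trip_step r a) (bdry G i, 0) t,
        all (predC at_bdry) (belast (bdry G i, 0) t),
        at_bdry (last (bdry G i, 0) t) &
        p = [seq s.1 | s <- (bdry G i, 0) :: t]].

(* Two walks that meet at two vertices, in the same order, coincide in
   between. *)
Definition no_double_crossing (p q : seq G) : Prop :=
  forall x p1 y q1, infix (x :: p1) p -> infix (y :: q1) q ->
    vtx x = vtx y -> vtx (opp (last x p1)) = vtx (opp (last y q1)) ->
    x :: p1 = y :: q1.

Record fully_reduced (r : nat) : Prop := {
  reduced_isolated : no_isolated_component;
  reduced_self : forall a i p, 0 < a < r -> is_trip r a i p ->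
    uniq [seq vtx x | x <- p];
  reduced_double : forall a b i j p q, 0 < a < r -> 0 < b < r ->
    b = a \/ b = a.+1 ->
    is_trip r a i p -> is_trip r b j q -> no_double_crossing p q
}.

(* A cycle is given by its edges, oriented along the cycle: each ends where the
   next one starts and is not its reverse, and the vertices are distinct. *)
Definition is_cycle (c : seq G) : bool :=
  [&& c != [::],
      path.cycle [rel x y | (vtx (opp x) == vtx y) && (y != opp x)] c &
      uniq [seq vtx x | x <- c]].

Definition forest : Prop := forall c, ~~ is_cycle c.

Definition white_vertices : {set {set G}} := [set vtx x | x in @white n G].

Definition interior_black x : bool := ~~ white x && ~~ is_bdry x.

Definition bdry_nbr (i : 'I_n) : {set G} := vtx (opp (bdry G i)).

(* [m] is the weight of the polygon edge joining the white vertices [u], [v]. *)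
Definition polygon_weight (r : nat) (u v : {set G}) (m : nat) : Prop :=
  (#|white_vertices| = 2 -> m = r) /\
  (#|white_vertices| = 3 -> forall x, interior_black x ->
     vtx (opp x) \notin [set u; v] -> m = mult x).

End HGraph.

(* Isomorphisms of rotation systems, i.e. isotopies fixing the boundary. *)
Definition isotopic (n : nat) (G H : hgraph n) : Prop :=
  exists f : G -> H,
    [/\ bijective f,
        forall x, f (rot G x) = rot H (f x),
        forall x, f (opp x) = opp (f x),
        forall x, white (f x) = white x /\ mult (f x) = mult x &
        forall i, f (bdry G i) = bdry H i].

Definition degree_two_web (r : nat) (G : hgraph (2 * r)) : Prop :=
  [/\ is_hourglass_plabic G r, contracted G & fully_reduced G r].

Definition forest_web (r : nat) (G : hgraph (2 * r)) : Prop :=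
  degree_two_web G /\ forest G.

Definition noncrossing_matching (n : nat) (M : 'I_n -> 'I_n) : Prop :=
  [/\ involutive M, forall i, M i != i &
      forall i j : 'I_n, ~ [/\ i < j, j < M i & M i < M j]].

(* [M] arises from the m parallel strands of the polygon edges of weight m: each
   strand of the edge {u, v} joins a boundary vertex adjacent to [u] to one
   adjacent to [v]. *)
Definition strand_matching (r : nat) (G : hgraph (2 * r))
    (M : 'I_(2 * r) -> 'I_(2 * r)) : Prop :=
  noncrossing_matching M /\
  forall u v, u \in white_vertices G -> v \in white_vertices G -> u != v ->
    polygon_weight r u v
      #|[set i | (bdry_nbr G i == u) && (bdry_nbr G (M i) == v)]|.

Definition is_standard (r : nat) (T : 'M[nat]_(r, 2)) : bool :=
  [&& perm_eq [seq T k c | k <- enum 'I_r, c <- enum 'I_2] (iota 1 (2 * r)),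
      [forall k, T k ord0 < T k ord_max] &
      [forall c : 'I_2, forall k : 'I_r, forall l : 'I_r,
         (k < l) ==> (T k c < T l c)]].

Record syt (r : nat) := Syt {
  tableau :> 'M[nat]_(r, 2);
  tableau_standard : is_standard tableau
}.

(* Entries of a column are increasing because [enum 'I_(2 * r)] is. *)
Definition matching_tableau (r : nat) (M : 'I_(2 * r) -> 'I_(2 * r)) :
    'M[nat]_(r, 2) :=
  \matrix_(k, c)
    nth 0 [seq i.+1 | i : 'I_(2 * r) <- enum 'I_(2 * r)
           & if c == ord0 then i < M i else M i < i] k.

(* [omega G T] reads "omega(G) = T", and similarly for [pi] and [Phi] below. *)
Definition omega (r : nat) (G : hgraph (2 * r)) (T : syt r) : Prop :=
  exists2 M : 'I_(2 * r) -> 'I_(2 * r),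
    strand_matching G M & tableau T = matching_tableau M.

Section Pi.
Variables (r : nat) (T : syt r).
Implicit Types (p q : nat * nat) (S : seq (nat * nat)).

Definition north_step (i : nat) : bool := [exists k, T k ord0 == i].

(* The point of path(T) reached after k steps. *)
Definition path_point (k : nat) : nat * nat :=
  let h := count north_step (iota 1 k) in ((k - h).+1, h).

Definition nw_corners : seq (nat * nat) :=
  [seq path_point k | k <- iota 1 (2 * r).-1
   & north_step k && ~~ north_step k.+1].

Definition on_or_below_path p : bool :=
  has (fun k => ((path_point k).1 == p.1) && (p.2 <= (path_point k).2))
      (iota 0 (2 * r).+1).

Definition covered S p : bool :=
  has (fun q => (q.2 == p.2) && (q.1 < p.1) || (q.1 == p.1) && (p.2 < q.2)) S.

Definition available S p : bool :=
  [&& 0 < p.1 <= r, 0 < p.2 <= r, on_or_below_path p, p \notin S &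
      ~~ covered S p].

Definition nw_most S p : Prop :=
  available S p /\
  forall q, available S q -> q.1 <= p.1 -> p.2 <= q.2 -> q = p.

Inductive marking : seq (nat * nat) -> Prop :=
| marking_corners : marking nw_corners
| marking_add S p : marking S -> nw_most S p -> marking (p :: S).

(* With [i : 'I_r] standing for i + 1, the condition w(r + 1 - y) = x relates
   the marker (x, y) = ((w i).+1, r - i) to [i]. *)
Definition pi (w : 'S_r) : Prop :=
  exists2 S, marking S & (forall p, ~~ available S p) /\
    S =i [seq ((w i).+1, r - i) | i : 'I_r <- enum 'I_r].

End Pi.

Definition Phi (r : nat) (G : hgraph (2 * r)) (w : 'S_r) : Prop :=
  exists2 T : syt r, omega G T & pi T w.

Definition contains (r : nat) (w : 'S_r) (s : seq nat) : Prop :=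
  exists f : 'I_(size s) -> 'I_r,
    {homo f : a b / a < b} /\
    forall a b, (w (f a) < w (f b)) = (nth 0 s a < nth 0 s b).

Definition avoids (r : nat) (w : 'S_r) (s : seq nat) : Prop := ~ contains w s.

(* Main.v *)
Require Import Defs.
From mathcomp Require Import all_boot perm matrix zify.
(* Imported again so that [rot] is the rotation of an [hgraph], not [seq.rot]. *)
Import Defs.
Set Implicit Arguments.
Unset Strict Implicit.
Unset Printing Implicit Defensive.

(* Forest webs and permutations are both described by the short arcs, between
   cyclically consecutive points, of a noncrossing matching.

   Counting multiplicities in a forest web gives two more white vertices than
   interior black ones, and as the latter have degree at least 3, acyclicity
   leaves at most one of them.  By Euler's formula the web is then determined by
   its cuts, the two or three boundary points whose successor is adjacent to
   another white vertex.  Its strand matchings are the noncrossing matchings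
   whose set of short arcs is the set of cuts; there is exactly one.

   On the other side, pi(T) = w means that the Rothe diagram of w is the Young
   diagram above the path of T, which accounts for 132-avoidance.  The short arcs,
   except the one through the last point, are the peaks of the path; they are the
   left-to-right minima of w.  With at most three short arcs there is no pattern
   4321; a pattern 3214 uses up all three on peaks, so the arc between the last
   and the first point is missing, the path returns to the diagonal and w splits
   into two antidiagonal blocks, which 3214 cannot fit.
   Conversely, four short arcs produce one of these patterns by the pigeonhole
   principle. *)

(** * The map pi and Rothe diagrams *)

(** A web lives on an arbitrary type of darts, so [Phi] is evaluated only on the explicit model
    [canonical_web], which has the cuts as parameters, and carried along isotopies. What fixes the
    rotation of an unknown web is its faces: each meets the boundary circle in gaps between
    consecutive points. Euler's formula gives [n] faces if there is an interior black vertex and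
    [n - 1] otherwise, so the gaps lie in distinct faces except for one pair in the second case, and
    this dictates which dart follows each boundary edge.

    The weights [r - part_size] come from a linear system: if three parts with [2 * r] points in all
    are matched without arcs inside a part, two of them are joined by [r] minus the size of the
    third. This is also the multiplicity that degree [r] forces on the edge from the white vertex of
    the third part to the black one. So the conditions on strand matchings amount to having the cuts
    as short arcs.

    The marking process of [pi] leaves choices. They are harmless because a complete marking is a
    kernel of the covering relation, and such a kernel is unique. *)

Lemma card_ord_ltn n k : #|[pred l : 'I_n | l < k]| = minn k n.
Proof.
elim: k => [|k IHk]; first by rewrite min0n; apply: eq_card0 => l; rewrite !inE.
case: (ltnP k n) => hk; last first.
  rewrite (@eq_card _ _ [pred l : 'I_n | l < k]) ?IHk; first by lia.
  by move=> l; rewrite !inE; have := ltn_ord l; lia.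
rewrite (cardD1 (Ordinal hk)) inE /= ltnSn.
rewrite (@eq_card _ _ [pred l : 'I_n | l < k]) ?IHk; first by lia.
move=> l; rewrite !inE -val_eqE /=; lia.
Qed.

Lemma card_ord_interval n a b :
  b < n -> #|[pred l : 'I_n | a < l <= b]| = b - a.
Proof.
move=> hb; have hle := card_ord_ltn n b.+1.
have := cardID [pred l : 'I_n | l < a.+1] [pred l : 'I_n | l < b.+1].
rewrite hle (@eq_card _ [predD _ & _] [pred l : 'I_n | a < l <= b]); last first.
  by move=> l; rewrite !inE /=; lia.
rewrite (@eq_card _ [predI _ & _] [pred l : 'I_n | l < minn a.+1 b.+1]); last first.
  by move=> l; rewrite !inE /=; lia.
rewrite card_ord_ltn; move: #|_| => N; lia.
Qed.

Section Marking.
Variables (r : nat) (T : syt r).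
Implicit Types (p q : nat * nat) (S : seq (nat * nat)) (k l i v : 'I_r).

Lemma col0_mono k l : k < l -> T k ord0 < T l ord0.
Proof.
have /and3P[_ _ /forallP/(_ ord0)/forallP/(_ k)/forallP/(_ l)/implyP] :=
  tableau_standard T.
exact.
Qed.

Lemma row_mono k : T k ord0 < T k ord_max.
Proof. by have /and3P[_ /forallP h _] := tableau_standard T; apply: h. Qed.

Lemma entry_range k c : 0 < T k c <= 2 * r.
Proof.
have /and3P[/perm_mem hp _ _] := tableau_standard T.
have := hp (T k c); rewrite mem_iota => hk.
have -> : (0 < T k c <= 2 * r) = (0 < T k c < 1 + 2 * r) by lia.
rewrite -hk; apply/allpairsP; exists (k, c) => /=.
by rewrite !mem_enum.
Qed.

Lemma col0_inj : injective (fun k => T k ord0).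
Proof.
move=> k l /= e; apply: val_inj.
by case: (ltngtP k l) => // /col0_mono; rewrite e ltnn.
Qed.

Lemma col0_gap k l : k <= l -> T k ord0 + (l - k) <= T l ord0.
Proof.
move=> kl; have [d hd] : exists d, (l - k)%N = d by eexists.
elim: d l kl hd => [|d IH] l kl hd.
  have -> : l = k by apply: val_inj => /=; lia.
  lia.
have hl' : (l : nat).-1 < r by have := ltn_ord l; lia.
have h1 := IH (Ordinal hl') _ _; rewrite /= in h1.
have h2 : T (Ordinal hl') ord0 < T l ord0 by apply: col0_mono => /=; lia.
move: (h1 ltac:(lia) ltac:(lia)); lia.
Qed.

(** The entries smaller than [T k ord0] all lie in the first [k] rows, at most two per row: in a row
    [l >= k] the first entry is already at least [T k ord0]. *)
Lemma col0_le k : T k ord0 <= k.*2.+1.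
Proof.
have /and3P[/seq.permP/(_ (fun e => e < T k ord0)) hp _ _] := tableau_standard T.
have he : count (fun e => e < T k ord0) (iota 1 (2 * r)) = (T k ord0).-1.
  have := entry_range k ord0; set x := T k ord0; move: (2 * r) => N hx.
  have -> : N = x.-1 + (N - x.-1) by lia.
  rewrite iotaD count_cat.
  rewrite (eq_in_count (a2 := predT)); last by move=> e; rewrite mem_iota /=; lia.
  rewrite count_predT size_iota.
  rewrite (eq_in_count (a2 := pred0)); last by move=> e; rewrite mem_iota /=; lia.
  by rewrite count_pred0 addn0.
move: hp; rewrite he => hp.
suff : (T k ord0).-1 <= k.*2 by lia.
rewrite -hp count_flatten sumnE big_map big_map big_enum /=.
apply: (@leq_trans (\sum_(l : 'I_r) (l < k).*2)).
  apply: leq_sum => l _; rewrite enum_ordSl enum_ordSl /=.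
  have -> : enum 'I_0 = [::] by apply: size0nil; rewrite size_enum_ord.
  rewrite /= addn0 /=.
  have := row_mono l; have -> : lift ord0 ord0 = ord_max :> 'I_2 by apply: val_inj.
  case: (ltnP l k) => [lk|kl]; first by lia.
  have := col0_gap kl; lia.
have -> : \sum_(l : 'I_r) (l < k).*2 = #|[pred l : 'I_r | l < k]|.*2.
  by rewrite -sum1_card -muln2 big_distrl /= [RHS]big_mkcond; apply: eq_bigr => l _; rewrite !inE; case: (l < k).
by rewrite card_ord_ltn; lia.
Qed.

Definition north_count (k : nat) := #|[pred l : 'I_r | T l ord0 <= k]|.

Lemma north_countE (k : nat) : count (north_step T) (iota 1 k) = north_count k.
Proof.
elim: k => [|k IHk].
  rewrite /north_count /=; symmetry; apply: eq_card0 => l; rewrite !inE.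
  have := entry_range l ord0; lia.
rewrite -(addn1 k) iotaD count_cat IHk /= addn0 add1n.
rewrite /north_count /north_step; case: existsP => [[l /eqP hl]|hno].
  rewrite [RHS](cardD1 l) !inE hl addnC; have -> : k.+1 <= k + 1 by lia.
  congr (_ + _).
  apply: eq_card => l'; rewrite !inE -(inj_eq col0_inj) hl; lia.
rewrite addn0; apply: eq_card => l; rewrite !inE.
have : T l ord0 != k.+1 by apply/eqP => e; apply: hno; exists l; apply/eqP.
lia.
Qed.

Lemma path_pointE (k : nat) :
  path_point T k = ((k - north_count k).+1, north_count k).
Proof. by rewrite /path_point north_countE. Qed.

(** The first column increases, so the rows whose first entry is at most [m] form an initial
    segment. *)
Lemma north_count_geq k m : (k < north_count m) = (T k ord0 <= m).
Proof.
apply/idP/idP => h.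
  apply: contraLR h; rewrite -!ltnNge => h; rewrite ltnS.
  have -> : (k : nat) = #|[pred l : 'I_r | l < k]|.
    by rewrite card_ord_ltn; have := ltn_ord k; lia.
  apply: subset_leq_card; apply/subsetP => l; rewrite !inE.
  case: (ltnP l k) => // kl; have := col0_gap kl; lia.
have -> : (k : nat).+1 = #|[pred l : 'I_r | l < k.+1]|.
  by rewrite card_ord_ltn; have := ltn_ord k; lia.
apply: subset_leq_card; apply/subsetP => l; rewrite !inE => lk.
have hlk : l <= k by lia.
have := col0_gap hlk; lia.
Qed.

Lemma north_count_leq m : north_count m <= r.
Proof. by rewrite /north_count -[X in _ <= X]card_ord max_card. Qed.

Lemma north_count_all : north_count (2 * r) = r.
Proof.
rewrite /north_count -[RHS]card_ord; apply: eq_card => l; rewrite !inE.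
by have /andP[_ ->] := entry_range l ord0.
Qed.

Lemma north_count_step m : north_count m.+1 = north_count m + north_step T m.+1.
Proof. by rewrite -!north_countE -(addn1 m) iotaD count_cat /= addn0 add1n addn1. Qed.

Lemma north_countS m : north_count m <= north_count m.+1 <= (north_count m).+1.
Proof. by rewrite north_count_step; case: north_step; lia. Qed.

Lemma north_count_lem m : north_count m <= m.
Proof.
elim: m => [|m IH]; first by rewrite -north_countE.
have := north_countS m; lia.
Qed.

Lemma north_count_mono m m' : m <= m' ->
  north_count m <= north_count m' /\ m - north_count m <= m' - north_count m'.
Proof.
move=> /subnK <-; elim: (m' - m) => [|d IH]; first by rewrite add0n.
have := north_countS (d + m); have := north_count_lem (d + m).
rewrite addSn; lia.
Qed.

(** The path reaches height [k.+1] with step number [T k ord0], at abscissa [T k ord0 - k]; on this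
    height exactly the points from there eastwards are on or below the path. *)
Lemma on_or_below_pathE (x : nat) k :
  0 < x <= r -> on_or_below_path T (x, k.+1) = (T k ord0 <= x + k).
Proof.
move=> hx; rewrite /on_or_below_path; apply/hasP/idP => [[m]|hle].
  rewrite mem_iota path_pointE /= => hm /andP[/eqP mx].
  rewrite north_count_geq => hk.
  have [_] := north_count_mono hk.
  have : k < north_count (T k ord0) by rewrite north_count_geq.
  have : north_count (T k ord0) <= k.+1.
    rewrite leqNgt; apply/negP => hgt.
    have hk1 : k.+1 < r by apply: leq_trans hgt (north_count_leq _).
    have := north_count_geq (Ordinal hk1) (T k ord0); rewrite /= hgt.
    have : T k ord0 < T (Ordinal hk1) ord0 by apply: col0_mono => /=; lia.
    lia.
  lia.
(* The largest such [m] gives the last, hence highest, point of the path with abscissa at most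
   [x]. *)
pose P m := (m <= 2 * r) && (m - north_count m < x).
have exP : exists m, P m by exists 0; rewrite /P sub0n; lia.
have ubP m : P m -> m <= 2 * r by case/andP.
case: (ex_maxnP exP ubP) => m /andP[hm1 hm2] hmax.
have hm : m < 2 * r.
  rewrite ltn_neqAle hm1 andbT; apply/eqP => e.
  by move: hm2; rewrite e north_count_all; lia.
have hS : x <= m.+1 - north_count m.+1.
  rewrite leqNgt; apply/negP => h; have := hmax m.+1.
  by rewrite /P h andbT ltnn hm => /(_ isT).
exists m; first by rewrite mem_iota; lia.
rewrite path_pointE /=; have := north_countS m; have := north_count_lem m.
have := north_count_geq k m => hg h1 h2.
have hx1 : m - north_count m = x.-1 by lia.
rewrite hx1 prednK ?eqxx /=; last by lia.
rewrite hg.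
have hT : P (T k ord0).
  rewrite /P; have /andP[_ ->] := entry_range k ord0.
  have : k < north_count (T k ord0) by rewrite north_count_geq.
  by rewrite /=; lia.
exact: hmax.
Qed.

(** Matrix coordinates with rows counted from the top: a marker at [cell i v] is the one that [pi]
    reads as [w i = v]. *)
Definition cell i v : nat * nat := (v.+1, r - i).

(** The length of row [i] of the Young diagram above the path: the north step [T (rev_ord i) ord0]
    is the one reaching the height [r - i] of this row. *)
Definition lam i := T (rev_ord i) ord0 - (r - i).

(** The subtraction in [lam] is not truncated because the first column grows by at least one per
    row; the bound is the ballot condition [col0_le]. *)
Lemma lamE i : T (rev_ord i) ord0 = lam i + (r - i) /\ lam i < r - i.
Proof.
have := ltn_ord i; rewrite /lam.
have h0 : 0 < r by have := ltn_ord i; lia.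
have := @col0_gap (Ordinal h0) (rev_ord i) (leq0n _).
have := entry_range (Ordinal h0) ord0; have := col0_le (rev_ord i) => /=.
lia.
Qed.

Lemma lam_mono i i' : i <= i' -> lam i' <= lam i.
Proof.
move=> le_ii'; have := ltn_ord i; have := ltn_ord i'.
have [h1 _] := lamE i; have [h2 _] := lamE i'.
have := @col0_gap (rev_ord i') (rev_ord i); rewrite /= h1 h2; lia.
Qed.

Lemma cell_below i v : on_or_below_path T (cell i v) = (lam i <= v).
Proof.
have hi := ltn_ord i; have hv := ltn_ord v.
have -> : cell i v = (v.+1, (rev_ord i : 'I_r).+1) by rewrite /cell /=; congr pair; lia.
rewrite on_or_below_pathE; last by lia.
have [-> _] := lamE i; rewrite /=; lia.
Qed.

Definition in_grid p := (0 < p.1 <= r) && (0 < p.2 <= r).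

Lemma cellP p : in_grid p -> exists i v, p = cell i v.
Proof.
case: p => x y /andP[/= hx hy].
have hi : r - y < r by lia.
have hv : x.-1 < r by lia.
exists (Ordinal hi), (Ordinal hv); rewrite /cell /=; congr pair; lia.
Qed.

Lemma cell_inj i v i' v' : cell i v = cell i' v' -> i = i' /\ v = v'.
Proof.
move=> [e1 e2]; have := ltn_ord i; have := ltn_ord i'.
split; apply: val_inj => /=; lia.
Qed.

Lemma cell_in_grid i v : in_grid (cell i v).
Proof. by rewrite /in_grid /=; have := ltn_ord i; have := ltn_ord v; lia. Qed.

Definition covers q p := (q.2 == p.2) && (q.1 < p.1) || (q.1 == p.1) && (p.2 < q.2).

Definition region p := in_grid p && on_or_below_path T p.

Lemma availableE S p : available T S p = [&& region p, p \notin S & ~~ covered S p].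
Proof. by rewrite /available /region /in_grid -!andbA. Qed.

(** Increases along rays, hence serves as induction measure for kernels and as selector of
    northwest-most points. *)
Definition nw_rank p := p.1 + (r - p.2).

Lemma covers_rank p q : in_grid q -> covers q p -> nw_rank q < nw_rank p.
Proof. by rewrite /in_grid /covers /nw_rank; lia. Qed.

(* The complete markings are the kernels of [covers] on [region]. *)
Definition kernel (S : seq (nat * nat)) :=
  forall p, (p \in S) = region p && ~~ covered S p.

Lemma coveredP S p : reflect (exists2 q, q \in S & covers q p) (covered S p).
Proof. exact: hasP. Qed.

(** Whether a point belongs to a kernel depends only on the points covering it, which have smaller
    rank. *)
Lemma kernel_unique S S' : kernel S -> kernel S' -> S =i S'.
Proof.
move=> kS kS' p; have [m] := ubnP (nw_rank p); elim: m p => // m IH p hp.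
rewrite kS kS'; case reg: (region p) => //=; congr negb.
have gp : in_grid p by case/andP: reg.
apply/coveredP/coveredP => -[q qS cq]; exists q => //.
  rewrite -IH //; move: qS; rewrite kS => /andP[/andP[gq _] _].
  by have := covers_rank gq cq; lia.
rewrite IH //; move: qS; rewrite kS' => /andP[/andP[gq _] _].
by have := covers_rank gq cq; lia.
Qed.

(** The invariant of the marking process. The second clause keeps markers from being covered later:
    a point whose rays would reach a marker is itself already covered and so never becomes
    available. *)
Definition sound_marking S :=
  [/\ {subset S <= region},
      forall p q, p \in S -> region q -> covers q p -> covered S q
    & forall p q, p \in S -> q \in S -> ~~ covers q p].

Lemma sound_corners : sound_marking (nw_corners T).
Proof.
have corner p : p \in nw_corners T -> exists k,
    [/\ p = ((T k ord0 - k), k.+1), T k ord0 - k <= r &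
        forall l, k < l -> T k ord0 + (l - k) < T l ord0].
  case/mapP => m; rewrite mem_filter mem_iota => /andP[/andP[/existsP[k /eqP hk] hS] hm] ->.
  exists k; rewrite path_pointE.
  have nk : north_count m = k.+1.
    apply/eqP; rewrite eqn_leq north_count_geq hk leqnn andbT leqNgt.
    apply/negP => h; have hk1 : k.+1 < r by apply: leq_trans h (north_count_leq _).
    have := north_count_geq (Ordinal hk1) m; rewrite /= h => /esym.
    rewrite -hk leqNgt => /negP[]; exact: col0_mono.
  have := north_count_step m; rewrite (negbTE hS) addn0 nk => nS.
  have := north_count_lem m; rewrite nk => hkm.
  split.
  - by rewrite hk; congr pair; lia.
  - have [] := @north_count_mono m.+1 (2 * r) ltac:(lia).
    rewrite nS north_count_all hk; lia.
  - move=> l kl; have hk1 : k.+1 < r by have := ltn_ord l; lia.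
    have := @col0_gap (Ordinal hk1) l kl.
    have : T k ord0 < T (Ordinal hk1) ord0 by apply: col0_mono.
    have : T (Ordinal hk1) ord0 != m.+1.
      by apply: contra hS => /eqP e; apply/existsP; exists (Ordinal hk1); rewrite e.
    rewrite hk /=; lia.
(* The points west of a corner in its row and north of it in its column are above the path, so the
   second and third clauses are immediate for corners. *)
have nocover p q : p \in nw_corners T -> region q -> ~~ covers q p.
  case/corner => k [-> hr hgap] /andP[gq]; have [i [v eq]] := cellP gq; subst q.
  have hi := ltn_ord i; have hk := ltn_ord k.
  rewrite cell_below /covers /= => hv; have [eT _] := lamE i.
  apply/negP => /orP[/andP[/eqP e hlt]|/andP[/eqP e hlt]].
    have ek : rev_ord i = k by apply: val_inj => /=; lia.
    by move: eT; rewrite ek; lia.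
  have := hgap (rev_ord i); rewrite eT /=; lia.
have corner_region p : p \in nw_corners T -> region p.
  case/corner => k [-> hr hgap]; have hk := ltn_ord k; have hT := entry_range k ord0.
  have h0 : 0 < r by lia.
  have := @col0_gap (Ordinal h0) k (leq0n _); have := entry_range (Ordinal h0) ord0.
  move=> /= h1 h2; rewrite /region /in_grid on_or_below_pathE /=; lia.
split=> [p /corner_region //|p q pS rq cq|p q pS /corner_region].
  by case/negP: (nocover _ _ pS rq).
exact: nocover.
Qed.

Lemma sound_markingP S : marking T S -> sound_marking S.
Proof.
elim=> [|{}S p _ [S1 S2 S3] [avp nwp]]; first exact: sound_corners.
move: (avp); rewrite availableE => /and3P[rp npS ncp].
have cov_cons a b : covered S a -> covered (b :: S) a by rewrite /covered /= => ->; rewrite orbT.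
(* An uncovered [q] would either be a marker, so that [p] is covered, or be available to the
   northwest of [p], against the choice of [p]. *)
have hp q : region q -> covers q p -> covered S q.
  move=> rq cq; apply: contraR ncp => ncq.
  have qS : q \in S.
    apply: contraT => nqS; have e : q = p.
      apply: nwp; first by rewrite availableE rq nqS.
        by move: cq; rewrite /covers; lia.
      by move: cq; rewrite /covers; lia.
    by move: cq; rewrite e /covers !ltnn !andbF.
  by apply/coveredP; exists q.
split.
- by move=> q; rewrite inE => /predU1P[->|/S1].
- move=> q q'; rewrite inE => /predU1P[->|qS] rq' cq'; apply: cov_cons; first exact: hp.
  exact: S2 qS rq' cq'.
- move=> q q'; rewrite !inE => /predU1P[->|qS] /predU1P[->|q'S].
  + by rewrite /covers !ltnn !andbF.
  + by apply: contra ncp => c; apply/coveredP; exists q'.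
  + by apply: contra ncp => c; apply: S2 qS rp c.
  + exact: S3.
Qed.

Lemma complete_marking_kernel S :
  marking T S -> (forall p, ~~ available T S p) -> kernel S.
Proof.
move=> /sound_markingP[S1 S2 S3] noav p; apply/idP/andP => [pS|[rp ncp]].
  split; first exact: S1.
  by apply/coveredP => -[q qS cq]; case/negP: (S3 _ _ pS qS).
by have := noav p; rewrite availableE rp ncp andbT negbK.
Qed.

Lemma marking_completes : exists2 S, marking T S & forall p, ~~ available T S p.
Proof.
pose grid := [seq cell i v | i <- enum 'I_r, v <- enum 'I_r].
have gridP p : in_grid p -> p \in grid.
  move=> /cellP[i [v ->]]; apply/allpairsP; exists (i, v); split; rewrite /= ?mem_enum //.
have avg S p : available T S p -> p \in grid.
  by rewrite availableE => /and3P[/andP[gp _] _ _]; exact: gridP.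
suff H m S : marking T S -> count (available T S) grid < m ->
    exists2 S, marking T S & forall p, ~~ available T S p.
  exact: H (marking_corners T) (ltnSn _).
elim: m S => // m IH S mS; rewrite ltnS => hm.
case hav: (has (available T S) grid); last first.
  exists S => // p; apply: contraFN hav => avp.
  by apply/hasP; exists p => //; exact: avg avp.
(* An available point of least [nw_rank] is northwest-most, and marking it lowers the number of
   available points. *)
pose P (k : nat) := has (fun p => available T S p && (nw_rank p == k)) grid.
have exP : exists k : nat, P k.
  case/hasP: hav => p pg avp; exists (nw_rank p); apply/hasP; exists p => //.
  by rewrite avp eqxx.
case: (ex_minnP exP) => k /hasP[p pg /andP[avp /eqP ek]] kmin.
have nw : nw_most T S p.
  split=> // q avq; have := kmin (nw_rank q).
  have -> : P (nw_rank q) by apply/hasP; exists q; rewrite ?(avg _ _ avq) // avq eqxx.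
  move=> /(_ isT); rewrite -ek; case: p q avp avq {pg ek} => [x y] [x' y'].
  rewrite /nw_rank !availableE /region /in_grid /= => *; congr pair; lia.
apply: (IH (p :: S)); first exact: marking_add.
apply: leq_trans hm; rewrite -!size_filter.
apply: (@leq_trans (size (rem p [seq x <- grid | available T S x])).+1).
  rewrite ltnS; have ug : uniq grid.
    apply: allpairs_uniq; rewrite ?enum_uniq // => -[i v] [i' v'] _ _ /= e.
    by have [-> ->] := cell_inj e.
  apply: uniq_leq_size; first exact: filter_uniq.
  move=> q; rewrite mem_filter rem_filter ?filter_uniq // !mem_filter /= => /andP[avq ->].
  move: avq; rewrite !availableE andbT => /and3P[-> ]; rewrite inE negb_or => /andP[-> ->].
  by rewrite /covered /= negb_or => /andP[_ ->].
rewrite size_rem; last by rewrite mem_filter avp.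
by rewrite prednK // size_filter -has_count.
Qed.

Definition marker_graph (w : 'S_r) := [seq cell i (w i) | i : 'I_r <- enum 'I_r].

Definition rothe (w : 'S_r) i v := (v < w i) && (i < w^-1%g v).

Lemma mem_marker_graph w i v : (cell i v \in marker_graph w) = (w i == v).
Proof.
apply/mapP/eqP => [[i' _ /cell_inj[-> ->]] //|<-].
by exists i; rewrite ?mem_enum.
Qed.

Lemma covered_marker_graph w i v :
  covered (marker_graph w) (cell i v) = (w i < v) || (w^-1%g v < i).
Proof.
apply/coveredP/orP => [[_ /mapP[i' _ ->]]|].
  have := ltn_ord i; have := ltn_ord i'; rewrite /covers /= => hi' hi.
  case/orP=> /andP[/eqP e hlt].
    by left; have <- : i' = i by apply: val_inj => /=; lia.
  right; have -> : v = w i' by apply: val_inj => /=; lia.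
  by rewrite permK; lia.
case=> h; [exists (cell i (w i))|exists (cell (w^-1%g v) v)].
- by apply/mapP; exists i; rewrite ?mem_enum.
- by rewrite /covers /= eqxx; lia.
- by apply/mapP; exists (w^-1%g v); rewrite ?mem_enum // permKV.
- by rewrite /covers /= eqxx; have := ltn_ord i; lia.
Qed.

(** The cells that are neither markers nor covered by one are exactly those of the Rothe diagram.
    For a kernel they are also exactly the cells above the path: each cell of the region is marked
    or covered, and no ray leaves the region, as it is closed to the east and to the south. *)
Lemma kernel_marker_graph w :
  kernel (marker_graph w) <-> forall i v, rothe w i v = (v < lam i).
Proof.
have inv_eq i v : (w i == v) = (w^-1%g v == i).
  by rewrite -(inj_eq (@perm_inj _ w^-1%g)) permK eq_sym.
split=> [ker i v|char p].
  have := ker (cell i v); rewrite mem_marker_graph covered_marker_graph.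
  rewrite /region cell_in_grid cell_below /= /rothe.
  case: (leqP (lam i) v) => hl e.
    apply/negbTE; move: e; have := inv_eq i v; rewrite -!val_eqE /=; lia.
  have reg i' v' : w i' = v' -> lam i' <= v'.
    move=> ew; have := ker (cell i' v').
    by rewrite mem_marker_graph ew eqxx /region cell_in_grid cell_below => /esym/andP[].
  have h1 := reg i _ erefl; have h2 := reg (w^-1%g v) v (permKV _ _).
  have := @lam_mono (w^-1%g v) i; lia.
have [gp|ngp] := boolP (in_grid p); last first.
  rewrite /region (negbTE ngp); apply/mapP => -[i _ e].
  by rewrite e cell_in_grid in ngp.
have [i [v ->]] := cellP gp.
rewrite mem_marker_graph covered_marker_graph /region cell_in_grid cell_below /=.
have := char i v; have := inv_eq i v; rewrite /rothe -!val_eqE /=; lia.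
Qed.

(** Two markers in one row or column would cover one another, so it remains to find a marker in
    every row. *)
Lemma kernel_is_graph S : kernel S -> exists w, S =i marker_graph w.
Proof.
move=> ker.
have reg i v : cell i v \in S -> lam i <= v.
  by rewrite ker /region cell_in_grid cell_below => /andP[].
have row_uniq i v v' : cell i v \in S -> cell i v' \in S -> v = v'.
  move=> h h'; apply: val_inj; case: (ltngtP v v') => // hlt.
    by move: h'; rewrite ker => /andP[_ /coveredP[]]; exists (cell i v); rewrite // /covers /= eqxx; lia.
  by move: h; rewrite ker => /andP[_ /coveredP[]]; exists (cell i v'); rewrite // /covers /= eqxx; lia.
have col_uniq i i' v : cell i v \in S -> cell i' v \in S -> i = i'.
  have hi := ltn_ord i; have hi' := ltn_ord i'.
  move=> h h'; apply: val_inj; case: (ltngtP i i') => // hlt.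
    move: h'; rewrite ker => /andP[_ /coveredP[]]; exists (cell i v); rewrite // /covers /= eqxx; lia.
  move: h; rewrite ker => /andP[_ /coveredP[]]; exists (cell i' v); rewrite // /covers /= eqxx; lia.
(* In a row [i] without marker each cell of the region is covered from above. The [r - lam i]
   columns concerned have markers in distinct rows above [i], but [r - lam i > i]. *)
have row_ex i : exists v, cell i v \in S.
  apply/existsP; apply: contraT; rewrite negb_exists => /forallP nrow.
  have col v : lam i <= v -> exists2 i' : 'I_r, i' < i & cell i' v \in S.
    move=> hl; have := ker (cell i v).
    rewrite (negbTE (nrow v)) /region cell_in_grid cell_below hl /=.
    move=> /esym/negbT; rewrite negbK => /coveredP[q qS].
    have gq : in_grid q by move: qS; rewrite ker => /andP[/andP[]].
    have [i' [v' eq]] := cellP gq; subst q.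
    have hi := ltn_ord i; have hi' := ltn_ord i'.
    rewrite /covers /= => /orP[/andP[/eqP e hlt]|/andP[/eqP e hlt]].
      have ei : i' = i by apply: val_inj => /=; lia.
      by rewrite ei (negbTE (nrow v')) in qS.
    have ev : v' = v by apply: val_inj => /=; lia.
    by exists i'; [lia|rewrite -ev].
  pose f v := odflt i [pick i' : 'I_r | (i' < i) && (cell i' v \in S)].
  have fP v : lam i <= v -> (f v < i) && (cell (f v) v \in S).
    rewrite /f => /col[i' h1 h2]; case: pickP => //= /(_ i').
    by rewrite h1 h2.
  have finj : {in [pred v : 'I_r | lam i <= v] &, injective f}.
    move=> v v'; rewrite !inE => /fP/andP[_ h] /fP/andP[_ h'] e.
    by rewrite e in h; apply: row_uniq h h'.
  have := card_in_image finj.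
  have [_ hlam] := lamE i; have hi := ltn_ord i.
  have -> : #|[pred v : 'I_r | lam i <= v]| = r - lam i.
    have := cardC [pred v : 'I_r | v < lam i]; rewrite card_ord_ltn card_ord.
    rewrite (@eq_card _ [predC _] [pred v : 'I_r | lam i <= v]); last by move=> v; rewrite !inE /= -leqNgt.
    move: #|_| => N; lia.
  move=> hcard.
  have : #|image f [pred v : 'I_r | lam i <= v]| <= #|[pred i' : 'I_r | i' < i]|.
    apply: subset_leq_card; apply/subsetP => _ /imageP[v hv ->].
    by rewrite inE; case/andP: (fP v hv).
  by rewrite hcard card_ord_ltn; lia.
pose f i := xchoose (row_ex i).
have fP i : cell i (f i) \in S by exact: xchooseP (row_ex i).
have finj : injective f.
  by move=> i i' e; apply: (col_uniq i i' (f i)); rewrite // e.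
exists (perm finj) => p; apply/idP/mapP => [pS|[i _ ->]]; last by rewrite permE.
have gp : in_grid p by move: pS; rewrite ker => /andP[/andP[]].
have [i [v e]] := cellP gp; exists i; first by rewrite mem_enum.
by rewrite permE e; congr cell; apply: (row_uniq i); rewrite -?e.
Qed.

Lemma pi_rothe w : Defs.pi T w <-> forall i v, rothe w i v = (v < lam i).
Proof.
rewrite -kernel_marker_graph; split=> [[S mS [noav eS]] p|ker].
  have ker := complete_marking_kernel mS noav.
  rewrite -/(marker_graph w) in eS *; rewrite -eS ker; congr (_ && ~~ _).
  by apply/coveredP/coveredP => -[q qS c]; exists q; rewrite // ?eS // -eS.
have [S mS noav] := marking_completes; exists S => //; split=> //.
exact: kernel_unique (complete_marking_kernel mS noav) ker.
Qed.

Lemma pi_exists : exists w, Defs.pi T w.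
Proof.
have [S mS noav] := marking_completes; have ker := complete_marking_kernel mS noav.
by have [w eS] := kernel_is_graph ker; exists w, S.
Qed.

Lemma pi_functional w w' : Defs.pi T w -> Defs.pi T w' -> w = w'.
Proof.
rewrite !pi_rothe -!kernel_marker_graph => k k'; apply/permP => i.
have := kernel_unique k k' (cell i (w i)).
by rewrite !mem_marker_graph eqxx => /esym/eqP.
Qed.
End Marking.

(** * Tableaux of noncrossing matchings *)

Section FilterEnum.
Variables (n : nat) (P : pred 'I_n) (i0 : 'I_n).
Let s := [seq i <- enum 'I_n | P i].

Lemma mem_filter_enum i : (i \in s) = P i.
Proof. by rewrite mem_filter mem_enum andbT. Qed.

Lemma size_filter_enum : size s = #|P|.
Proof.
rewrite cardE /s /enum_mem; congr size; rewrite -filter_predI.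
by apply: eq_filter => i; rewrite /= andbT.
Qed.

Lemma nth_filter_enum k : k < size s -> P (nth i0 s k).
Proof. by move=> hk; rewrite -mem_filter_enum mem_nth. Qed.

Lemma filter_enum_sorted : sorted ltn [seq val i | i <- s].
Proof.
have sub : subseq [seq val i | i <- s] (iota 0 n).
  by rewrite -val_enum_ord map_subseq // filter_subseq.
exact: (subseq_sorted ltn_trans sub (iota_ltn_sorted _ _)).
Qed.

Lemma nth_filter_enum_mono k l :
  k < size s -> l < size s -> (nth i0 s k < nth i0 s l) = (k < l).
Proof.
move=> hk hl.
have homo a b : a < size s -> b < size s -> a < b -> nth i0 s a < nth i0 s b.
  move=> ha hb hab; have h := @sorted_ltn_nth _ _ ltn_trans 0 _ filter_enum_sorted a b.
  by move: h; rewrite !inE size_map !(nth_map i0) //; apply.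
case: (ltngtP k l) => [|h|->]; last by rewrite ltnn.
  exact: homo.
by apply/negbTE; rewrite -leqNgt ltnW // homo.
Qed.

Lemma filter_enum_uniq : uniq s.
Proof. by rewrite filter_uniq ?enum_uniq. Qed.

Lemma rank_filter_enum k : k < size s ->
  #|[pred i | P i && (i < nth i0 s k)]| = k.
Proof.
move=> hk; rewrite -[RHS](@size_takel k _ s); last exact: ltnW.
rewrite -(card_uniqP (take_uniq k filter_enum_uniq)).
apply: eq_card => i; rewrite !inE -mem_filter_enum.
case hi : (i \in s) => /=; last by apply/esym/negbTE; apply: contraFN hi; apply: mem_take.
rewrite in_take // -{1}(nth_index i0 hi) nth_filter_enum_mono //.
by rewrite index_mem.
Qed.
End FilterEnum.

Lemma closerN n (M : 'I_n -> 'I_n) (M_neq : forall i, M i != i) i :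
  (M i < i) = ~~ (i < M i).
Proof. by have := M_neq i; rewrite -val_eqE /=; case: ltngtP. Qed.

Section Matching.
Variables (r : nat) (M : 'I_(2 * r) -> 'I_(2 * r)).
Local Notation n := (2 * r).
Hypotheses (MK : involutive M) (M_neq : forall i, M i != i).
Implicit Types (i j : 'I_n) (k l : 'I_r).

Let opener i := i < M i.
Let closer i := M i < i.
Let M_inj : injective M := inv_inj MK.

Lemma card_openers_lt m :
  #|[pred i | opener i && (i < m)]| + #|[pred i | closer i && (i < m)]| = minn m n.
Proof.
rewrite -card_ord_ltn -(cardID opener [pred l : 'I_n | l < m]).
rewrite (@eq_card _ [pred i | opener i && (i < m)] [predI [pred l : 'I_n | l < m] & opener]).
  rewrite (@eq_card _ [pred i | closer i && (i < m)] [predD [pred l : 'I_n | l < m] & opener]) //.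
  by move=> i; rewrite !inE /closer (closerN M_neq).
by move=> i; rewrite !inE andbC.
Qed.

(** [M] maps the closers before [m] injectively to openers before [m]: the ballot condition. *)
Lemma card_closers_lt m :
  #|[pred i | closer i && (i < m)]| <= #|[pred i | opener i && (i < m)]|.
Proof.
rewrite -(card_in_imset (f := M)); last by move=> x y _ _; apply: M_inj.
apply: subset_leq_card; apply/subsetP => y /imsetP[i hi ->]; move: hi; rewrite !inE /opener /closer MK.
lia.
Qed.

Lemma card_openers : #|[pred i | opener i]| = r /\ #|[pred i | closer i]| = r.
Proof.
have e : #|[pred i | opener i]| = #|[pred i | closer i]|.
  rewrite -(card_in_imset (f := M)); last by move=> x y _ _; apply: M_inj.
  apply: eq_card => i; rewrite !inE; apply/imsetP/idP => [[j]|ci].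
    by rewrite inE => oj ->; rewrite /closer MK.
  by exists (M i); rewrite ?MK // inE /opener MK.
have := cardC opener; rewrite card_ord.
have -> : #|[predC opener]| = #|[pred i | closer i]|.
  by apply: eq_card => i; rewrite !inE /closer (closerN M_neq).
have -> : #|opener| = #|[pred i | opener i]| by apply: eq_card.
rewrite -e; lia.
Qed.

Lemma size_openers : size [seq i <- enum 'I_n | opener i] = r /\
  size [seq i <- enum 'I_n | closer i] = r.
Proof. by rewrite !size_filter_enum; exact: card_openers. Qed.

Lemma pos_of_ord k : 0 < n.
Proof. by have := ltn_ord k; lia. Qed.

Definition opn k : 'I_n :=
  nth (Ordinal (pos_of_ord k)) [seq i : 'I_n <- enum 'I_n | i < M i] k.
Definition clo k : 'I_n :=
  nth (Ordinal (pos_of_ord k)) [seq i : 'I_n <- enum 'I_n | M i < i] k.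

Lemma matching_tableau_opn k : matching_tableau M k ord0 = (opn k).+1.
Proof.
rewrite mxE eqxx (nth_map (Ordinal (pos_of_ord k))) //.
by case: size_openers => -> _.
Qed.

Lemma matching_tableau_clo k : matching_tableau M k ord_max = (clo k).+1.
Proof.
rewrite mxE -val_eqE /= (nth_map (Ordinal (pos_of_ord k))) //.
by case: size_openers => _ ->.
Qed.

Lemma opnP k : opn k < M (opn k).
Proof. by apply: (@nth_filter_enum n opener); rewrite (proj1 size_openers). Qed.

Lemma cloP k : M (clo k) < clo k.
Proof. by apply: (@nth_filter_enum n closer); rewrite (proj2 size_openers). Qed.

Lemma opn_mono k l : (opn k < opn l) = (k < l).
Proof.
rewrite /opn (bool_irrelevance (pos_of_ord l) (pos_of_ord k)).
by rewrite (@nth_filter_enum_mono n opener) // (proj1 size_openers).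
Qed.

Lemma clo_mono k l : (clo k < clo l) = (k < l).
Proof.
rewrite /clo (bool_irrelevance (pos_of_ord l) (pos_of_ord k)).
by rewrite (@nth_filter_enum_mono n closer) // (proj2 size_openers).
Qed.

Lemma opn_inj : injective opn.
Proof.
move=> k l e; apply: val_inj; have := opn_mono k l; have := opn_mono l k.
by rewrite e ltnn; case: ltngtP.
Qed.

Lemma opn_rank k : #|[pred i | opener i && (i < opn k)]| = k.
Proof. by apply: rank_filter_enum; rewrite (proj1 size_openers). Qed.

Lemma clo_rank k : #|[pred i | closer i && (i < clo k)]| = k.
Proof. by apply: rank_filter_enum; rewrite (proj2 size_openers). Qed.

Lemma opn_surj i : i < M i -> exists k, i = opn k.
Proof.
move=> hi; have his : i \in [seq i <- enum 'I_n | opener i] by rewrite mem_filter_enum.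
have hk : index i [seq i <- enum 'I_n | opener i] < r.
  by apply: leq_trans (eq_leq (proj1 size_openers)); rewrite index_mem.
by exists (Ordinal hk); rewrite /opn /= nth_index.
Qed.

(** Otherwise the points up to [clo k] would contain [k.+1] closers but at most [k] openers. *)
Lemma opn_lt_clo k : opn k < clo k.
Proof.
rewrite ltnNge; apply/negP => hle.
have hlt : clo k < opn k.
  rewrite ltn_neqAle hle andbT; apply/eqP => /val_inj e.
  by have := opnP k; have := cloP k; rewrite e; lia.
have := card_closers_lt (clo k).+1.
have : k < #|[pred i | closer i && (i < (clo k).+1)]|.
  rewrite (cardD1 (clo k)) !inE /= /closer cloP ltnSn ltnS -{1}clo_rank.
  apply: subset_leq_card; apply/subsetP => i; rewrite !inE -val_eqE /closer /=; lia.
have : #|[pred i | opener i && (i < (clo k).+1)]| <= k.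
  apply: leq_trans (eq_leq (opn_rank k)).
  apply: subset_leq_card; apply/subsetP => i; rewrite !inE /=; lia.
lia.
Qed.

Lemma matching_tableau_standard : is_standard (matching_tableau M).
Proof.
have clo_inj : injective clo.
  move=> k l e; apply: val_inj; have := clo_mono k l; have := clo_mono l k.
  by rewrite e ltnn; case: ltngtP.
have cases2 (c : 'I_2) : c = ord0 \/ c = ord_max.
  by case: c => [[|[|c]] hc] //; [left|right]; apply: val_inj.
apply/and3P; split.
(* The [2 * r] entries are distinct and lie between 1 and [2 * r], so they exhaust this range. *)
- have us : uniq [seq matching_tableau M k c | k <- enum 'I_r, c <- enum 'I_2].
    apply: allpairs_uniq; rewrite ?enum_uniq // => -[k c] [l d] _ _ /=.
    case: (cases2 c) => ->; case: (cases2 d) => ->;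
      rewrite ?matching_tableau_opn ?matching_tableau_clo => -[/val_inj].
    + by move/opn_inj->.
    + by move=> e; have := opnP k; have := cloP l; rewrite e; lia.
    + by move=> e; have := opnP l; have := cloP k; rewrite e; lia.
    + by move/clo_inj->.
  apply: uniq_perm => //; first exact: iota_uniq.
  apply: (uniq_min_size us _ _).2.
    move=> x /allpairsP[[k c] [_ _ ->]] /=; rewrite mem_iota.
    case: (cases2 c) => ->; rewrite ?matching_tableau_opn ?matching_tableau_clo.
      by have := ltn_ord (opn k); lia.
    by have := ltn_ord (clo k); lia.
  by rewrite size_iota size_allpairs !size_enum_ord; lia.
- by apply/forallP => k; rewrite matching_tableau_opn matching_tableau_clo ltnS opn_lt_clo.
- apply/forallP => c; apply/forallP => k; apply/forallP => l; apply/implyP => kl.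
  by case: (cases2 c) => ->; rewrite ?matching_tableau_opn ?matching_tableau_clo ltnS ?opn_mono ?clo_mono.
Qed.

Definition matching_syt : syt r := Syt matching_tableau_standard.

Lemma matching_syt_col0 k : matching_syt k ord0 = (opn k).+1.
Proof. exact: matching_tableau_opn. Qed.

End Matching.

(** A short arc is named by its first point clockwise, and the arc from the last point to the first
    is included. For [n = 2] the only arc counts at both of its points, which gives two cuts also
    for [r = 1]. *)
Definition short_arcs (n : nat) (M : 'I_n -> 'I_n) : {set 'I_n} :=
  [set i | M i == ordS i].

Lemma val_ordS n (i : 'I_n) : ordS i = (if i.+1 == n then 0 else i.+1) :> nat.
Proof.
rewrite /=; case: eqP => [->|ne]; first by rewrite modnn.
by rewrite modn_small //; have := ltn_ord i; lia.
Qed.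

Lemma ordS_cases n (i : 'I_n) :
  ordS i = i.+1 :> nat /\ i.+1 < n \/ ordS i = 0 :> nat /\ i.+1 = n.
Proof. by rewrite val_ordS; case: eqP => [->|ne]; [right|left]; have := ltn_ord i; lia. Qed.

Lemma noncrossing_inv n (M : 'I_n -> 'I_n) : noncrossing_matching M -> involutive M.
Proof. by case. Qed.

Lemma noncrossing_neq n (M : 'I_n -> 'I_n) :
  noncrossing_matching M -> forall i, M i != i.
Proof. by case. Qed.

Lemma noncrossing_in n (M : 'I_n -> 'I_n) (i j : 'I_n) :
  noncrossing_matching M -> i < j -> j < M i -> i < M j < M i.
Proof.
case=> MK Mne nc ij jMi; have := nc i j; have := nc (M j) i.
have : M j != M i by apply/eqP => /(inv_inj MK) e; rewrite e ltnn in ij.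
have : M j != i by apply: contraTneq jMi => <-; rewrite MK ltnn.
rewrite -!val_eqE /= MK => h1 h2 h3 h4; apply/negPn/negP => h.
have [h5|h5] : (M j < i) \/ (M i < M j) by lia.
  by apply: h3; split; lia.
by apply: h4; split.
Qed.

Lemma noncrossing_out n (M : 'I_n -> 'I_n) (i j : 'I_n) :
  noncrossing_matching M -> i < M i -> j < i \/ M i < j -> M j < i \/ M i < M j.
Proof.
move=> ncM iM hj; case: (ltnP (M j) i) => [|h1]; first by left.
case: (ltnP (M i) (M j)) => [|h2]; first by right.
have [MK Mne _] := ncM.
have : M j != M i by apply/eqP => /(inv_inj MK) e; move: hj; rewrite e; lia.
have : M j != i by apply/eqP => e; move: hj iM; rewrite -e MK; lia.
rewrite -!val_eqE /= => h3 h4.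
have := @noncrossing_in n M i (M j) ncM; rewrite MK; lia.
Qed.

Section Peaks.
Variables (r : nat) (M : 'I_(2 * r) -> 'I_(2 * r)).
Local Notation n := (2 * r).
Hypothesis ncM : noncrossing_matching M.
Let MK := noncrossing_inv ncM.
Let M_neq := noncrossing_neq ncM.
Let T := matching_syt MK M_neq.
Let lam := lam T.

Lemma opener_then_closer (i j : 'I_n) : j = i.+1 :> nat -> i < M i -> M j < j -> M i = j.
Proof.
move=> ej oi cj; apply: val_inj => /=; apply/eqP; rewrite eqn_leq; apply/andP; split; last lia.
rewrite leqNgt; apply/negP => h.
have := noncrossing_in ncM (i := i) (j := j); lia.
Qed.

(** These rows are the corners of the Young diagram. Phrased with [lam] rather than [w], they depend
    on the matching only; [lam_record] identifies the two values there. *)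
Definition records : {set 'I_r} :=
  [set i : 'I_r | [forall i' : 'I_r, (i' < i) ==> (lam i < lam i')]].

Lemma recordsP (i : 'I_r) : reflect (forall i' : 'I_r, i' < i -> lam i < lam i') (i \in records).
Proof.
rewrite inE; apply: (iffP forallP) => [h i' /(implyP (h i'))//|h i'].
by apply/implyP/h.
Qed.

Let lamT (i : 'I_r) : (opn M (rev_ord i)).+1 = lam i + (r - i).
Proof. by rewrite -(proj1 (lamE T i)) matching_syt_col0. Qed.

Definition peaks := [set i : 'I_n in short_arcs M | i.+1 < n].

(** Openers are numbered from the bottom row upwards. The next opener comes right after opener [k]
    exactly when the next row above has the same length, and then that row is earlier and
    [rev_ord k] is no record; otherwise all earlier rows are longer. *)
Lemma peaksE : peaks = [set opn M (rev_ord i) | i in records].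
Proof.
have opM := opn_mono MK M_neq.
apply/setP => q; rewrite !inE; apply/andP/imsetP => [[/eqP eq hq]|[i /recordsP ri ->{q}]].
  have vq : M q = q.+1 :> nat by rewrite eq val_ordS; case: eqP => //; lia.
  have [k ek] := @opn_surj r M MK M_neq q ltac:(by rewrite vq).
  exists (rev_ord k); last by rewrite rev_ordK.
  apply/recordsP => i' hi'; have := lamT i'; have := lamT (rev_ord k).
  rewrite rev_ordK -ek; have hi := ltn_ord i'; have hk := ltn_ord k.
  have above (l : 'I_r) : k < l -> q.+1 < opn M l.
    rewrite -opM -ek => h; have : opn M l != M q.
      by apply/eqP => e; have := opnP MK M_neq l; rewrite e MK vq; lia.
    by rewrite -val_eqE /= vq; lia.
  have hk1 : k.+1 < r by move: hi' => /=; lia.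
  have := above (rev_ord i') ltac:(move: hi' => /=; lia).
  have := above (Ordinal hk1) (ltnSn k).
  have := @col0_gap r T (Ordinal hk1) (rev_ord i').
  rewrite !matching_syt_col0; move: hi' => /=; lia.
set q := opn M (rev_ord i); have oq : q < M q by exact: opnP.
have hq : q.+1 < n by have := ltn_ord (M q); lia.
rewrite hq; split=> //.
pose j := Ordinal hq; have [cj|oj] := boolP (M j < j).
  have -> : M q = j by apply: opener_then_closer.
  by rewrite -val_eqE /= modn_small.
move: oj; rewrite (closerN M_neq) negbK => oj.
have [k ek] := @opn_surj r M MK M_neq j oj.
have lk : rev_ord i < k by rewrite -opM -ek /=.
have := @col0_gap r T (rev_ord i) k (ltnW lk); rewrite !matching_syt_col0 -ek /=.
have hk := ltn_ord k; have hi := ltn_ord i; move: (lk) => /= lk' hgap.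
have := ri (rev_ord k) ltac:(move=> /=; lia).
have := lamT (rev_ord k); rewrite rev_ordK -ek.
have := lamT i; rewrite -/q /=; lia.
Qed.

Lemma card_peaks : #|peaks| = #|records|.
Proof.
by rewrite peaksE card_imset // => i i' /(opn_inj MK M_neq)/rev_ord_inj.
Qed.

Lemma first_record (i : 'I_r) : exists2 i', i' \in records & lam i' = lam i /\ i' <= i.
Proof.
pose P k := [exists i' : 'I_r, (i' == k :> nat) && (lam i' == lam i)].
have exP : exists k, P k by exists i; apply/existsP; exists i; rewrite !eqxx.
case: (ex_minnP exP) => k /existsP[i' /andP[/eqP ek /eqP e]] kmin.
exists i'; last first.
  by split=> //; rewrite ek; apply: kmin; apply/existsP; exists i; rewrite !eqxx.
apply/recordsP => i'' h; have := lam_mono T (ltnW h).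
rewrite -/lam leq_eqVlt => /predU1P[e'|//].
have := kmin i''; rewrite -ek leqNgt h => /(_ _) hk.
by have := hk; rewrite (_ : P i'') => [/(_ isT)//|]; apply/existsP; exists i''; rewrite eqxx -e' e eqxx.
Qed.

(** Every value of [lam] is taken for the first time at a record. *)
Lemma card_records_ge (s : seq 'I_r) : uniq [seq lam i | i <- s] -> size s <= #|records|.
Proof.
move=> us; have -> : size s = size [seq lam i | i <- s] by rewrite size_map.
rewrite cardE -(size_map lam).
apply: uniq_leq_size => // _ /mapP[i _ ->].
have [i' ri [<- _]] := first_record i.
by apply/mapP; exists i'; rewrite ?mem_enum.
Qed.

Definition last_short : bool := [exists i : 'I_n, (i.+1 == n) && (M i == ordS i)].

Lemma card_short_arcs : #|short_arcs M| = #|records| + last_short.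
Proof.
rewrite -card_peaks -(cardsID [set i : 'I_n | i.+1 < n] (short_arcs M)).
congr (_ + _); first by apply: eq_card => i; rewrite !inE.
rewrite /last_short; case: existsP => [[i /andP[/eqP ei Mi]]|h].
  apply/eqP/cards1P; exists i; apply/setP => j; rewrite !inE.
  apply/andP/eqP => [[hj _]|->]; last by rewrite ei ltnn.
  by apply: val_inj => /=; have := ltn_ord j; lia.
apply/eqP; rewrite cards_eq0; apply/eqP/setP => i; rewrite !inE.
apply/negP => /andP[hi Mi]; apply: h; exists i; rewrite Mi andbT.
by have := ltn_ord i; lia.
Qed.
End Peaks.

(** * Patterns in permutations with few short arcs *)

Lemma containsP r (w : 'S_r) s (i0 : 'I_r) :
  contains w s <-> exists t : nat -> 'I_r,
    (forall x y, x < y < size s -> t x < t y) /\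
    (forall x y, x < size s -> y < size s ->
       (w (t x) < w (t y)) = (nth 0 s x < nth 0 s y)).
Proof.
split=> [[f [fhomo fP]]|[t [thomo tP]]].
  exists (fun x => if insub x is Some a then f a else i0); split=> [x y hxy|x y hx hy].
    have hx : x < size s by lia.
    have hy : y < size s by lia.
    by rewrite !insubT; apply: fhomo => /=; lia.
  by rewrite !insubT fP.
exists (fun a : 'I_(size s) => t a); split=> [a b|a b]; last by apply: tP.
by move=> ab; apply: thomo; rewrite (ltn_ord b) andbT.
Qed.

Lemma syt_inj r (T T' : syt r) : tableau T = tableau T' -> T = T'.
Proof.
by case: T T' => [T hT] [T' hT'] /= e; subst T'; rewrite (bool_irrelevance hT hT').
Qed.

Section Rothe.
Variables (r : nat) (T : syt r) (w : 'S_r).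
Hypothesis rotheE : forall i v, rothe w i v = (v < lam T i).
Implicit Types (i j k : 'I_r).

Lemma lam_le_perm i : lam T i <= w i.
Proof. by rewrite leqNgt -rotheE /rothe ltnn. Qed.

Lemma inversion_lam i j : i < j -> w j < w i -> w j < lam T i.
Proof. by move=> ij h; rewrite -rotheE /rothe permK ij h. Qed.

Lemma lam_inversion i (v : 'I_r) : v < lam T i -> i < w^-1%g v.
Proof. by rewrite -rotheE => /andP[]. Qed.

(** The inversion of [j] and [k] puts [w k] below [lam j]. Then the smaller value [w i] is in row
    [j] of the diagram too, so it would have to occur after position [j]. *)
Lemma rothe_no132 i j k : i < j -> j < k -> w i < w k -> w k < w j -> False.
Proof.
move=> ij jk ik kj; have h := inversion_lam jk kj.
have := @lam_inversion j (w i); rewrite permK; lia.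
Qed.

Lemma rothe_avoids132 : avoids w [:: 1; 3; 2].
Proof.
move=> h; have [i0 _] : exists i0 : 'I_r, true by case: h => f _; exists (f ord0).
have [t [th tw]] := (containsP w _ i0).1 h.
have := @rothe_no132 (t 0) (t 1) (t 2).
by rewrite !tw // !th //; apply.
Qed.

(** If [w i] were larger, then the value [lam i], not being in row [i] of the diagram, would occur
    at an earlier position; the row of that position is longer than [lam i], hence has this value in
    the diagram and places it still later. *)
Lemma lam_record i : (forall i', i' < i -> lam T i < lam T i') -> w i = lam T i :> nat.
Proof.
move=> rec; apply/eqP; rewrite eqn_leq lam_le_perm andbT leqNgt; apply/negP => h.
have hv : lam T i < r by have := ltn_ord (w i); lia.
have [v ev] : exists v : 'I_r, v = lam T i :> nat by exists (Ordinal hv).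
have : ~~ rothe w i v by rewrite rotheE ev ltnn.
rewrite /rothe ev h /= -leqNgt leq_eqVlt => /predU1P[e|hlt].
  have ew : w i = v by rewrite -(val_inj e) permKV.
  by move: h; rewrite ew ev ltnn.
have := @lam_inversion (w^-1%g v) v; rewrite ev (rec _ hlt) ltnn.
by move/(_ isT).
Qed.
End Rothe.

Section Patterns.
Variables (r : nat) (M : 'I_(2 * r) -> 'I_(2 * r)).
Local Notation n := (2 * r).
Hypothesis ncM : noncrossing_matching M.
Let MK := noncrossing_inv ncM.
Let M_neq := noncrossing_neq ncM.
Let T := matching_syt MK M_neq.
Let lam := lam T.
Variable w : 'S_r.
Hypothesis rotheE : forall i v, rothe w i v = (v < lam i).

(** Along a decreasing subsequence values and row lengths interlace: each value is below the row
    length at the preceding position, which is at most the value there. So 4321 yields four distinct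
    row lengths and four records. *)
Lemma avoids_card_records : #|short_arcs M| <= 3 -> avoids w [:: 4; 3; 2; 1].
Proof.
move=> hK h; have [i0 _] : exists i0 : 'I_r, true by case: h => f _; exists (f ord0).
have [t [th tw]] := (containsP w _ i0).1 h.
have D x y : x < y < 4 -> w (t y) < lam (t x).
  move=> hxy; have hx : x < 4 by lia.
  have hy : y < 4 by lia.
  apply: (inversion_lam rotheE); first exact: th.
  rewrite (tw y x hy hx).
  by case: x y hxy hx hy => [|[|[|[|x]]]] [|[|[|[|y]]]] //=; lia.
have L x := lam_le_perm rotheE (t x).
have L0 := L 0; have L1 := L 1; have L2 := L 2; have L3 := L 3.
have D0 := D 0 1 isT; have D1 := D 1 2 isT; have D2 := D 2 3 isT.
rewrite -/T -/lam in L0 L1 L2 L3.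
have : 4 <= #|records ncM|.
  by apply: (@card_records_ge r M ncM [:: t 0; t 1; t 2; t 3]); rewrite /= !inE -/lam; lia.
by move: hK; rewrite card_short_arcs; lia.
Qed.

Lemma noncrossing_prefix (j : 'I_n) (x : 'I_n) :
  M j < j -> M j = 0 :> nat -> (M x <= j) = (x <= j).
Proof.
move=> cj j0.
suff H (y : 'I_n) : y <= j -> M y <= j by apply/idP/idP => [/H|/H //]; rewrite MK.
move=> hy; have [->|ney] := eqVneq y j; first exact: ltnW.
have [->|ne0] := eqVneq y (M j); first by rewrite MK.
have := @noncrossing_in n M (M j) y ncM; rewrite MK j0.
move: ney ne0; rewrite -!val_eqE /= j0; lia.
Qed.

(* If the arc at the first point is not the outer one then the path returns to
   the diagonal, which splits [w] into two antidiagonal blocks. *)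
Lemma split_perm (z j : 'I_n) : z = 0 :> nat -> M z = j -> j.+1 < n ->
  exists2 m, 0 < m < r &
    (forall i : 'I_r, (i < r - m) = (m <= lam i)) /\
    (forall i : 'I_r, (i < r - m) = (m <= w i)).
Proof.
move=> z0 Mz hj.
have Mj : M j = z by rewrite -Mz MK.
have cj : M j < j by have := M_neq j; rewrite Mj -val_eqE /= z0; lia.
have pre (x : 'I_n) : (M x <= j) = (x <= j).
  by apply: noncrossing_prefix => //; rewrite Mj.
(* The points up to [j] are matched among themselves, [m] openers with [m] closers, so the path is
   on the diagonal after [j.+1 = m.*2] steps. *)
pose m := #|[pred l : 'I_r | opn M l <= j]|.
have ho : #|[pred i : 'I_n | (i < M i) && (i < j.+1)]| = m.
  rewrite /m -(card_image (opn_inj MK M_neq)).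
  apply: eq_card => i; rewrite !inE ltnS; apply/andP/imageP => [[oi hi]|[l hl ->]].
    by have [k ek] := opn_surj MK M_neq oi; exists k; rewrite // inE -ek.
  by rewrite inE in hl; rewrite (opnP MK M_neq).
have hc : #|[pred i : 'I_n | (M i < i) && (i < j.+1)]| = m.
  rewrite -ho -(card_in_imset (f := M)); last by move=> x y _ _; apply: (inv_inj MK).
  apply: eq_card => i; rewrite !inE !ltnS; apply/imsetP/idP => [[x]|/andP[oi hi]].
    by rewrite inE ltnS => /andP[cx hx] ->; rewrite MK cx pre.
  by exists (M i); rewrite ?MK // inE MK oi ltnS pre.
have hm : m.*2 = j.+1.
  have := card_openers_lt M_neq j.+1.
  rewrite (eq_card (B := [pred i : 'I_n | (i < M i) && (i < j.+1)])) // ho.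
  rewrite (eq_card (B := [pred i : 'I_n | (M i < i) && (i < j.+1)])) // hc.
  have := ltn_ord j; lia.
have opm (l : 'I_r) : (opn M l <= j) = (l < m).
  have opM := opn_mono MK M_neq.
  apply/idP/idP => h.
    have -> : (l : nat).+1 = #|[pred k : 'I_r | k < l.+1]| by rewrite card_ord_ltn; have := ltn_ord l; lia.
    apply: subset_leq_card; apply/subsetP => k; rewrite !inE => hk.
    have : ~~ (opn M l < opn M k) by rewrite opM; lia.
    lia.
  rewrite leqNgt; apply: contraL h => h; rewrite -leqNgt.
  have -> : (l : nat) = #|[pred k : 'I_r | k < l]| by rewrite card_ord_ltn; have := ltn_ord l; lia.
  apply: subset_leq_card; apply/subsetP => k; rewrite !inE => hk.
  by rewrite -opM; lia.
have m0 : 0 < m by lia.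
have mr : m < r by lia.
exists m; first by rewrite m0.
have lamm (i : 'I_r) : (i < r - m) = (m <= lam i).
  have [] := lamE T i; rewrite -/lam matching_syt_col0 => e _.
  have hi := ltn_ord i; have := opm (rev_ord i) => /=.
  have [hlt|hge] := ltnP i (r - m) => h.
    have h1 : m < r by lia.
    have := @col0_gap r T (Ordinal h1) (rev_ord i); rewrite !matching_syt_col0 e /=.
    have := opm (Ordinal h1); rewrite /= ltnn; lia.
  have h1 : m.-1 < r by lia.
  have := @col0_gap r T (rev_ord i) (Ordinal h1); rewrite !matching_syt_col0 e /=.
  have : opn M (Ordinal h1) <= j by rewrite opm /=; lia.
  have : opn M (Ordinal h1) != j.
    by apply/eqP => e'; have := opnP MK M_neq (Ordinal h1); rewrite e'; lia.
  rewrite -val_eqE /=; lia.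
split=> //.
(* As [lam i <= w i], the first [r - m] positions have values at least [m]. There are exactly
   [r - m] such values, so the inclusion is an equality. *)
have sub : [set i : 'I_r | i < r - m] \subset w @^-1: [set v : 'I_r | m <= v].
  by apply/subsetP => i; rewrite !inE lamm => /leq_trans; apply; exact: lam_le_perm rotheE i.
have /eqP/setP e : [set i : 'I_r | i < r - m] == w @^-1: [set v : 'I_r | m <= v].
  rewrite eqEcard sub on_card_preimset; last by exists w^-1%g => v _; rewrite ?permK ?permKV.
  rewrite !cardsE card_ord_ltn; have := cardC [pred v : 'I_r | v < m].
  rewrite card_ord card_ord_ltn (@eq_card _ [predC _] [pred v : 'I_r | m <= v]).
    by move: #|_| => N; lia.
  by move=> v; rewrite !inE -leqNgt.
by move=> i; have := e i; rewrite !inE.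
Qed.

(** The letters 3, 2, 1 have distinct row lengths and use up the three records, so every row has one
    of these lengths. In the splitting by [m] the top row forces the letter 3 into the upper block
    and the bottom row forces the letter 1 into the lower one; the letter 4 comes after 1, so its
    value is below [m] and below that of 3. *)
Lemma avoids_3214 : #|short_arcs M| <= 3 -> avoids w [:: 3; 2; 1; 4].
Proof.
move=> hK h; have [i0 _] : exists i0 : 'I_r, true by case: h => f _; exists (f ord0).
have [t [th tw]] := (containsP w _ i0).1 h.
have r0 : 0 < r by have := ltn_ord i0; lia.
have D1 : w (t 1) < lam (t 0) by apply: (inversion_lam rotheE); rewrite ?th ?tw.
have D2 : w (t 2) < lam (t 1) by apply: (inversion_lam rotheE); rewrite ?th ?tw.
have L x := lam_le_perm rotheE (t x).
have L0 := L 0; have L1 := L 1; have L2 := L 2; rewrite -/T -/lam in L0 L1 L2.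
have G := @card_records_ge r M ncM; rewrite -/T -/lam in G.
have h3 : 3 <= #|records ncM|.
  by apply: (G [:: t 0; t 1; t 2]); rewrite /= !inE; lia.
have no4 (i : 'I_r) : uniq [seq lam i | i <- [:: i; t 0; t 1; t 2]] -> False.
  move=> u; have h4 : 4 <= #|records ncM| := G _ u.
  by move: hK; rewrite card_short_arcs; lia.
have nolast : ~~ last_short M by apply/negP => hl; move: hK; rewrite card_short_arcs hl; lia.
have n0 : 0 < n by lia.
have hz : (M (Ordinal n0)).+1 < n.
  rewrite ltn_neqAle ltn_ord andbT; apply: contra nolast => hl.
  apply/existsP; exists (M (Ordinal n0)); rewrite hl MK.
  by apply/eqP/ord_inj; rewrite val_ordS hl.
have [m /andP[m0 mr] [lamm wm]] := @split_perm (Ordinal n0) _ erefl erefl hz.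
have hr1 : r.-1 < r by lia.
have e0 : m <= lam (t 0).
  rewrite leqNgt; apply/negP => hlt; apply: (no4 (Ordinal r0)).
  have : m <= lam (Ordinal r0) by rewrite -lamm /=; lia.
  rewrite /= !inE; lia.
have e2 : lam (t 2) < m.
  rewrite ltnNge; apply/negP => hlt; apply: (no4 (Ordinal hr1)).
  have : lam (Ordinal hr1) < m by rewrite ltnNge -lamm /=; lia.
  rewrite /= !inE; lia.
have h23 := th 2 3 isT; have h03 := tw 0 3 isT isT.
have := lamm (t 0); have := lamm (t 2); have := wm (t 0); have := wm (t 3).
move: h03 => /=; lia.
Qed.
End Patterns.

(** * From permutations to matchings *)

Section DyckMatching.
Variables (r : nat) (o : 'I_r -> nat).
Local Notation n := (2 * r).
Hypotheses (o_mono : {homo o : k l / k < l}) (o_le : forall k : 'I_r, o k <= k.*2).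

Let op (m : nat) := [exists k, o k == m].
Let up m := #|[pred k : 'I_r | o k < m]|.
(* The height of the path after m steps, shifted by n to stay in nat. *)
Let ht m := (up m).*2 + n - m.

Let o_inj : injective o.
Proof.
move=> k l e; apply: val_inj => /=.
by case: (ltngtP k l) => // /o_mono; rewrite e ltnn.
Qed.

Let upS m : up m.+1 = up m + op m.
Proof.
rewrite /up /op; case: existsP => [[k /eqP ek]|nk].
  rewrite (cardD1 k) inE ek ltnSn addnC; congr (_ + _).
  by apply: eq_card => l; rewrite !inE -(inj_eq o_inj) ek; lia.
rewrite addn0; apply: eq_card => l; rewrite !inE.
have : o l != m by apply/eqP => e; apply: nk; exists l; apply/eqP.
lia.
Qed.

Let up0 : up 0 = 0.
Proof. by apply: eq_card0 => k; rewrite !inE. Qed.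

Let upn : up n = r.
Proof.
rewrite -[RHS]card_ord; apply: eq_card => k; rewrite !inE.
by have := o_le k; have := ltn_ord k; lia.
Qed.

Let up_dyck m : m <= n -> m <= (up m).*2.
Proof.
move=> hm; rewrite leqNgt; apply/negP => hlt.
have hr : up m < r by lia.
have hk : m <= o (Ordinal hr).
  rewrite leqNgt; apply/negP => h.
  have : #|[pred k : 'I_r | k < (up m).+1]| <= up m.
    apply: subset_leq_card; apply/subsetP => k; rewrite !inE ltnS leq_eqVlt => /orP[/eqP e|hk].
      by rewrite (_ : k = Ordinal hr) //; apply: val_inj.
    by apply: ltn_trans h; apply: o_mono.
  by rewrite card_ord_ltn; lia.
have := o_le (Ordinal hr) => /=; lia.
Qed.

Let htS m : m < n -> ht m.+1 = if op m then (ht m).+1 else (ht m).-1.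
Proof. by move=> hm; have := up_dyck (ltnW hm); rewrite /ht upS; case: (op m) => /=; lia. Qed.

Let ht0 : ht 0 = n. Proof. by rewrite /ht up0; lia. Qed.
Let htn : ht n = n. Proof. by rewrite /ht upn; lia. Qed.
Let ht_ge m : m <= n -> n <= ht m.
Proof. by move=> /up_dyck; rewrite /ht; lia. Qed.

(** The classical matching of a Dyck path: [j] is the step with which the path first comes back to
    its height before step [i]. *)
Let arc (i j : 'I_n) := [&& i < j, ht j.+1 == ht i &
  [forall k : 'I_n, (i < k <= j) ==> (ht i < ht k)]].

Let arcP (i j : 'I_n) : reflect
  [/\ i < j, ht j.+1 = ht i & forall k, i < k <= j -> ht i < ht k] (arc i j).
Proof.
apply: (iffP and3P) => [[ij /eqP e /forallP h]|[ij e h]]; split=> //; last 2 first.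
- by rewrite e.
- by apply/forallP => k; apply/implyP => /h.
move=> k hk; have hn : k < n by have := ltn_ord j; lia.
exact: (implyP (h (Ordinal hn))).
Qed.

Let arc_open (i : 'I_n) : op i -> exists j, arc i j.
Proof.
move=> oi; have hi := htS (ltn_ord i); rewrite oi in hi.
have hin : i < n.-1.
  rewrite ltn_neqAle; apply/andP; split; last by have := ltn_ord i; lia.
  apply/eqP => e; move: hi; rewrite (_ : i.+1 = n); last by have := ltn_ord i; lia.
  rewrite htn; have := ht_ge (ltnW (ltn_ord i)); lia.
pose P j := (i < j) && (ht j.+1 <= ht i).
have exP : exists j, P j.
  exists n.-1; rewrite /P hin prednK; last by have := ltn_ord i; lia.
  by rewrite htn ht_ge // ltnW.
case: (ex_minnP exP) => j /andP[ij hj] jmin.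
have jn : j < n.
  have : P n.-1 by rewrite /P hin prednK ?htn ?ht_ge // 1?ltnW //; have := ltn_ord i; lia.
  by move/jmin; lia.
have habove k : i < k <= j -> ht i < ht k.
  move=> hk; have [ek|nek] := eqVneq k i.+1; first by rewrite ek hi.
  rewrite ltnNge; apply/negP => hle; have := jmin k.-1.
  rewrite /P prednK; last by lia.
  by rewrite hle andbT; lia.
exists (Ordinal jn); apply/arcP; split=> //=.
have := habove j; have := htS jn; case: (op j); lia.
Qed.

Let arc_close (j : 'I_n) : ~~ op j -> exists i, arc i j.
Proof.
move=> cj; have hj := htS (ltn_ord j); rewrite (negbTE cj) in hj.
have g1 := ht_ge (ltn_ord j); have g0 := ht_ge (ltnW (ltn_ord j)).
have hj' : ht j = (ht j.+1).+1 by have := ltn_ord j; lia.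
(* The last moment up to [j] at which the path is no higher than after step [j]; time 0 qualifies
   since the path starts at its least height. *)
pose P i := (i <= j) && (ht i <= ht j.+1).
have exP : exists i, P i by exists 0; rewrite /P ht0.
have ubP i : P i -> i <= j by case/andP.
case: (ex_maxnP exP ubP) => i /andP[ij hi] imax.
have habove k : i < k <= j -> ht j.+1 < ht k.
  move=> hk; rewrite ltnNge; apply/negP => hle; have := imax k.
  by rewrite /P hle andbT; lia.
have ij' : i < j.
  rewrite ltn_neqAle ij andbT; apply/eqP => e; move: hi; rewrite e; lia.
have hin : i < n by have := ltn_ord j; lia.
have ei : ht j.+1 = ht i.
  have := habove i.+1; have := htS hin; case: (op i); lia.
by exists (Ordinal hin); apply/arcP; split=> //= k /habove; rewrite ei.
Qed.

Let arc_ends (i j : 'I_n) : arc i j -> op i && ~~ op j.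
Proof.
case/arcP=> ij e h; have := h i.+1; have := h j; have := htS (ltn_ord i).
have := htS (ltn_ord j); have := ht_ge (ltnW (ltn_ord i)).
by case: (op i); case: (op j) => //=; lia.
Qed.

Let arc_fun (i j j' : 'I_n) : arc i j -> arc i j' -> j = j'.
Proof.
case/arcP=> ij e h /arcP[ij' e' h']; apply: val_inj => /=.
case: (ltngtP j j') => // hlt.
  have := h' j.+1; lia.
have := h j'.+1; lia.
Qed.

Let arc_cofun (i i' j : 'I_n) : arc i j -> arc i' j -> i = i'.
Proof.
case/arcP=> ij e h /arcP[ij' e' h']; apply: val_inj => /=.
case: (ltngtP i i') => // hlt.
  have := h i'; lia.
have := h' i; lia.
Qed.

Lemma dyck_matching : exists M : 'I_n -> 'I_n,
  noncrossing_matching M /\ forall i : 'I_n, (i < M i) = [exists k, o k == i].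
Proof.
have ex i : exists j, arc i j || arc j i.
  have [oi|ci] := boolP (op i).
    by have [j a] := arc_open oi; exists j; rewrite a.
  by have [j a] := arc_close ci; exists j; rewrite a orbT.
have uniq_mate i j j' : arc i j || arc j i -> arc i j' || arc j' i -> j = j'.
  case/orP=> a /orP[] a'.
  - exact: arc_fun a a'.
  - by have := arc_ends a; have := arc_ends a'; case: (op i); rewrite /= ?andbF.
  - by have := arc_ends a; have := arc_ends a'; case: (op i); rewrite /= ?andbF.
  - exact: arc_cofun a a'.
pose M i := xchoose (ex i).
have MP i : arc i (M i) || arc (M i) i := xchooseP (ex i).
exists M; split; last first.
  move=> i; rewrite -/(op i); case/orP: (MP i) => a; have /andP[] := arc_ends a.
    by move=> -> _; case/arcP: a => ->.
  by move=> _ /negbTE->; apply/negbTE; case/arcP: a; rewrite -leqNgt => /ltnW.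
have MK : involutive M by move=> i; apply: (uniq_mate (M i)) => //; rewrite orbC.
split=> // [i|i j [ij jMi MiMj]].
  by apply/eqP => e; have := MP i; rewrite e => /orP[] /arcP[]; rewrite ltnn.
have a : arc i (M i) by case/orP: (MP i) => // /arcP[]; lia.
have b : arc j (M j) by case/orP: (MP j) => // /arcP[]; lia.
(* If the arcs crossed, the path would be higher at [j] than at [i], and higher still after step
   [M i], where it is back at the height of [i]. *)
case/arcP: a => _ e h; case/arcP: b => _ e' h'.
have := h j; have := h' (M i).+1; lia.
Qed.
End DyckMatching.

Definition noncrossing_syt r (M : 'I_(2 * r) -> 'I_(2 * r)) (ncM : noncrossing_matching M) :=
  matching_syt (noncrossing_inv ncM) (noncrossing_neq ncM).

Lemma contains3 r (w : 'S_r) (a b c : nat) (i j k : 'I_r) :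
  i < j -> j < k ->
  ((w i < w j) = (a < b)) * ((w j < w i) = (b < a)) * ((w i < w k) = (a < c)) *
  ((w k < w i) = (c < a)) * ((w j < w k) = (b < c)) * ((w k < w j) = (c < b)) ->
  contains w [:: a; b; c].
Proof.
move=> ij jk h; apply/(containsP _ _ i).
exists (fun x => nth i [:: i; j; k] x); split=> x y.
  by case: x y => [|[|[|x]]] [|[|[|y]]] //=; lia.
by case: x y => [|[|[|x]]] [|[|[|y]]] //= _ _; rewrite ?ltnn ?h.
Qed.

Lemma contains4 r (w : 'S_r) (a b c d : nat) (i j k l : 'I_r) :
  i < j -> j < k -> k < l ->
  ((w i < w j) = (a < b)) * ((w j < w i) = (b < a)) * ((w i < w k) = (a < c)) *
  ((w k < w i) = (c < a)) * ((w j < w k) = (b < c)) * ((w k < w j) = (c < b)) ->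
  ((w i < w l) = (a < d)) * ((w l < w i) = (d < a)) * ((w j < w l) = (b < d)) *
  ((w l < w j) = (d < b)) * ((w k < w l) = (c < d)) * ((w l < w k) = (d < c)) ->
  contains w [:: a; b; c; d].
Proof.
move=> ij jk kl h g; apply/(containsP _ _ i).
exists (fun x => nth i [:: i; j; k; l] x); split=> x y.
  by case: x y => [|[|[|[|x]]]] [|[|[|[|y]]]] //=; lia.
by case: x y => [|[|[|[|x]]]] [|[|[|[|y]]]] //= _ _; rewrite ?ltnn ?h ?g.
Qed.

Section Dominant.
Variables (r : nat) (w : 'S_r).
Hypothesis w132 : avoids w [:: 1; 3; 2].
Implicit Types (i j k v : 'I_r).

Let code i := #|[pred v | rothe w i v]|.

Lemma no132 i j k : i < j -> j < k -> w i < w k -> w k < w j -> False.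
Proof. move=> ij jk ik kj; apply: w132; apply: (contains3 ij jk); do !split; lia. Qed.

(** If [v'] occurred before position [i], then [v'], [w i], [v] would form a 132 pattern. So the
    rows of the Rothe diagram are left-justified. *)
Let rothe_left i v v' : v' <= v -> rothe w i v -> rothe w i v'.
Proof.
move=> hv /andP[h1 h2]; apply/andP; split; first lia.
have [->//|ne] := eqVneq v' v.
rewrite ltnNge leq_eqVlt; apply/negP => /orP[/eqP/val_inj e|h3].
  by move: h1; rewrite -e permKV; lia.
apply: (@no132 (w^-1%g v') i (w^-1%g v)) => //; rewrite ?permKV //.
by move: ne; rewrite -val_eqE /=; lia.
Qed.

Lemma rothe_code i v : rothe w i v = (v < code i).
Proof.
apply/idP/idP => h.
  have -> : (v : nat).+1 = #|[pred u : 'I_r | u < v.+1]|.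
    by rewrite card_ord_ltn; have := ltn_ord v; lia.
  apply: subset_leq_card; apply/subsetP => u; rewrite !inE ltnS => hu.
  exact: rothe_left hu h.
apply: contraLR h => h; rewrite -leqNgt.
have -> : (v : nat) = #|[pred u : 'I_r | u < v]|.
  by rewrite card_ord_ltn; have := ltn_ord v; lia.
apply: subset_leq_card; apply/subsetP => u; rewrite !inE => hu.
by rewrite ltnNge; apply: contra h => h; apply: rothe_left hu.
Qed.

Let code_le i : code i <= r - i.+1.
Proof.
rewrite /code -(card_in_image (f := w^-1%g)); last by move=> x y _ _; apply: perm_inj.
apply: (@leq_trans #|[pred j : 'I_r | i < j <= r.-1]|).
  apply: subset_leq_card; apply/subsetP => j /imageP[v hv ->]; move: hv.
  by rewrite !inE => /andP[_ ->] /=; have := ltn_ord (w^-1%g v); lia.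
by rewrite card_ord_interval; have := ltn_ord i; lia.
Qed.

(** A value [v] in row [j] but not in row [i] would give the 132 pattern [w i], [w j], [v]. *)
Let code_mono i j : i <= j -> code j <= code i.
Proof.
rewrite leq_eqVlt => /orP[/eqP/val_inj->//|ij].
apply: subset_leq_card; apply/subsetP => v; rewrite !inE => /andP[h1 h2].
apply/andP; split; last lia.
rewrite ltnNge leq_eqVlt; apply/negP => /orP[/eqP/val_inj e|h3].
  by move: h2; rewrite -e permK; lia.
by apply: (@no132 i j (w^-1%g v)); rewrite ?permKV.
Qed.

Lemma avoids132_matching : exists M (ncM : noncrossing_matching M),
  forall i v, rothe w i v = (v < lam (noncrossing_syt ncM) i).
Proof.
(* The equation of [lamE] solved for the position of the opener, counted from 0, with the code as
   row lengths. *)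
pose o k := code (rev_ord k) + k.
have o_mono : {homo o : k l / k < l}.
  move=> k l kl; rewrite /o; have := @code_mono (rev_ord l) (rev_ord k).
  by rewrite /=; have := ltn_ord l; lia.
have o_le k : o k <= k.*2.
  by rewrite /o; have := code_le (rev_ord k); rewrite /=; have := ltn_ord k; lia.
have [M [ncM opM]] := dyck_matching o_mono o_le; exists M, ncM => i v.
rewrite rothe_code; congr (_ < _); rewrite /lam matching_syt_col0.
suff e k : opn M k = o k :> nat by rewrite e /o rev_ordK /=; have := ltn_ord i; lia.
have MK := noncrossing_inv ncM; have Mne := noncrossing_neq ncM.
have [l el] : exists l, o l = opn M k.
  by have := opnP MK Mne k; rewrite opM => /existsP[l /eqP]; exists l.
suff ekl : k = l by rewrite -el ekl.
(* [k] is the rank of [opn M k] among the openers. These are the values of the increasing function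
   [o], so the rank of [o l] is [l]. *)
apply: val_inj => /=; rewrite -{1}(opn_rank MK Mne k) -el.
have o_lt a b : (o a < o b) = (a < b).
  case: (ltngtP a b) => [/o_mono //|/o_mono h|/val_inj ->]; last by rewrite ltnn.
  by apply/negbTE; rewrite -leqNgt ltnW.
have o_inj : injective o.
  by move=> a b e; apply: val_inj; have := o_lt a b; have := o_lt b a; rewrite e ltnn; case: ltngtP.
have on a : o a < 2 * r by have := o_le a; have := ltn_ord a; lia.
transitivity #|[pred a : 'I_r | a < l]|; last by rewrite card_ord_ltn; have := ltn_ord l; lia.
rewrite -(card_in_image (f := fun a => Ordinal (on a))); last first.
  by move=> a b _ _ [/o_inj].
apply: eq_card => x; rewrite !inE opM; apply/andP/imageP => [[]|[a]].
  move=> /existsP[a /eqP ea]; rewrite -ea o_lt => al.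
  by exists a; rewrite ?inE //; apply: val_inj.
rewrite inE => al -> /=; rewrite o_lt; split=> //.
by apply/existsP; exists a.
Qed.

(* More than v positions lie at or after p, so one of their values is at least v. *)
Let pigeonhole (p v : nat) : v + p < r -> exists2 j : 'I_r, p <= j & v <= w j.
Proof.
move=> hv; apply/exists_inP; apply: contraT; rewrite negb_exists_in => /forall_inP hno.
have : #|[pred j : 'I_r | ~~ (j < p)]| <= #|[pred u : 'I_r | u < v]|.
  rewrite -(card_in_image (f := w)); last by move=> x y _ _; apply: perm_inj.
  apply: subset_leq_card; apply/subsetP => y /imageP[j]; rewrite inE -leqNgt => hj ->.
  by rewrite inE ltnNge hno.
have := cardC [pred j : 'I_r | j < p]; rewrite card_ord !card_ord_ltn.
rewrite (@eq_card _ [predC _] [pred j : 'I_r | ~~ (j < p)]) //.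
move: #|_| => N; lia.
Qed.

(** The pigeonhole principle gives [j'] after [p2] with a value above [w p1], and [j] after [p3]
    with a value above [w p2]. Avoiding 3214 keeps all values after [p3] below [w p1]; hence [j'] is
    not after [p3], and [p2], [j'], [j] form a 132 pattern. *)
Lemma no_three_records (p1 p2 p3 : 'I_r) : avoids w [:: 3; 2; 1; 4] ->
  p1 < p2 -> p2 < p3 -> w p2 < w p1 -> w p3 < w p2 ->
  w p1 + p2 < r -> w p2 + p3 < r -> False.
Proof.
move=> w3214 l12 l23 d12 d23 /pigeonhole[j' j2 wj'] /pigeonhole[j j3 wj].
have neq (x y : 'I_r) : y < x -> w x != w y :> nat.
  move=> h; rewrite (inj_eq val_inj) (inj_eq perm_inj) -val_eqE /=.
  by rewrite neq_ltn h orbT.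
have below (x : 'I_r) : p3 < x -> w x < w p1.
  move=> hx; have := neq x p1 ltac:(lia).
  rewrite neq_ltn => /orP[//|h]; exfalso.
  by apply: w3214; apply: (contains4 l12 l23 hx); do !split; clear -d12 d23 h; lia.
have hj : p3 < j.
  by rewrite ltn_neqAle j3 andbT; apply: contraTneq d23 => /val_inj->; rewrite -leqNgt.
have hj' : p2 < j'.
  by rewrite ltn_neqAle j2 andbT; apply: contraTneq d12 => /val_inj->; rewrite -leqNgt.
have h1 := below j hj; have h2 := neq j p2 ltac:(lia); have h3 := neq j' p1 ltac:(lia).
have hj'3 : j' <= p3 by rewrite leqNgt; apply/negP => /below; clear -wj'; lia.
by apply: (@no132 p2 j' j); clear -hj hj' hj'3 wj wj' h1 h2 h3; lia.
Qed.

Variables (M : 'I_(2 * r) -> 'I_(2 * r)) (ncM : noncrossing_matching M).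
Hypothesis rotheE : forall i v, rothe w i v = (v < lam (noncrossing_syt ncM) i).
Hypotheses (w4321 : avoids w [:: 4; 3; 2; 1]) (w3214 : avoids w [:: 3; 2; 1; 4]).
Let lam := lam (noncrossing_syt ncM).

Let record_val i : i \in records ncM -> w i = lam i :> nat.
Proof. by move/recordsP => h; apply: (lam_record rotheE). Qed.

Let record_desc i j : i \in records ncM -> j \in records ncM -> i < j -> w j < w i.
Proof. by move=> hi hj ij; rewrite !record_val //; move/recordsP: hj; apply. Qed.

(* The path stays strictly above the diagonal between its endpoints if the
   first and the last points are matched. *)
Let lam_prime i : last_short M -> i.+1 < r -> (lam i).+1 < r - i.
Proof.
move=> /existsP[z /andP[/eqP ez /eqP Mz]] hi.
have MK := noncrossing_inv ncM; have Mne := noncrossing_neq ncM.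
have z0 : M z = 0 :> nat by rewrite Mz val_ordS ez eqxx.
have [e _] := lamE (noncrossing_syt ncM) i; rewrite -/lam matching_syt_col0 in e.
have := opn_rank MK Mne (rev_ord i); have := card_openers_lt Mne (opn M (rev_ord i)).
have oMz : opn M (rev_ord i) != M z.
  apply/eqP => e'; have := opn_rank MK Mne (rev_ord i).
  rewrite e' z0 (eq_card0 (A := [pred j : 'I_(2 * r) | _])) /=; first by lia.
  by move=> j; rewrite !inE andbF.
(* [M] injects the closers before this opener into the openers before it and misses the first point,
   whose mate is the last point; so the ballot inequality is strict. *)
have cz : #|[pred j : 'I_(2 * r) | (M j < j) && (j < opn M (rev_ord i))]|
      < #|[pred j : 'I_(2 * r) | (j < M j) && (j < opn M (rev_ord i))]|.
  rewrite [X in _ < X](cardD1 (M z)) !inE MK z0.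
  have -> : 0 < z by have := Mne z; rewrite -val_eqE /= z0; lia.
  have -> : 0 < opn M (rev_ord i) by move: oMz; rewrite -val_eqE /= z0; lia.
  rewrite /= add1n ltnS -(card_in_imset (f := M)); last by move=> x y _ _; apply: (inv_inj MK).
  apply: subset_leq_card; apply/subsetP => y /imsetP[j hj ->]; move: hj.
  rewrite !inE MK (inj_eq (inv_inj MK)) => /andP[cj hj].
  have -> : j != z by apply/eqP => ejz; have := ltn_ord (opn M (rev_ord i)); rewrite ejz in hj; lia.
  by rewrite cj /=; lia.
move=> h1 h2; move: h1 cz; rewrite h2 => h1 cz.
have := ltn_ord (opn M (rev_ord i)); move: h1 cz e => /=; lia.
Qed.

(** Four records are a 4321 pattern, since [w] decreases along records. Three records together with
    the arc from the last to the first point are excluded by [no_three_records]. *)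
Lemma avoids_card_short_arcs : #|short_arcs M| <= 3.
Proof.
rewrite (card_short_arcs ncM) cardE.
have in_s i : (i \in enum (records ncM)) = (i \in records ncM) := mem_enum _ i.
have ss : sorted ltn [seq val i | i <- enum (records ncM)].
  rewrite (_ : enum _ = [seq i <- enum 'I_r | i \in records ncM]); first exact: filter_enum_sorted.
  by rewrite /enum_mem -filter_predI; apply: eq_filter => i; rewrite /= andbT.
case: (enum _) in_s ss => [|p1 [|p2 [|p3 s]]] in_s ss; try by case: last_short.
have [r1 r2 r3] : [/\ p1 \in records ncM, p2 \in records ncM & p3 \in records ncM].
  by rewrite -!in_s !inE !eqxx !orbT.
have /and3P[/= l12 l23 _] := ss.
have d12 := record_desc r1 r2 l12; have d23 := record_desc r2 r3 l23.
case: s in_s ss => [|p4 s] in_s ss; last first.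
  have r4 : p4 \in records ncM by rewrite -in_s !inE eqxx !orbT.
  have /and4P[_ _ l34 _] := ss; have d34 := record_desc r3 r4 l34.
  by case: w4321; apply: (contains4 l12 l23 l34); do !split; lia.
case hl: (last_short M) => //; exfalso.
have recs i : i \in records ncM -> [\/ i = p1, i = p2 | i = p3].
  by rewrite -in_s !inE => /or3P[] /eqP->; [constructor 1|constructor 2|constructor 3].
have v1 := record_val r1; have v2 := record_val r2.
have hp3 := ltn_ord p3.
(* Row [p.-1] is at least as long as the row of the preceding record [q], and [lam_prime] bounds it
   strictly. *)
have before (p q : 'I_r) : q < p -> (forall x, x \in records ncM -> x < p -> x <= q) ->
    lam q + p < r.
  move=> qp hq; have hi : p.-1 < r by have := ltn_ord p; lia.
  have [x rx [ex xi]] := first_record ncM (Ordinal hi); rewrite -/lam /= in ex xi.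
  have hx : x <= q by apply: hq => //; lia.
  have := lam_mono (noncrossing_syt ncM) hx; rewrite -/lam ex.
  by have := @lam_prime (Ordinal hi) hl; have := ltn_ord p; rewrite /=; lia.
have a2 : lam p1 + p2 < r by apply: before => // x /recs[] ->; lia.
have a3 : lam p2 + p3 < r by apply: before => // x /recs[] ->; lia.
by apply: (no_three_records w3214 l12 l23 d12 d23); lia.
Qed.
End Dominant.

(** * Matchings with two or three short arcs *)

(** Unless the arc is short, the point after [i] opens an arc nested in it. *)
Lemma short_in_interval n (M : 'I_n -> 'I_n) (i : 'I_n) :
  noncrossing_matching M -> i < M i ->
  exists2 q, q \in short_arcs M & i <= q < M i.
Proof.
move=> ncM; have [m] := ubnP (M i - i); elim: m i => // m IH i hm iM.
have hS : i.+1 < n by have := ltn_ord (M i); lia.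
have [e|ne] := eqVneq (M i) (Ordinal hS).
  exists i; last by rewrite leqnn.
  by rewrite inE; apply/eqP/ord_inj; rewrite val_ordS e /=; case: eqP; lia.
have h1 : i.+1 < M i by move: ne; rewrite -val_eqE /=; lia.
have h2 := @noncrossing_in n M i (Ordinal hS) ncM; rewrite /= in h2.
have h3 := noncrossing_neq ncM (Ordinal hS); rewrite -val_eqE /= in h3.
have [||q qs hq] := IH (Ordinal hS); rewrite /=; try lia.
by exists q => //; move: hq => /=; lia.
Qed.

(** The point before [i] either closes an arc, which contains a short one, or opens an arc around
    the given one, to which induction applies. If [i] is the first point, either the arc from the
    last point back to it is short or another arc opens right after [M i]. *)
Lemma short_outside n (M : 'I_n -> 'I_n) (i : 'I_n) :
  noncrossing_matching M -> i < M i ->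
  exists2 q, q \in short_arcs M & (M i <= q) || (q < i).
Proof.
move=> ncM; have MK := noncrossing_inv ncM.
have [m] := ubnP (i : nat); elim: m i => // m IH i hm iM.
have [i0|ipos] := posnP (i : nat).
  have [e|ne] := eqVneq (M i).+1 n.
    exists (M i); last by rewrite leqnn.
    by rewrite inE MK; apply/eqP/ord_inj; rewrite val_ordS e eqxx i0.
  have hS : (M i).+1 < n by have := ltn_ord (M i); lia.
  have h2 := @noncrossing_out n M i (Ordinal hS) ncM iM; rewrite /= in h2.
  have h3 := noncrossing_neq ncM (Ordinal hS); rewrite -val_eqE /= in h3.
  have [|q qs hq] := short_in_interval (i := Ordinal hS) ncM; first by rewrite /=; lia.
  by exists q => //; move: hq => /=; lia.
have hP : i.-1 < n by have := ltn_ord i; lia.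
have [p ep] : exists p : 'I_n, p = i.-1 :> nat by exists (Ordinal hP).
have h2 := @noncrossing_out n M i p ncM iM; rewrite ep in h2.
have h3 := noncrossing_neq ncM p; rewrite -val_eqE /= ep in h3.
have [hlt|hgt] := ltnP (M p) p.
  have [|q qs hq] := short_in_interval (i := M p) ncM; first by rewrite MK.
  by exists q => //; move: hq; rewrite MK ep; lia.
have [||q qs hq] := IH p; rewrite ?ep; try lia.
by exists q => //; move: hq; rewrite ep; lia.
Qed.

(** The half-open arc of the circle clockwise from [a] to [b], without [b]; a cut belongs to it
    exactly if passing along it crosses the gap after that cut. *)
Definition in_arc (a b q : nat) := if a < b then a <= q < b else (a <= q) || (q < b).

Lemma short_in_arc n (M : 'I_n -> 'I_n) (i : 'I_n) :
  noncrossing_matching M -> exists2 q, q \in short_arcs M & in_arc i (M i) q.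
Proof.
move=> ncM; rewrite /in_arc; case: ltnP => [/short_in_interval|h]; first exact.
have [|q qs hq] := short_outside (i := M i) ncM.
  by have := noncrossing_neq ncM i; rewrite (noncrossing_inv ncM) -val_eqE /=; lia.
by exists q => //; move: hq; rewrite (noncrossing_inv ncM).
Qed.

(** Two-element sets are encoded by [c1 = c2], so that both kinds of webs share the same three
    parameters; the test [c1 < c2] tells them apart from here on. *)
Lemma set_cuts n (A : {set 'I_n}) : 1 < #|A| <= 3 ->
  exists c0 c1 c2 : 'I_n, [/\ c0 < c1, c1 <= c2 & A = [set c0; c1; c2]].
Proof.
move=> hA; have ss := @filter_enum_sorted n (fun i => i \in A).
have us := filter_enum_uniq (fun i => i \in A).
have ms := @mem_filter_enum n (fun i => i \in A).
have sz := @size_filter_enum n (fun i => i \in A).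
have hs : size [seq i <- enum 'I_n | i \in A] = #|A| by rewrite sz.
move: ss ms hs {us sz}; case: [seq _ <- _ | _] => [|a [|b [|c [|d s]]]] /=;
  [by move=> _ _ h; rewrite -h in hA|by move=> _ _ h; rewrite -h in hA
  | | |by move=> _ _ h; rewrite -h in hA].
- case/andP=> ab _ ms _; exists a, b, b; split=> //.
  by apply/setP => x; rewrite !inE -ms !inE -orbA orbb.
- case/and3P=> ab bc _ ms _; exists a, b, c; split=> //; first exact: ltnW.
  by apply/setP => x; rewrite !inE -ms !inE -orbA.
Qed.

Section Cuts.
Variables (r : nat).
Local Notation n := (2 * r).
Variables (c0 c1 c2 : 'I_n).
Hypotheses (c01 : c0 < c1) (c12 : c1 <= c2).
Implicit Types (i j u v s : 'I_n).

Definition cuts : {set 'I_n} := [set c0; c1; c2].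

(* The parts of the circle are named by their last points. *)
Definition part i : 'I_n :=
  if i <= c0 then c0 else if i <= c1 then c1 else if i <= c2 then c2 else c0.

Definition part_size u :=
  if u == c0 then n + c0 - c2 else if u == c1 then c1 - c0 else c2 - c1.

(** With three parts, the weights [r] minus size have to be positive; with two, both sizes have to
    be [r]. *)
Definition valid_cuts :=
  if c1 < c2 then [&& c1 - c0 < r, c2 - c1 < r & n + c0 - c2 < r]
  else c1 == c0 + r :> nat.

Lemma partP i : [\/ i <= c0 /\ part i = c0, c0 < i <= c1 /\ part i = c1,
  c1 < i <= c2 /\ part i = c2 | c2 < i /\ part i = c0].
Proof.
rewrite /part; case: leqP => h0; first by constructor 1.
case: leqP => h1; first by constructor 2.
by case: leqP => h2; [constructor 3|constructor 4].
Qed.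

Lemma neq_part i j : (part i != part j) = ~~ [|| ((i <= c0) || (c2 < i)) && ((j <= c0) || (c2 < j)),
  (c0 < i <= c1) && (c0 < j <= c1) | (c1 < i <= c2) && (c1 < j <= c2)].
Proof. by rewrite -val_eqE; case: (partP i) => -[hi ->]; case: (partP j) => -[hj ->] /=; lia. Qed.

Lemma in_cuts u : u \in cuts = [|| u == c0, u == c1 | u == c2].
Proof. by rewrite !inE -orbA. Qed.

Lemma cut_ins : [/\ c0 \in cuts, c1 \in cuts & c2 \in cuts].
Proof. by rewrite !in_cuts !eqxx !orbT. Qed.

Lemma part_in_cuts i : part i \in cuts.
Proof. by rewrite in_cuts; case: (partP i) => -[_ ->]; rewrite eqxx ?orbT. Qed.

Lemma part_cut u : u \in cuts -> part u = u.
Proof.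
rewrite in_cuts => /or3P[] /eqP->; rewrite /part ?leqnn //.
  by rewrite leqNgt c01.
rewrite leqNgt (leq_trans c01 c12) /=; case: leqP => // h.
by apply: ord_inj; lia.
Qed.

Lemma no_cut_in_arc i j : part i = part j -> i != j ->
  (forall u, u \in cuts -> ~~ in_arc i j u) \/ (forall u, u \in cuts -> ~~ in_arc j i u).
Proof.
move=> e ne; have ne' : i != j :> nat by [].
have hn0 : c0 != c1 :> nat by lia.
have hn1 : c0 != c2 :> nat by lia.
have H a b : a < b -> (b <= c0) || (c0 < a) && (b <= c1) || (c1 < a) && (b <= c2) || (c2 < a) ->
    forall u, u \in cuts -> ~~ in_arc a b u.
  move=> ab h u; rewrite /in_arc ab in_cuts.
  by case/or3P=> /eqP->; lia.
have H' a b : b < a -> (b <= c0) && (c2 < a) -> forall u, u \in cuts -> ~~ in_arc a b u.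
  move=> ab h u; rewrite /in_arc ltnNge (ltnW ab) /= in_cuts.
  by case/or3P=> /eqP->; lia.
have e' : part i = part j :> nat by rewrite e.
case: (ltngtP i j) => [ij|ji|/ord_inj eij]; last by rewrite eij eqxx in ne.
  case: (partP i) => -[hi ei]; case: (partP j) => -[hj ej]; rewrite ei ej in e';
    try (by left; apply: H => //; lia); try (by right; apply: H' => //; lia); exfalso; lia.
case: (partP i) => -[hi ei]; case: (partP j) => -[hj ej]; rewrite ei ej in e';
  try (by right; apply: H => //; lia); try (by left; apply: H' => //; lia); exfalso; lia.
Qed.

Lemma card_part u : u \in cuts -> #|[set i | part i == u]| = part_size u.
Proof.
have hc2 := ltn_ord c2.
have I a b : a <= b -> b < n -> #|[set i : 'I_n | a < i <= b]| = b - a.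
  by move=> ab hb; rewrite cardsE card_ord_interval.
rewrite in_cuts /part_size; case: eqP => [->|/eqP n0] /= h.
  have -> : [set i | part i == c0] = ~: [set i : 'I_n | c0 < i <= c2].
    apply/setP => i; rewrite !inE -val_eqE.
    by case: (partP i) => -[hi ->] /=; lia.
  have := cardsC [set i : 'I_n | c0 < i <= c2]; rewrite I ?card_ord //; last lia.
  move: #|_| => N; lia.
case: eqP h => [->|/eqP n1] /= h.
  rewrite -(I c0 c1) ?(ltnW c01) //; apply: eq_card => i; rewrite !inE -val_eqE.
  by case: (partP i) => -[hi ->] /=; lia.
move/eqP: h n1 => -> n1; rewrite -(I c1 c2) //; apply: eq_card => i; rewrite !inE -val_eqE.
move: n1; rewrite -val_eqE; case: (partP i) => -[hi ->] /=; lia.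
Qed.

Lemma part_size0 : part_size c0 = n + c0 - c2.
Proof. by rewrite /part_size eqxx. Qed.

Lemma part_size1 : part_size c1 = c1 - c0.
Proof.
by rewrite /part_size eqxx -val_eqE /= (_ : (c1 == c0 :> nat) = false) //; lia.
Qed.

Lemma part_size2 : c1 < c2 -> part_size c2 = c2 - c1.
Proof.
move=> h; rewrite /part_size -!val_eqE /=.
have -> : (c2 == c0 :> nat) = false by lia.
by have -> : (c2 == c1 :> nat) = false by lia.
Qed.

Lemma sum_part_size : c1 < c2 -> part_size c0 + part_size c1 + part_size c2 = n.
Proof.
by move=> h; rewrite part_size0 part_size1 part_size2 //; have := ltn_ord c2; lia.
Qed.

Section Links.
Variable M : 'I_n -> 'I_n.
Hypothesis ncM : noncrossing_matching M.

Definition links u v := #|[set i | (part i == u) && (part (M i) == v)]|.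

Lemma linksC u v : links u v = links v u.
Proof.
have MK := noncrossing_inv ncM.
rewrite /links -(card_in_imset (f := M)); last by move=> x y _ _; apply: (inv_inj MK).
apply: eq_card => i; rewrite !inE; apply/imsetP/idP => [[j hj ->]|/andP[h1 h2]].
  by rewrite MK; move: hj; rewrite inE andbC.
by exists (M i); rewrite ?MK // inE MK h1 h2.
Qed.

(** Classifies the points of part [u] by the part of their mate; for [c1 = c2] the third summand
    would repeat the second. *)
Lemma links_sum u : u \in cuts ->
  part_size u = links u c0 + links u c1 + (if c1 < c2 then links u c2 else 0).
Proof.
move=> uc; rewrite -card_part // /links.
rewrite -(cardsID [set i | part (M i) == c0]) -addnA; congr (_ + _).
  by apply: eq_card => i; rewrite !inE.
rewrite -(cardsID [set i | part (M i) == c1]); congr (_ + _).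
  apply: eq_card => i; rewrite !inE; case: (part i == u); rewrite /= ?andbF //.
  by case: (part (M i) =P c1) => [->|_]; rewrite ?andbF // !andbT -val_eqE /=; lia.
have [h12|h12] := ltnP c1 c2.
  apply: eq_card => i; rewrite !inE; have := part_in_cuts (M i); rewrite in_cuts -!val_eqE /=.
  case: (part i == u) => /=; lia.
apply/eqP; rewrite cards_eq0; apply/eqP/setP => i; rewrite !inE.
have := part_in_cuts (M i); rewrite in_cuts -!val_eqE /=; lia.
Qed.

Definition next_cut u :=
  if u == c0 then c1 else if (u == c1) && (c1 < c2) then c2 else c0.

Lemma next_cut0 : next_cut c0 = c1.
Proof. by rewrite /next_cut eqxx. Qed.

Lemma next_cut1 : next_cut c1 = if c1 < c2 then c2 else c0.
Proof.
by rewrite /next_cut eqxx -val_eqE /= (_ : (c1 == c0 :> nat) = false) //; lia.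
Qed.

Lemma next_cut2 : next_cut c2 = c0.
Proof.
rewrite /next_cut; case: eqP => [e|_].
  by move/(congr1 (@nat_of_ord n)): e; lia.
case: eqP => //= /(congr1 (@nat_of_ord n)) e.
by rewrite ltnNge e leqnn.
Qed.

Lemma cut_in_link i j q : part j = next_cut (part i) -> q \in cuts -> in_arc i j q ->
  q = part i.
Proof.
move=> ej; rewrite in_cuts => hq ha; apply: ord_inj; move: ej hq ha; rewrite /in_arc.
case: (ltnP i j) => hij;
  case: (partP i) => -[hi ->]; rewrite ?next_cut0 ?next_cut1 ?next_cut2;
  try (case: (ltnP c1 c2) => h12);
  case: (partP j) => -[hj ->] /(congr1 (@nat_of_ord n)); rewrite -!val_eqE /=; lia.
Qed.

(** An arc from part [u] to the next part passes no cut but [u], and it contains a short arc, which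
    is a cut. *)
Lemma short_of_link u : u \in cuts -> 0 < links u (next_cut u) ->
  short_arcs M \subset cuts -> u \in short_arcs M.
Proof.
move=> uc /card_gt0P[i]; rewrite inE => /andP[/eqP pi /eqP pM] /subsetP sub.
have [q qs iq] := short_in_arc i ncM.
have /= e := @cut_in_link i (M i) q _ (sub q qs) iq.
by rewrite -pi -e // pi.
Qed.

(** What [strand_matching] says on the canonical web: the polygon edge between two parts has the
    weight of the spoke to the third. *)
Definition linked := forall u v, u \in cuts -> v \in cuts -> u != v ->
  if c1 < c2 then forall s, s \in cuts -> s != u -> s != v -> links u v = r - part_size s
  else links u v = r.

Lemma part_ordS q : part (ordS q) = if q \in cuts then next_cut q else part q.
Proof.
have e := ordS_cases q.
have h2 := ltn_ord c2; have P := partP (ordS q).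
have [qc|nq] := boolP (q \in cuts).
  apply: ord_inj; move: qc; rewrite in_cuts => /or3P[] /eqP eq; rewrite eq in e P *;
    rewrite ?next_cut0 ?next_cut1 ?next_cut2; try (case: (ltnP c1 c2) => h12);
    case: P => -[hj ->]; lia.
move: nq; rewrite in_cuts -!val_eqE /= => nq; apply: ord_inj.
by case: (partP q) => -[hq ->]; case: P => -[hj ->]; lia.
Qed.

Lemma next_cut_in u : next_cut u \in cuts.
Proof.
rewrite /next_cut in_cuts; case: (u == c0); first by rewrite eqxx orbT.
by case: (_ && _); rewrite eqxx ?orbT.
Qed.

Lemma links_selfP : (forall i, part (M i) != part i) <->
  (forall u, u \in cuts -> links u u = 0).
Proof.
split=> [h u uc|h i].
  apply/eqP; rewrite cards_eq0; apply/eqP/setP => i; rewrite !inE.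
  by apply/andP => -[/eqP <-]; apply/negP.
apply/eqP => e; have := h _ (part_in_cuts i).
by apply/eqP; rewrite -lt0n; apply/card_gt0P; exists i; rewrite inE e eqxx.
Qed.

Lemma short_arcs_sub : (forall i, part (M i) != part i) -> short_arcs M \subset cuts.
Proof.
move=> h; apply/subsetP => q; rewrite inE => /eqP e; apply: contraT => nq.
by have := h q; rewrite e part_ordS (negbTE nq) eqxx.
Qed.

Let cut_neqs : [/\ c0 != c1, c0 != c2 & (c1 != c2) = (c1 < c2)].
Proof. by rewrite -!val_eqE /=; split; lia. Qed.

(** The prescribed numbers of links already add up to the part sizes, so no arc stays inside a part.
    Then short arcs occur only at cuts, and as neighbouring parts have links, at every cut. *)
Lemma linked_short_arcs : valid_cuts -> linked ->
  short_arcs M = cuts /\ forall i, part (M i) != part i.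
Proof.
have [n01 n02 n12] := cut_neqs; have [i0 i1 i2] := cut_ins.
move=> hv hl; have := hl; rewrite /linked /valid_cuts in hl hv *; move: hl.
have S0 := links_sum i0; have S1 := links_sum i1; have S2 := links_sum i2.
case: (ltnP c1 c2) (n12) hv S0 S1 S2 => [h12 n12' hv S0 S1 S2 hl lk|h12 n12' hv S0 S1 _ hl lk].
  have l01 := hl _ _ i0 i1 n01 _ i2; have l02 := hl _ _ i0 i2 n02 _ i1.
  have l12 := hl _ _ i1 i2 n12' _ i0.
  have {}l01 : links c0 c1 = r - part_size c2 by apply: l01; rewrite eq_sym.
  have {}l02 : links c0 c2 = r - part_size c1 by apply: l02; rewrite // eq_sym.
  have {}l12 : links c1 c2 = r - part_size c0 by apply: l12.
  have sum := sum_part_size h12.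
  have e0 : part_size c0 < r /\ part_size c1 < r /\ part_size c2 < r.
    by rewrite part_size0 part_size1 part_size2 //; lia.
  have C10 := linksC c1 c0; have C20 := linksC c2 c0; have C21 := linksC c2 c1.
  have self : forall i, part (M i) != part i.
    by apply/links_selfP => u; rewrite in_cuts => /or3P[] /eqP->; lia.
  split=> //; apply/eqP; rewrite eqEsubset short_arcs_sub //=.
  apply/subsetP => u uc; apply: short_of_link => //; last exact: short_arcs_sub.
  move: uc; rewrite in_cuts => /or3P[] /eqP->; rewrite ?next_cut0 ?next_cut1 ?next_cut2 ?h12; lia.
have e12 : c2 = c1 by apply: ord_inj; lia.
have l01 := hl _ _ i0 i1 n01; have C10 := linksC c1 c0.
have z0 : part_size c0 = r.
  by rewrite part_size0 e12; move: hv; have := ltn_ord c1; lia.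
have z1 : part_size c1 = r.
  by rewrite part_size1; move: hv; lia.
have r0 : 0 < r by have := ltn_ord c0; lia.
have self : forall i, part (M i) != part i.
  by apply/links_selfP => u; rewrite in_cuts e12 orbb => /orP[] /eqP->; lia.
split=> //; apply/eqP; rewrite eqEsubset short_arcs_sub //=.
apply/subsetP => u uc; apply: short_of_link => //; last exact: short_arcs_sub.
move: uc; rewrite in_cuts e12 orbb => /orP[] /eqP->; rewrite ?next_cut0 ?next_cut1 ?e12 ?ltnn; lia.
Qed.

(** Each side of an arc contains a short arc, hence a cut, so no arc stays inside a part. The
    equations [links_sum] then determine the links; they are positive because of the short arc at
    each cut, which yields [valid_cuts]. *)
Lemma short_arcs_linked : short_arcs M = cuts -> valid_cuts /\ linked.
Proof.
have [n01 n02 n12] := cut_neqs; have [i0 i1 i2] := cut_ins.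
move=> hs.
have self : forall i, part (M i) != part i.
  move=> i; apply/eqP => e; have := noncrossing_neq ncM i => ne.
  have [q qs hq] := short_in_arc i ncM; have [q' qs' hq'] := short_in_arc (M i) ncM.
  rewrite (noncrossing_inv ncM) in hq'; rewrite hs in qs qs'.
  by case: (no_cut_in_arc e ne) => h; [move: (h q' qs')|move: (h q qs)]; rewrite ?hq ?hq'.
have /links_selfP zs := self.
have pos u : u \in cuts -> 0 < links u (next_cut u).
  move=> uc; apply/card_gt0P; exists u; rewrite inE part_cut // eqxx /=.
  by have := uc; rewrite -hs inE => /eqP->; rewrite part_ordS uc.
have p0 := pos _ i0; have p1 := pos _ i1; have p2 := pos _ i2.
rewrite next_cut0 in p0; rewrite next_cut1 in p1; rewrite next_cut2 in p2.
have z0 := zs _ i0; have z1 := zs _ i1; have z2 := zs _ i2.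
have S0 := links_sum i0; have S1 := links_sum i1; have S2 := links_sum i2.
have C10 := linksC c1 c0; have C20 := linksC c2 c0; have C21 := linksC c2 c1.
rewrite /linked /valid_cuts.
case: (ltnP c1 c2) (n12) S0 S1 S2 p1 => [h12 n12' S0 S1 S2 p1|h12 n12' S0 S1 _ p1].
  have sum := sum_part_size h12.
  have l01 : links c0 c1 = r - part_size c2 by lia.
  have l02 : links c0 c2 = r - part_size c1 by lia.
  have l12 : links c1 c2 = r - part_size c0 by lia.
  split.
    have : part_size c0 < r /\ part_size c1 < r /\ part_size c2 < r by lia.
    by rewrite part_size0 part_size1 part_size2 //; lia.
  move=> u v; rewrite !in_cuts => /or3P[] /eqP-> /or3P[] /eqP-> nuv s;
    rewrite in_cuts => /or3P[] /eqP->; rewrite ?eqxx // in nuv * => _ _; lia.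
have e12 : c2 = c1 by apply: ord_inj; lia.
have z : part_size c0 = r /\ part_size c1 = r.
  have : part_size c0 + part_size c1 = n.
    rewrite part_size0 part_size1 e12.
    have := ltn_ord c1; lia.
  lia.
split.
  move: z; rewrite part_size0 part_size1 e12.
  have := ltn_ord c1; lia.
move=> u v; rewrite !in_cuts e12 !orbb => /orP[] /eqP-> /orP[] /eqP-> nuv; rewrite ?eqxx // in nuv *; lia.
Qed.
End Links.
End Cuts.

(** * Uniqueness of the matching with prescribed links *)

Section Openers.
Variables (r : nat).
Local Notation n := (2 * r).
Variables (c0 c1 c2 : 'I_n).
Hypotheses (c01 : c0 < c1) (c12 : c1 <= c2).
Implicit Types (i j u v s : 'I_n) (M : 'I_n -> 'I_n).
Local Notation part := (part c0 c1 c2).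

Let ope M (a b : nat) := [set i : 'I_n | (a < i <= b) && (i < M i)].
Let clos M (a b : nat) := [set i : 'I_n | (a < i <= b) && (M i < i)].

Section OneMatching.
Variable M : 'I_n -> 'I_n.
Hypotheses (ncM : noncrossing_matching M) (self : forall i, part (M i) != part i).

Lemma opener_low i : i <= c0 -> i < M i.
Proof.
by have := self i; rewrite neq_part //; lia.
Qed.

Lemma closer_high i : c2 < i -> M i < i.
Proof.
by have := self i; rewrite neq_part //; lia.
Qed.

(** An opener followed by a closer in the same part would have their mates outside the part on
    opposite sides, and the two arcs would cross. So the openers form a final segment of the
    part. *)
Lemma opener_up i j : (c0 < i) && (j <= c1) || (c1 < i) && (j <= c2) ->
  i <= j -> i < M i -> j < M j.
Proof.
move=> seg; rewrite leq_eqVlt => /orP[/eqP/ord_inj->//|ij] oi.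
have := noncrossing_neq ncM j; rewrite -val_eqE /= neq_ltn => /orP[cj|//].
have hMj : M j < i.
  by have := self j; rewrite neq_part //; lia.
have hMi : j < M i.
  by have := self i; rewrite neq_part //; lia.
have := @noncrossing_in n M i j ncM ij hMi; lia.
Qed.

Lemma card_ope : c0.+1 + #|ope M c0 c1| + #|ope M c1 c2| = r.
Proof.
have [ho _] := card_openers (noncrossing_inv ncM) (noncrossing_neq ncM).
apply: etrans ho; rewrite -[RHS](cardID [pred i : 'I_n | i <= c0]).
have e0 : c0.+1 = #|[pred i : 'I_n | i < c0.+1]| by rewrite card_ord_ltn; have := ltn_ord c0; lia.
rewrite -addnA; congr (_ + _).
  rewrite e0; apply: eq_card => i; rewrite !inE ltnS.
  by have := @opener_low i; lia.
rewrite -[RHS](cardID [pred i : 'I_n | i <= c1]); congr (_ + _).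
  by apply: eq_card => i; rewrite !inE /=; lia.
apply: eq_card => i; rewrite !inE /=.
have := @closer_high i; have := closerN (noncrossing_neq ncM) i; lia.
Qed.

Lemma card_ope_clos : #|ope M c1 c2| + #|clos M c1 c2| = c2 - c1.
Proof.
rewrite -(@card_ord_interval n c1 c2) // -[RHS](cardID [pred i : 'I_n | i < M i]).
congr (_ + _); apply: eq_card => i; rewrite !inE ?(closerN (noncrossing_neq ncM)) /=; lia.
Qed.

End OneMatching.

Section TwoMatchings.
Variables M M' : 'I_n -> 'I_n.
Hypotheses (ncM : noncrossing_matching M) (self : forall i, part (M i) != part i).
Hypotheses (ncM' : noncrossing_matching M') (self' : forall i, part (M' i) != part i).
Hypothesis eq_links : c1 < c2 -> links c0 c1 c2 M c1 c2 = links c0 c1 c2 M' c1 c2.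

Lemma links_ope N : (forall i, part (N i) != part i) -> links c0 c1 c2 N c1 c2 <= #|ope N c0 c1|.
Proof.
move=> selfN; apply: subset_leq_card; apply/subsetP => i; rewrite !inE -!val_eqE.
have := selfN i; rewrite -val_eqE; case: (partP c0 c1 c2 i) => -[hi ->];
  case: (partP c0 c1 c2 (N i)) => -[hj ->] /=; lia.
Qed.

Lemma links_clos N : (forall i, part (N i) != part i) -> links c0 c1 c2 N c2 c1 <= #|clos N c1 c2|.
Proof.
move=> selfN; apply: subset_leq_card; apply/subsetP => i; rewrite !inE -!val_eqE.
have := selfN i; rewrite -val_eqE; case: (partP c0 c1 c2 i) => -[hi ->];
  case: (partP c0 c1 c2 (N i)) => -[hj ->] /=; lia.
Qed.

(* With more openers in the second part, M' would have an arc from the second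
   part to the end and one from the third part to the beginning; they cross. *)
Lemma card_ope_leq : #|ope M' c0 c1| <= #|ope M c0 c1|.
Proof.
rewrite leqNgt; apply/negP => h1.
have t := card_ope ncM self; have t' := card_ope ncM' self'.
have d := card_ope_clos ncM; have d' := card_ope_clos ncM'.
have h12 : c1 < c2 by lia.
have e := eq_links h12.
have [a ha hMa] : exists2 a : 'I_n, c0 < a <= c1 & c2 < M' a.
  apply/exists_inP; apply: contraT; rewrite negb_exists_in => /forall_inP hno.
  have := links_ope self; rewrite e leqNgt (leq_trans h1) //.
  apply: subset_leq_card; apply/subsetP => i; rewrite !inE -!val_eqE /= => /andP[hi oi].
  have := hno i hi; have := self' i; rewrite -val_eqE; case: (partP c0 c1 c2 i) => -[hi' ->];
  case: (partP c0 c1 c2 (M' i)) => -[hj ->] /=; lia.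
have [b hb hMb] : exists2 b : 'I_n, c1 < b <= c2 & M' b <= c0.
  apply/exists_inP; apply: contraT; rewrite negb_exists_in => /forall_inP hno.
  have := links_clos self; rewrite linksC // e linksC // leqNgt (@leq_trans #|clos M' c1 c2|) //; first lia.
  apply: subset_leq_card; apply/subsetP => i; rewrite !inE -!val_eqE /= => /andP[hi oi].
  have := hno i hi; have := self' i; rewrite -val_eqE; case: (partP c0 c1 c2 i) => -[hi' ->];
  case: (partP c0 c1 c2 (M' i)) => -[hj ->] /=; lia.
have := @noncrossing_in n M' (M' b) a ncM'; rewrite (noncrossing_inv ncM'); lia.
Qed.
End TwoMatchings.

Lemma linked_openers M M' : valid_cuts c0 c1 c2 ->
  noncrossing_matching M -> noncrossing_matching M' ->
  linked c0 c1 c2 M -> linked c0 c1 c2 M' -> forall i, (i < M i) = (i < M' i).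
Proof.
move=> hv ncM ncM' lM lM'.
have [_ self] := linked_short_arcs c01 c12 ncM hv lM.
have [_ self'] := linked_short_arcs c01 c12 ncM' hv lM'.
have e : c1 < c2 -> links c0 c1 c2 M c1 c2 = links c0 c1 c2 M' c1 c2.
  move=> h12; have [i0 i1 i2] := cut_ins c0 c1 c2.
  have n12 : c1 != c2 by rewrite -val_eqE /=; lia.
  have := lM _ _ i1 i2 n12; have := lM' _ _ i1 i2 n12; rewrite h12.
  have n01 : c0 != c1 by rewrite -val_eqE /=; lia.
  have n02 : c0 != c2 by rewrite -val_eqE /=; lia.
  by move=> /(_ _ i0 n01 n02) -> /(_ _ i0 n01 n02) ->.
have g := card_ope_leq ncM self ncM' self' e.
have g' := card_ope_leq ncM' self' ncM self (fun h => esym (e h)).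
have t := card_ope ncM self; have t' := card_ope ncM' self'.
(* Final segments are determined by their sizes: an opener of [N] that is not one of [N'] would
   leave [N'] with fewer openers in this part. *)
have sub N N' a b : (a = c0 :> nat /\ b = c1 :> nat) \/ (a = c1 :> nat /\ b = c2 :> nat) ->
    noncrossing_matching N -> noncrossing_matching N' ->
    (forall i, part (N i) != part i) -> (forall i, part (N' i) != part i) ->
    #|ope N a b| = #|ope N' a b| -> forall i, a < i <= b -> i < N i -> i < N' i.
  move=> hab ncN ncN' sN sN' ec i hi oi; apply: contraT => ci.
  have sb : ope N' a b \subset ope N a b.
    apply/subsetP => j; rewrite !inE => /andP[hj oj]; rewrite hj /=.
    have ij : i <= j.
      rewrite leqNgt; apply/negP => ji; move/negP: ci; apply.
      by apply: (opener_up ncN' sN' _ (ltnW ji) oj); lia.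
    by apply: (opener_up ncN sN _ ij oi); lia.
  have /setP/(_ i) : ope N' a b = ope N a b by apply/eqP; rewrite eqEcard sb ec leqnn.
  by rewrite !inE hi /= oi (negbTE ci).
have ec1 : #|ope M c0 c1| = #|ope M' c0 c1| by lia.
have ec2 : #|ope M c1 c2| = #|ope M' c1 c2| by lia.
move=> i; have [h0|h0] := leqP i c0; first by rewrite !opener_low.
have [h2|h2] := ltnP c2 i.
  have := closer_high self h2; have := closer_high self' h2; lia.
have [h1|h1] := leqP i c1.
  have s1 : (c0 = c0 :> nat /\ c1 = c1 :> nat) \/ (c0 = c1 :> nat /\ c1 = c2 :> nat) by left.
  have hi : c0 < i <= c1 by rewrite h0.
  by apply/idP/idP; [exact: (sub M M' _ _ s1)|exact: (sub M' M _ _ s1)].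
have s1 : (c1 = c0 :> nat /\ c2 = c1 :> nat) \/ (c1 = c1 :> nat /\ c2 = c2 :> nat) by right.
have hi : c1 < i <= c2 by rewrite h1.
by apply/idP/idP; [exact: (sub M M' _ _ s1)|exact: (sub M' M _ _ s1)].
Qed.
End Openers.

(* A noncrossing matching is determined by its openers: at the first closer with
   two different mates, the inner one of the mates would have no place to go. *)
Lemma openers_inj n (M M' : 'I_n -> 'I_n) :
  noncrossing_matching M -> noncrossing_matching M' ->
  (forall i : 'I_n, (i < M i) = (i < M' i)) -> M =1 M'.
Proof.
move=> ncM ncM' e.
have MK := noncrossing_inv ncM; have MK' := noncrossing_inv ncM'.
have cl N j (ncN : noncrossing_matching N) := closerN (noncrossing_neq ncN) j.
have key N N' : noncrossing_matching N -> noncrossing_matching N' ->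
    (forall i : 'I_n, (i < N i) = (i < N' i)) -> forall j : 'I_n, N j < j ->
    (forall j' : 'I_n, j' < j -> N j' < j' -> N j' = N' j') -> ~~ (N j < N' j).
  move=> ncN ncN' eN j cj IH; apply/negP => lt.
  have NK := noncrossing_inv ncN; have NK' := noncrossing_inv ncN'.
  have cj' : N' j < j by rewrite cl // -eN -cl.
  have o' : N' j < N (N' j) by rewrite eN NK'.
  have := @noncrossing_in n N (N j) (N' j) ncN; rewrite NK => /(_ lt cj') /andP[_ h].
  have := IH (N (N' j)) h; rewrite NK => /(_ o') eq.
  by move: h; rewrite -(inv_inj NK' eq) ltnn.
have closers j : M j < j -> M j = M' j.
  have [m] := ubnP (j : nat); elim: m j => // m IH j hm cj.
  have IH' (j' : 'I_n) : j' < j -> M j' < j' -> M j' = M' j' by move=> h; apply: IH; lia.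
  have k1 := key M M' ncM ncM' e j cj IH'.
  have cj' : M' j < j by rewrite cl // -e -cl.
  have k2 : ~~ (M' j < M j).
    apply: (key M' M ncM' ncM (fun i => esym (e i)) j cj') => j' hj' cj''.
    by apply/esym/IH' => //; rewrite cl // e -cl.
  by apply: ord_inj; move: k1 k2; case: ltngtP.
move=> i; have [ci|] := boolP (M i < i); first exact: closers.
rewrite cl // negbK => oi.
have := closers (M i); rewrite MK => /(_ oi) h.
by rewrite [in RHS]h MK'.
Qed.

(** * Existence of a matching with prescribed cuts *)

Definition rotate n (M : 'I_n -> 'I_n) (i : 'I_n) := ordS (M (ord_pred i)).

Lemma rotate_noncrossing n (M : 'I_n -> 'I_n) :
  noncrossing_matching M -> noncrossing_matching (rotate M).
Proof.
case=> MK Mne nc; split=> [i|i|i j [ij jRi RiRj]].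
- by rewrite /rotate ordSK MK ord_predK.
- apply: contra (Mne (ord_pred i)) => /eqP e.
  by apply/eqP/ordS_inj; rewrite ord_predK.
move: ij jRi RiRj; rewrite /rotate.
move: (ord_pred i) (ord_pred j) (ord_predK i) (ord_predK j) => p q <- <- {i j}.
have := nc p q; have := nc q (M p); have := nc (M p) (M q); have := nc (M q) p.
rewrite !MK !val_ordS.
have := Mne p; have := Mne q; rewrite -!val_eqE /=.
have := ltn_ord p; have := ltn_ord q; have := ltn_ord (M p); have := ltn_ord (M q).
move=> h1 h2 h3 h4 h5 h6 g1 g2 g3 g4.
do 4 (case: eqP => ?); try lia; move=> a b c;
  by [apply: g4; split; lia|apply: g3; split; lia].
Qed.

Lemma short_arcs_rotate n (M : 'I_n -> 'I_n) :
  short_arcs (rotate M) = [set ordS i | i in short_arcs M].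
Proof.
apply/setP => i; rewrite inE /rotate (inj_eq (@ordS_inj n)); apply/eqP/imsetP => [e|[j]].
  by exists (ord_pred i); rewrite ?ord_predK // inE ord_predK e.
by rewrite inE => /eqP e ->; rewrite ordSK e.
Qed.

Lemma iter_rotate n (M : 'I_n -> 'I_n) s : noncrossing_matching M ->
  noncrossing_matching (iter s (@rotate n) M) /\
  short_arcs (iter s (@rotate n) M) = [set iter s (@ordS n) i | i in short_arcs M].
Proof.
move=> ncM; elim: s => [|s [IH1 IH2]] /=.
  by split=> //; rewrite imset_id.
split; first exact: rotate_noncrossing.
by rewrite short_arcs_rotate IH2 -imset_comp.
Qed.

Lemma val_iter_ordS n (i : 'I_n) s : iter s (@ordS n) i = (i + s) %% n :> nat.
Proof.
elim: s => [|s IH] /=; first by rewrite addn0 modn_small.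
by rewrite IH addnS -addn1 modnDml addn1.
Qed.

Ltac split_ifs :=
  repeat (match goal with |- context [if ?b then _ else _] => destruct b eqn:? end).

Section Rainbows.
Variables (r m0 m1 m2 : nat).
Local Notation n := (2 * r).
Hypotheses (m_gt0 : 0 < m0) (sum_m : m0 + m1 + m2 = r).

(* Three rainbows of m0, m1 and m2 arcs, side by side; a rotation moves their
   innermost arcs to the cuts. *)
Definition rainbow_mate (t : nat) :=
  if t < m0.*2 then m0.*2.-1 - t
  else if t < (m0 + m1).*2 then m0.*2.*2 + m1.*2.-1 - t
  else m0.*2.*2 + m1.*2.*2 + m2.*2.-1 - t.

Lemma rainbowP : exists M : 'I_n -> 'I_n,
  noncrossing_matching M /\ forall i, M i = rainbow_mate i :> nat.
Proof.
have lt (i : 'I_n) : rainbow_mate i < n.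
  by rewrite /rainbow_mate; have := ltn_ord i; split_ifs; lia.
exists (fun i => Ordinal (lt i)); split=> //; split=> [i|i|i j].
- by apply: ord_inj; rewrite /= /rainbow_mate; have := ltn_ord i; split_ifs; lia.
- by rewrite -val_eqE /= /rainbow_mate; have := ltn_ord i; split_ifs; lia.
rewrite /= /rainbow_mate; have := ltn_ord i; have := ltn_ord j => h1 h2.
by split_ifs; case; lia.
Qed.
End Rainbows.

Section LinkedExists.
Variable r : nat.
Local Notation n := (2 * r).

Lemma linked_exists (c0 c1 c2 : 'I_n) : c0 < c1 -> c1 <= c2 -> valid_cuts c0 c1 c2 ->
  exists M, noncrossing_matching M /\ short_arcs M = cuts c0 c1 c2.
Proof.
move=> c01 c12 hv.
have hc2 := ltn_ord c2.
have [m0 [m1 [m2 [m0_gt0 sum_m e1 e2 e3]]]] : exists m0 m1 m2, [/\ 0 < m0, m0 + m1 + m2 = r,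
    m0 + m1 = c1 - c0, m0 + m2 + c2 = n + c0 &
    m1 = 0 /\ m2 = 0 /\ c2 = c1 :> nat \/ 0 < m1 /\ 0 < m2].
  (* The sizes are the numbers of links over [c0], [c1] and [c2], each [r] minus the size of the
     remaining part. For two cuts they are [r], 0 and 0. *)
  exists (r - (c2 - c1)), (c2 - c0 - r), (r - (c1 - c0)).
  move: hv; rewrite /valid_cuts; case: ltnP => h hv; split; lia.
have [M [ncM eM]] := @rainbowP r m0 m1 m2 m0_gt0 sum_m.
(* The innermost arc of the first rainbow starts at [m0.-1] and is moved to [c0]; the summand [n]
   avoids a truncated subtraction. *)
have [ncR sR] := iter_rotate (c0.+1 + n - m0) ncM.
exists (iter (c0.+1 + n - m0) (@rotate n) M); split=> //; rewrite sR.
have c0r : m0 <= r by lia.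
(* One short arc per nonempty rainbow. A single rainbow has in addition its outermost arc, which is
   short across the last point. *)
have shortE (x : 'I_n) : (x \in short_arcs M) = [|| x == m0.-1 :> nat,
    (x == m0.*2 + m1.-1 :> nat) && (0 < m1), (x == (m0 + m1).*2 + m2.-1 :> nat) && (0 < m2)
  | (x == n.-1 :> nat) && (m1 == 0) && (m2 == 0)].
  rewrite inE -val_eqE; change (\val (M x)) with (nat_of_ord (M x)); change (\val (ordS x)) with (nat_of_ord (ordS x)).
  rewrite eM val_ordS /rainbow_mate; have := ltn_ord x.
  move: sum_m; clear -m0_gt0 e3; case: e3 => [[-> [-> _]]|[p1 p2]] sum_m;
    rewrite ?p1 ?p2 ?(gtn_eqF p1) /= ?andbT ?andbF ?orbF; split_ifs => h;
    apply/eqP/idP; lia.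
have valE (x : 'I_n) (c : 'I_n) : x + (c0.+1 + n - m0) = c + n -> iter (c0.+1 + n - m0) (@ordS n) x = c.
  by move=> e; apply: ord_inj; rewrite val_iter_ordS e modnDr modn_small.
apply/setP => u; rewrite in_cuts; apply/imsetP/idP => [[x]|].
  rewrite shortE => /or4P[/eqP ex|/andP[/eqP ex h]|/andP[/eqP ex h]|/andP[/andP[/eqP ex h] h']] ->.
  - by rewrite (valE x c0) ?eqxx //; lia.
  - by rewrite (valE x c1) ?eqxx ?orbT //; lia.
  - by rewrite (valE x c2) ?eqxx ?orbT //; lia.
  - by rewrite (valE x c1) ?eqxx ?orbT //; lia.
have ex (t : nat) (c : 'I_n) : t < n -> t + (c0.+1 + n - m0) = c + n ->
   (forall x : 'I_n, x = t :> nat -> x \in short_arcs M) ->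
   exists2 x, x \in short_arcs M & c = iter (c0.+1 + n - m0) (@ordS n) x.
  move=> ht e hs; exists (Ordinal ht); first exact: hs.
  by rewrite (valE _ c).
case/or3P => /eqP->.
- apply: (ex m0.-1); [lia|lia|move=> x ex'; rewrite shortE; lia].
- case: e3 => [[z1 [z2 z3]]|[p1 p2]].
    apply: (ex n.-1); [lia|lia|move=> x ex'; rewrite shortE; lia].
  apply: (ex (m0.*2 + m1.-1)); [lia|lia|move=> x ex'; rewrite shortE; lia].
- case: e3 => [[z1 [z2 z3]]|[p1 p2]].
    apply: (ex n.-1); [lia|lia|move=> x ex'; rewrite shortE; lia].
  apply: (ex ((m0 + m1).*2 + m2.-1)); [lia|lia|move=> x ex'; rewrite shortE; lia].
Qed.

End LinkedExists.

(** The two sides of any arc contain different short arcs, so there are at least two. *)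
Lemma short_arcs_are_cuts r (M : 'I_(2 * r) -> 'I_(2 * r)) : 0 < r ->
  noncrossing_matching M -> #|short_arcs M| <= 3 ->
  exists c0 c1 c2 : 'I_(2 * r), [/\ c0 < c1, c1 <= c2 & short_arcs M = cuts c0 c1 c2].
Proof.
move=> r0 ncM h3; apply: set_cuts; rewrite h3 andbT.
have n0 : 0 < 2 * r by lia.
pose i := Ordinal n0.
have [q qs hq] := short_in_arc i ncM; have [q' qs' hq'] := short_in_arc (M i) ncM.
rewrite (noncrossing_inv ncM) in hq'.
have ne : q != q'.
  have := noncrossing_neq ncM i.
  apply: contraNneq => e; apply/eqP/ord_inj; move: hq hq'; rewrite e /in_arc; split_ifs; lia.
apply: leq_trans (_ : #|[set q; q']| <= _); first by rewrite cards2 ne.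
by apply: subset_leq_card; apply/subsetP => x; rewrite !inE => /orP[] /eqP->; move: qs qs'; rewrite !inE.
Qed.

(** * Euler's formula *)

Lemma n_comp_invariant (T L : finType) (e : rel T) (k : T -> L) :
  connect_sym e -> (forall x y, connect e x y = (k x == k y)) ->
  n_comp e T = #|[set k x | x : T]|.
Proof.
move=> sym ke; rewrite /n_comp_mem -(card_in_image (f := k)).
  apply: eq_card => l; apply/imageP/imsetP => [[x _ ->]|[x _ ->]]; first by exists x.
  exists (root e x); first by rewrite inE /= roots_root.
  by apply/eqP; rewrite -ke connect_root.
move=> x y; rewrite !inE !andbT => /eqP rx /eqP ry /eqP; rewrite -ke => /(rootP sym).
by rewrite rx ry.
Qed.

Section Vertices.
Variables (n : nat) (G : hgraph n).
Implicit Types (x y : G).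

Lemma mem_vtx x : x \in vtx x.
Proof. exact: porbit_id. Qed.

Lemma vtx_eq x y : (y \in vtx x) = (vtx y == vtx x).
Proof. by rewrite /vtx eq_porbit_mem. Qed.

Lemma vtx_rot x : vtx (rot G x) = vtx x.
Proof. by apply/eqP; rewrite -vtx_eq; have := mem_porbit (rot G) 1 x; rewrite expg1. Qed.

Lemma vtx_fconnect x y : (y \in vtx x) = fconnect (rot G) x y.
Proof.
apply/porbitP/idP => [[i ->]|/iter_findex <-]; first by rewrite permX fconnect_iter.
by exists (findex (rot G) x y); rewrite permX.
Qed.
End Vertices.

Section Euler.
Variables (n : nat) (G : hgraph n).
Hypotheses (oppK : involutive (@opp n G)) (opp_neq : forall x : G, opp x != x).
Hypotheses (bdryI : injective (@bdry n G)) (bdry_rot : forall i, rot G (bdry G i) = bdry G i).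
Implicit Types (x y : G).

Definition face_step : G -> G := @closed_rot n G \o @opp n G.

Definition interior_vertices : {set {set G}} := [set vtx x | x in [pred x : G | ~~ is_bdry x]].

Lemma is_bdryP x : reflect (exists i, x = bdry G i) (is_bdry x).
Proof.
apply: (iffP codomP) => -[i ->]; by exists i.
Qed.

Lemma is_bdry_bdry i : is_bdry (bdry G i).
Proof. by apply/is_bdryP; exists i. Qed.

Lemma closed_rot_bdry i : closed_rot (bdry G i) = bdry G (ord_pred i).
Proof.
rewrite /closed_rot; case: pickP => [j /eqP/bdryI -> //|/(_ i)].
by rewrite eqxx.
Qed.

Lemma closed_rot_int x : ~~ is_bdry x -> closed_rot x = rot G x.
Proof.
rewrite /closed_rot; case: pickP => // i /eqP <-; by rewrite is_bdry_bdry.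
Qed.

Lemma is_bdry_rot x : is_bdry (rot G x) = is_bdry x.
Proof.
apply/is_bdryP/is_bdryP => -[i e]; exists i; last by rewrite e bdry_rot.
by apply: (@perm_inj _ (rot G)); rewrite bdry_rot.
Qed.

Lemma is_bdry_vtx x y : y \in vtx x -> is_bdry y = is_bdry x.
Proof.
by rewrite vtx_fconnect => /iter_findex <-; elim: findex => //= m <-; rewrite is_bdry_rot.
Qed.

Lemma is_bdry_closed_rot x : is_bdry (closed_rot x) = is_bdry x.
Proof.
have [/is_bdryP[i ->]|ib] := boolP (is_bdry x).
  by rewrite closed_rot_bdry is_bdry_bdry.
by rewrite closed_rot_int // is_bdry_rot (negbTE ib).
Qed.

Lemma closed_rot_inj : injective (@closed_rot n G).
Proof.
move=> x y e; have eb : is_bdry x = is_bdry y by rewrite -is_bdry_closed_rot e is_bdry_closed_rot.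
have [/is_bdryP[i ex]|ib] := boolP (is_bdry x).
  have /is_bdryP[j ey] : is_bdry y by rewrite -eb ex is_bdry_bdry.
  by move: e; rewrite ex ey !closed_rot_bdry => /bdryI/ord_pred_inj->.
move: e; rewrite !closed_rot_int -?eb //; exact: perm_inj.
Qed.

Lemma face_step_inj : injective face_step.
Proof. exact: inj_comp closed_rot_inj (inv_inj oppK). Qed.

Lemma fconnect_bdry (i j : 'I_n) : fconnect (@closed_rot n G) (bdry G i) (bdry G j).
Proof.
have H (k : 'I_n) : fconnect (@closed_rot n G) (bdry G (ordS k)) (bdry G k).
  by rewrite -{2}(ordSK k) -closed_rot_bdry fconnect1.
have n0 : 0 < n by apply: leq_ltn_trans (ltn_ord i).
have K (k : 'I_n) : fconnect (@closed_rot n G) (bdry G k) (bdry G (Ordinal n0)).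
  have [m] := ubnP (k : nat); elim: m k => // m IH k hk.
  have [k0|kpos] := posnP (k : nat).
    by rewrite (_ : k = Ordinal n0) //; apply: val_inj.
  apply: (connect_trans (y := bdry G (ord_pred k))).
    by rewrite -{1}(ord_predK k) H.
  apply: IH; rewrite /= (_ : (k + n).-1 = k.-1 + n); last lia.
  by rewrite modnDr modn_small; have := ltn_ord k; lia.
by apply: connect_trans (K i) _; rewrite (fconnect_sym closed_rot_inj) K.
Qed.

Lemma fconnect_closed_rot_int x y : ~~ is_bdry x ->
  fconnect (@closed_rot n G) x y = (y \in vtx x).
Proof.
move=> ib; rewrite vtx_fconnect.
have e k : iter k (@closed_rot n G) x = iter k (rot G) x /\ ~~ is_bdry (iter k (rot G) x).
  elim: k => //= k [-> IH]; split; last by rewrite is_bdry_rot.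
  by rewrite closed_rot_int.
apply/idP/idP => /iter_findex <-; first by rewrite (e _).1 fconnect_iter.
by rewrite -(e _).1 fconnect_iter.
Qed.

Lemma fcard_closed_rot : 0 < n -> fcard (@closed_rot n G) G = #|interior_vertices|.+1.
Proof.
move=> n0; pose k x := if is_bdry x then None else Some (vtx x).
rewrite (@n_comp_invariant _ _ _ k); first last.
- move=> x y; rewrite /k.
  have [/is_bdryP[i ->]|ix] := boolP (is_bdry x).
    have [/is_bdryP[j ->]|iy] := boolP (is_bdry y); first by rewrite fconnect_bdry.
    rewrite (fconnect_sym closed_rot_inj) fconnect_closed_rot_int // vtx_eq.
    by apply/negbTE; apply: contra iy; rewrite -vtx_eq => /is_bdry_vtx <-; exact: is_bdry_bdry.
  rewrite fconnect_closed_rot_int //.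
  have [/is_bdryP[j ->]|iy] := boolP (is_bdry y).
    by apply/negbTE; apply: contra ix => /is_bdry_vtx <-; exact: is_bdry_bdry.
  by rewrite vtx_eq eq_sym (inj_eq (@Some_inj _)).
- exact: (fconnect_sym closed_rot_inj).
have -> : [set k x | x : G] = None |: [set Some v | v in interior_vertices].
  apply/setP => -[v|]; rewrite !inE /=.
    apply/imsetP/imsetP => [[x _]|[u /imsetP[x]]].
      rewrite /k; case: ifPn => // ix [->]; exists (vtx x) => //.
      by apply: imset_f; rewrite inE.
    by rewrite inE => ix -> [->]; exists x; rewrite // /k (negbTE ix).
  by apply/imsetP; exists (bdry G (Ordinal n0)); rewrite // /k is_bdry_bdry.
rewrite cardsU1 card_imset; last exact: Some_inj.
by have -> : None \notin [set Some v | v in interior_vertices] by apply/imsetP => -[].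
Qed.

Lemma fcard_opp : fcard (@opp n G) G * 2 = #|G|.
Proof.
apply: fcard_order_set => //; first exact: inv_inj.
  apply/subsetP => x _; rewrite inE; apply/eqP.
  have e : orbit (@opp n G) x =i [:: x; opp x].
    move=> y; rewrite -fconnect_orbit; apply/idP/idP => [/iter_findex <-|].
      elim: findex => /= [|m]; first by rewrite inE eqxx.
      by rewrite !inE => /orP[] /eqP->; rewrite ?oppK eqxx ?orbT.
    by rewrite !inE => /orP[] /eqP->; rewrite ?connect0 ?fconnect1.
  rewrite /order (eq_card (B := mem [:: x; opp x])).
    by rewrite (card_uniqP _) //= inE eq_sym opp_neq.
  by move=> y; rewrite -e -fconnect_orbit.
Qed.

Hypothesis noiso : no_isolated_component G.

Lemma closed_link_connected x y : 0 < n -> connect (@closed_link n G) x y.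
Proof.
move=> n0.
have one x' y' : closed_link x' y' -> connect (@closed_link n G) y' x'.
  case/orP=> /eqP->; last by apply: connect1; rewrite /closed_link /= oppK eqxx orbT.
  have : fconnect (@closed_rot n G) (closed_rot x') x'.
    by rewrite (fconnect_sym closed_rot_inj) fconnect1.
  apply: connect_sub => u v /eqP <-; by apply: connect1; rewrite /closed_link /= eqxx.
have symm x' y' : connect (@closed_link n G) x' y' -> connect (@closed_link n G) y' x'.
  case/connectP=> p; elim: p x' => [|z p IH] x' /=; first by move=> _ ->.
  by case/andP=> /one h1 /IH h2 /h2 h3; apply: connect_trans h3 h1.
have tob x' : exists i, connect (@closed_link n G) x' (bdry G i).
  have [i h] := noiso x'; exists i; apply: connect_sub h => u v /orP[] /eqP->.
    have [/is_bdryP[j ->]|iu] := boolP (is_bdry u); first by rewrite bdry_rot.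
    by apply: connect1; rewrite /closed_link /= -closed_rot_int ?eqxx.
  by apply: connect1; rewrite /closed_link /= eqxx orbT.
have [i hi] := tob x; have [j hj] := tob y.
apply: connect_trans hi _; apply: connect_trans (symm _ _ hj).
have : fconnect (@closed_rot n G) (bdry G i) (bdry G j) by exact: fconnect_bdry.
apply: connect_sub => u v /eqP <-; by apply: connect1; rewrite /closed_link /= eqxx.
Qed.

(** All boundary vertices together count as one vertex of the sphere, and there is one component
    because every dart is connected to the boundary. *)
Lemma planarE : 0 < n ->
  planar G <-> #|interior_vertices|.+1 + fcard face_step G = #|G|./2.+2.
Proof.
move=> n0; rewrite /planar -/face_step fcard_closed_rot //.
have -> : n_comp (@closed_link n G) G = 1.
  rewrite (@n_comp_invariant _ unit _ (fun=> tt)).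
  - rewrite (_ : [set tt | x : G] = [set tt]) ?cards1 //.
    apply/setP => -[]; rewrite !inE; apply/imsetP; exists (bdry G (Ordinal n0)) => //.
  - by move=> x y; rewrite !closed_link_connected.
  - by move=> x y; rewrite closed_link_connected // eqxx.
have := fcard_opp; move: (fcard _ _) (fcard _ _) #|G| => a b c; lia.
Qed.

Lemma card_faces : (forall x, exists i, fconnect face_step x (bdry G i)) ->
  fcard face_step G = #|[set froot face_step (bdry G i) | i : 'I_n]|.
Proof.
move=> h; rewrite /n_comp_mem; apply: eq_card => x; rewrite !inE andbT.
apply/eqP/imsetP => [rx|[i _ ->]]; last first.
  by rewrite (root_root (fconnect_sym face_step_inj)).
have [i ci] := h x; exists i => //.
by rewrite -[LHS]rx; apply/(rootP (fconnect_sym face_step_inj)).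
Qed.
End Euler.

(** * Canonical forest webs *)

Lemma sum_bool_pair (I : finType) (F : bool * I -> nat) :
  \sum_p F p = \sum_i F (true, i) + \sum_i F (false, i).
Proof.
rewrite (eq_bigr (fun p => (fun b i => F (b, i)) p.1 p.2)); last by case.
by rewrite -(pair_bigA _ (fun b i => F (b, i))) big_bool.
Qed.

Section Canonical.
Variable r : nat.
Local Notation n := (2 * r).
Variables c0 c1 c2 : 'I_n.
Local Notation cuts := (cuts c0 c1 c2).
Local Notation part := (part c0 c1 c2).
Local Notation part_size := (part_size c0 c1 c2).
Local Notation next_cut := (next_cut c0 c1 c2).

Definition hub_cut (c : 'I_n) := (c1 < c2) && (c \in cuts).
Local Notation spoke := {c : 'I_n | hub_cut c}.
Definition cut_of (s : spoke) : 'I_n := val s.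
(** The boolean is the colour: [inl (_, i)] are the two halves of the boundary edge at [i], and
    [inr (_, s)] those of a spoke, an edge from the interior black vertex, the hub, to a white
    vertex. *)
Definition can_dart : finType := ((bool * 'I_n) + (bool * spoke))%type.

Definition prev_cut (c : 'I_n) := if c == c0 then c2 else if c == c1 then c0 else c1.

(** Clockwise around a white vertex come the boundary edges of its part in the order of the labels,
    then its spoke if there is one, then again the first point of the part, [ordS (prev_cut i)].
    Around the hub the spokes follow the cyclic order of the cuts; the default of [insubd] never
    occurs, by [cut_of_next]. *)
Definition can_rot (x : can_dart) : can_dart :=
  match x with
  | inl (false, i) => inl (false, i)
  | inl (true, i) => if i \in cuts then
      if insub i is Some s then inr (true, s) else inl (true, ordS (prev_cut i))
    else inl (true, ordS i)
  | inr (true, s) => inl (true, ordS (prev_cut (cut_of s)))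
  | inr (false, s) => inr (false, insubd s (next_cut (cut_of s)))
  end.

Definition can_opp (x : can_dart) : can_dart :=
  match x with inl (b, i) => inl (~~ b, i) | inr (b, s) => inr (~~ b, s) end.

Definition can_white (x : can_dart) : bool :=
  match x with inl (b, _) => b | inr (b, _) => b end.

Definition can_mult (x : can_dart) : nat :=
  match x with inl _ => 1 | inr (_, s) => r - part_size (cut_of s) end.

Hypotheses (c01 : c0 < c1) (c12 : c1 <= c2).

Lemma prev_cut_in c : prev_cut c \in cuts.
Proof.
have [i0 i1 i2] := cut_ins c0 c1 c2.
by rewrite /prev_cut; case: (c == c0) => //; case: (c == c1).
Qed.

Lemma next_cutK c : c \in cuts -> prev_cut (next_cut c) = c.
Proof.
have n10 : c1 != c0 by rewrite -val_eqE /=; lia.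
have n20 : c2 != c0 by rewrite -val_eqE /=; lia.
rewrite in_cuts => /or3P[] /eqP->.
- by rewrite next_cut0 /prev_cut (negbTE n10) eqxx.
- rewrite next_cut1 //; case: ltnP => h; rewrite /prev_cut; last by rewrite eqxx; apply: ord_inj; lia.
  by rewrite (negbTE n20) (_ : (c2 == c1) = false) // -val_eqE /=; lia.
- by rewrite next_cut2 // /prev_cut eqxx.
Qed.

Lemma prev_cutK c : c \in cuts -> next_cut (prev_cut c) = c.
Proof.
have n10 : c1 != c0 by rewrite -val_eqE /=; lia.
have n20 : c2 != c0 by rewrite -val_eqE /=; lia.
rewrite in_cuts => /or3P[] /eqP->.
- by rewrite /prev_cut eqxx next_cut2.
- by rewrite /prev_cut (negbTE n10) eqxx next_cut0.
- rewrite /prev_cut (negbTE n20); case: eqP => [->|ne]; first by rewrite next_cut0.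
  rewrite next_cut1 // (_ : c1 < c2 = true) //.
  by rewrite ltn_neqAle c12 andbT eq_sym; apply/eqP => /ord_inj.
Qed.

Lemma can_rot_inj : injective can_rot.
Proof.
pose g (x : can_dart) : can_dart := match x with
  | inl (false, i) => inl (false, i)
  | inl (true, i) => if ord_pred i \in cuts then
      if insub (next_cut (ord_pred i)) is Some s then inr (true, s)
      else inl (true, next_cut (ord_pred i))
    else inl (true, ord_pred i)
  | inr (true, s) => inl (true, cut_of s)
  | inr (false, s) => inr (false, insubd s (prev_cut (cut_of s)))
  end.
have next_hub s : hub_cut (next_cut (cut_of s)).
  by rewrite /hub_cut next_cut_in andbT; have /andP[] := valP s.
have prev_hub s : hub_cut (prev_cut (cut_of s)).
  by rewrite /hub_cut prev_cut_in andbT; have /andP[] := valP s.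
have s_in (s : spoke) : cut_of s \in cuts by have /andP[] := valP s.
apply: (can_inj (g := g)) => -[[[] i]|[[] s]] //=.
- have [ic|nic] := boolP (i \in cuts); last by rewrite /= ordSK (negbTE nic).
  case: insubP => [s _ <- //|h] /=.
  by rewrite ordSK prev_cut_in prev_cutK // insubN.
- by rewrite ordSK prev_cut_in prev_cutK // /cut_of valK.
- congr inr; congr pair; apply: val_inj.
  by rewrite /cut_of val_insubd val_insubd -/(cut_of s) next_hub next_cutK // (valP s).
Qed.

Definition canonical_web : hgraph n :=
  @HGraph n can_dart (perm can_rot_inj) can_opp can_white can_mult (fun i => inl (false, i)).

Local Notation G := canonical_web.
Implicit Types (x y : G) (i j : 'I_n) (s : spoke).

Lemma rotE x : rot G x = can_rot x.
Proof. exact: permE. Qed.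

Lemma spoke_in s : cut_of s \in cuts.
Proof. by have /andP[] := valP s. Qed.

Lemma spoke_hub s : c1 < c2.
Proof. by have /andP[] := valP s. Qed.

Lemma cut_of_next s : cut_of (insubd s (next_cut (cut_of s))) = next_cut (cut_of s).
Proof. by rewrite /cut_of val_insubd -/(cut_of s) /hub_cut (spoke_hub s) next_cut_in. Qed.

(* Labels of the vertices: a boundary vertex, a white vertex named by the last
   point of its part, or the interior black vertex. *)
Definition can_label (x : can_dart) : 'I_n + option 'I_n :=
  match x with
  | inl (false, i) => inl i
  | inl (true, i) => inr (Some (part i))
  | inr (true, s) => inr (Some (cut_of s))
  | inr (false, _) => inr None
  end.

Lemma part_start c : c \in cuts -> part (ordS (prev_cut c)) = c.
Proof. by move=> hc; rewrite part_ordS // prev_cut_in prev_cutK. Qed.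

Lemma label_rot x : can_label (rot G x) = can_label x.
Proof.
rewrite rotE; case: x => [[[] i]|[[] s]] //=; last by rewrite part_start ?spoke_in.
have [ic|nic] := boolP (i \in cuts); last by rewrite /= part_ordS // (negbTE nic).
case: insubP => [s _ e|_] /=; last by rewrite part_start // part_cut.
by rewrite (part_cut c01 c12 ic) -e.
Qed.

(** The number of clockwise steps to the end of the part, the measure for walking around a white
    vertex. *)
Definition cut_dist i := if i <= part i then part i - i else part i + n - i.

Lemma cut_dist_ordS i : i \notin cuts -> cut_dist i = (cut_dist (ordS i)).+1.
Proof.
move=> nic; rewrite /cut_dist part_ordS // (negbTE nic).
have e := ordS_cases i.
have ne : part i != i :> nat by apply: contra nic => /eqP/ord_inj <-; exact: part_in_cuts.
have := ltn_ord (part i).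
by case: (leqP i (part i)) => h1; case: (leqP (ordS i) (part i)) => h2; lia.
Qed.

Lemma vtx_part i : vtx (inl (true, i) : G) = vtx (inl (true, part i) : G).
Proof.
have [m] := ubnP (cut_dist i); elim: m i => // m IH i hm.
have [ic|nic] := boolP (i \in cuts); first by rewrite part_cut.
rewrite -(vtx_rot (inl (true, i) : G)) rotE /= (negbTE nic) IH.
  by rewrite part_ordS // (negbTE nic).
by have := cut_dist_ordS nic; lia.
Qed.

Lemma vtx_spoke s : vtx (inr (true, s) : G) = vtx (inl (true, cut_of s) : G).
Proof.
rewrite -(vtx_rot (inr (true, s) : G)) rotE /= vtx_part part_start //.
exact: spoke_in.
Qed.

Lemma vtx_hub s s' : vtx (inr (false, s) : G) = vtx (inr (false, s') : G).
Proof.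
have H (t t' : spoke) : next_cut (cut_of t) = cut_of t' -> vtx (inr (false, t) : G) = vtx (inr (false, t') : G).
  move=> e; rewrite -(vtx_rot (inr (false, t) : G)) rotE /=.
  by congr (vtx (inr (false, _) : G)); apply: val_inj; exact: etrans (cut_of_next t) e.
have h := spoke_hub s.
have n1 : next_cut c1 = c2 by rewrite next_cut1 // h.
have [->|ne] := eqVneq s s'; first by [].
have := spoke_in s; have := spoke_in s'; rewrite !in_cuts.
have nev : cut_of s != cut_of s' by [].
move=> /or3P[] /eqP e' /or3P[] /eqP e; rewrite e e' ?eqxx // in nev;
  by [apply: H; rewrite e e' ?next_cut0 ?n1 ?next_cut2|
      apply/esym; apply: H; rewrite e e' ?next_cut0 ?n1 ?next_cut2].
Qed.

Lemma vtxE x y : (vtx x == vtx y) = (can_label x == can_label y).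
Proof.
apply/eqP/eqP => [e|].
  have : x \in vtx y by rewrite -e mem_vtx.
  rewrite vtx_fconnect => /iter_findex <-; elim: findex => //= m IH.
  by rewrite label_rot.
case: x => [[[] i]|[[] s]]; case: y => [[[] j]|[[] s']] //=; try (move=> [e]).
- by rewrite vtx_part e -vtx_part.
- by rewrite vtx_part e vtx_spoke.
- by rewrite e.
- by rewrite vtx_spoke e -vtx_part.
- by rewrite vtx_spoke e vtx_spoke.
- by move=> _; exact: vtx_hub.
Qed.

Lemma mem_vtxE x y : (y \in vtx x) = (can_label y == can_label x).
Proof. by rewrite vtx_eq vtxE. Qed.

Lemma is_bdryE x : is_bdry x = if x is inl (false, _) then true else false.
Proof.
apply/is_bdryP/idP => [[i -> //]|].
by case: x => [[[] i]|[]] // _; exists i.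
Qed.

Lemma card_cuts : #|cuts| = if c1 < c2 then 3 else 2.
Proof.
have n0 : c0 \notin [set c1; c2] by rewrite !inE -!val_eqE /=; lia.
rewrite /cuts -setUA cardsU1 n0 cards2 -val_eqE /=.
have -> : (c1 != c2 :> nat) = (c1 < c2) by lia.
by case: (c1 < c2).
Qed.

Hypothesis hv : valid_cuts c0 c1 c2.

Lemma r_gt0 : 0 < r.
Proof. by have := ltn_ord c0; lia. Qed.

Lemma part_size_hub c : c1 < c2 -> c \in cuts -> part_size c < r.
Proof.
move: hv; rewrite /valid_cuts => hv' h; rewrite h in hv'.
rewrite in_cuts => /or3P[] /eqP->; rewrite ?part_size0 ?part_size1 ?part_size2 //; lia.
Qed.

Lemma part_size_claw c : ~~ (c1 < c2) -> c \in cuts -> part_size c = r.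
Proof.
move: hv; rewrite /valid_cuts => hv' h; rewrite (negbTE h) in hv'.
have e : c2 = c1 by apply: ord_inj; lia.
have [h1 e'] := (ltn_ord c1, congr1 (@nat_of_ord n) e).
have p0 : part_size c0 = r by rewrite part_size0; lia.
have p1 : part_size c1 = r by rewrite part_size1 //; lia.
by rewrite in_cuts e orbb => /orP[] /eqP->; rewrite -?e // in p0 p1 *; rewrite ?e.
Qed.

Lemma sum_vtx_white (m : can_dart -> nat) c : c \in cuts ->
  \sum_(y in vtx (inl (true, c) : G)) m y =
  \sum_(i | part i == c) m (inl (true, i)) + \sum_(s | cut_of s == c) m (inr (true, s)).
Proof.
move=> hc; rewrite (eq_bigl (fun y => can_label y == inr (Some c))); last first.
  by move=> y; rewrite mem_vtxE /= part_cut.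
rewrite big_mkcond big_sumType /= !sum_bool_pair /=.
rewrite [X in _ + X + _]big1 // [X in _ + (_ + X)]big1 // !addn0.
by congr (_ + _); rewrite [RHS]big_mkcond; apply: eq_bigr.
Qed.

Lemma sum_vtx_hub (m : can_dart -> nat) s :
  \sum_(y in vtx (inr (false, s) : G)) m y = \sum_(t : spoke) m (inr (false, t)).
Proof.
rewrite (eq_bigl (fun y => can_label y == inr None)); last by move=> y; rewrite mem_vtxE.
rewrite big_mkcond big_sumType /= !sum_bool_pair /=.
by rewrite [X in X + _ + _]big1 // [X in 0 + X + _]big1 // [X in _ + (X + _)]big1.
Qed.

Lemma sum_spokes (m : spoke -> nat) c : c1 < c2 -> c \in cuts ->
  exists2 s, cut_of s = c & \sum_(t | cut_of t == c) m t = m s.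
Proof.
move=> h hc; have hubc : hub_cut c by rewrite /hub_cut h.
exists (Sub c hubc); first exact: SubK.
apply: big_pred1 => t; apply/eqP/eqP => [e|->]; last exact: SubK.
by apply: val_inj; rewrite SubK -e.
Qed.

Lemma sum_no_spokes (m : spoke -> nat) c : ~~ (c1 < c2) -> \sum_(t | cut_of t == c) m t = 0.
Proof. by move=> h; rewrite big1 // => s _; have := spoke_hub s; rewrite (negbTE h). Qed.

Lemma sum_vtx_claw (m : can_dart -> nat) c : c \in cuts -> (forall i, m (inl (true, i)) = 1) ->
  \sum_(y in vtx (inl (true, c) : G)) m y =
  part_size c + \sum_(s | cut_of s == c) m (inr (true, s)).
Proof.
move=> hc m1; rewrite sum_vtx_white //; congr (_ + _).
rewrite (eq_bigr (fun=> 1)) // sum1_card -(card_part c01 c12) //.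
by apply: eq_card => i; rewrite !inE.
Qed.

Lemma can_degree x : ~~ is_bdry x -> degree x = r.
Proof.
rewrite is_bdryE => ix.
have white c : c \in cuts -> degree (inl (true, c) : G) = r.
  move=> hc; rewrite /degree sum_vtx_claw //=.
  have [h|h] := boolP (c1 < c2); last by rewrite sum_no_spokes // part_size_claw // addn0.
  have [s es ->] := sum_spokes (fun s => r - part_size (cut_of s)) h hc.
  by rewrite es; have := part_size_hub h hc; lia.
case: x ix => [[[] i]|[[] s]] //= _.
- by have := white _ (part_in_cuts c0 c1 c2 i); rewrite /degree -vtx_part.
- by have := white _ (spoke_in s); rewrite /degree -vtx_spoke.
(* The three weights [r - part_size c] add up to [3 * r - 2 * r]. *)
rewrite /degree sum_vtx_hub /=; have h := spoke_hub s.
rewrite -(@big_sub _ _ _ _ hub_cut (fun c => r - part_size c)).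
rewrite (eq_bigl (fun c => c \in [set c0; c1; c2])); last by move=> c; rewrite unfold_in /= h.
have n01 : c0 \notin [set c1; c2] by rewrite !inE -!val_eqE /=; lia.
have n12 : c1 \notin [set c2] by rewrite !inE -!val_eqE /=; lia.
rewrite -setUA big_setU1 // big_setU1 // big_set1.
have [i0 i1 i2] := cut_ins c0 c1 c2.
have := part_size_hub h i0; have := part_size_hub h i1; have := part_size_hub h i2.
have := sum_part_size c01 c12 h; rewrite /=; lia.
Qed.

Lemma spoke_exists : c1 < c2 -> exists s : spoke, cut_of s = c0.
Proof.
move=> h; have [i0 _ _] := cut_ins c0 c1 c2.
have hubc : hub_cut c0 by rewrite /hub_cut h.
by exists (Sub c0 hubc); exact: SubK.
Qed.

Lemma card_spoke : c1 < c2 -> #|{: spoke}| = 3.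
Proof.
move=> h; rewrite card_sig -(_ : #|cuts| = 3); last by rewrite card_cuts h.
by apply: eq_card => c; rewrite -[LHS]/(hub_cut c) /hub_cut h.
Qed.

Lemma can_opp_involutive : involutive (@opp n G).
Proof. by case=> [[[] i]|[[] s]]. Qed.

Lemma can_opp_neq x : opp x != x.
Proof. by case: x => [[[] i]|[[] s]]. Qed.

Lemma can_bdry_inj : injective (@bdry n G).
Proof. by move=> i j [->]. Qed.

Lemma can_bdry_simple i : rot G (bdry G i) = bdry G i.
Proof. by rewrite rotE. Qed.

Lemma can_no_isolated : no_isolated_component G.
Proof.
have w i : connect [rel y z | (z == rot G y) || (z == opp y)] (inl (true, i) : G) (bdry G i).
  by apply: connect1; rewrite /= eqxx orbT.
have b s : exists i, connect [rel y z | (z == rot G y) || (z == opp y)] (inr (true, s) : G) (bdry G i).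
  exists (ordS (prev_cut (cut_of s))); apply: connect_trans (w _).
  by apply: connect1; rewrite /= rotE eqxx.
case=> [[[] i]|[[] s]]; [by exists i|by exists i|exact: b|].
have [i hi] := b s; exists i; apply: connect_trans hi.
by apply: connect1; rewrite /= eqxx orbT.
Qed.

Lemma card_interior_vertices :
  #|interior_vertices G| = if c1 < c2 then 4 else 2.
Proof.
have vinj : {in cuts &, injective (fun c => vtx (inl (true, c) : G))}.
  by move=> c d hc hd /= /eqP; rewrite vtxE /= !part_cut // => /eqP[].
have eW : #|[set vtx (inl (true, c) : G) | c in cuts]| = if c1 < c2 then 3 else 2.
  by rewrite card_in_imset ?card_cuts.
have [h|h] := boolP (c1 < c2); rewrite ?h ?(negbTE h) in eW *.
  have [s0 _] := spoke_exists h.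
  have -> : interior_vertices G = vtx (inr (false, s0) : G) |: [set vtx (inl (true, c) : G) | c in cuts].
    apply/setP => v; apply/imsetP/setU1P => [[x]|].
      rewrite inE is_bdryE; case: x => [[[] i]|[[] s]] // _ ->.
      - right; rewrite vtx_part; apply: imset_f; exact: part_in_cuts.
      - right; rewrite vtx_spoke; apply: imset_f; exact: spoke_in.
      - by left; apply/eqP; rewrite vtxE.
    case=> [->|/imsetP[c hc ->]]; first by exists (inr (false, s0)); rewrite // inE is_bdryE.
    by exists (inl (true, c)); rewrite // inE is_bdryE.
  rewrite cardsU1 eW; case: imsetP => // -[c hc /eqP]; by rewrite vtxE.
apply: etrans eW; apply: eq_card => v; apply/imsetP/imsetP => [[x]|].
  rewrite inE is_bdryE; case: x => [[[] i]|[[] s]] // _ ->.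
  - by exists (part i); rewrite ?part_in_cuts // vtx_part.
  - by have := spoke_hub s; rewrite (negbTE h).
  - by have := spoke_hub s; rewrite (negbTE h).
by case=> c hc ->; exists (inl (true, c)); rewrite // inE is_bdryE.
Qed.

Lemma can_closed_rot_int x : ~~ is_bdry x -> closed_rot x = can_rot x.
Proof. by move=> h; rewrite closed_rot_int // rotE. Qed.

Lemma can_face_bdry i : face_step (bdry G i) = can_rot (inl (true, i)).
Proof. by rewrite /face_step /= can_closed_rot_int // is_bdryE. Qed.

Lemma can_face_white i : face_step (inl (true, i) : G) = bdry G (ord_pred i).
Proof. exact: (closed_rot_bdry can_bdry_inj i). Qed.

Lemma can_face_spoke s : face_step (inr (true, s) : G) = can_rot (inr (false, s)).
Proof. by rewrite /face_step /= can_closed_rot_int // is_bdryE. Qed.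

Lemma can_face_hub s : face_step (inr (false, s) : G) = can_rot (inr (true, s)).
Proof. by rewrite /face_step /= can_closed_rot_int // is_bdryE. Qed.

(* The boundary point preceding each face, the two faces between the claws
   being identified when there is no interior black vertex. *)
Definition face_label (x : G) : 'I_n :=
  let i := match x : can_dart with
    | inl (false, i) => i | inl (true, i) => ord_pred i
    | inr (true, s) => cut_of s | inr (false, s) => prev_cut (cut_of s) end in
  if ~~ (c1 < c2) && (i == c1) then c0 else i.

Lemma face_label_step x : face_label (face_step x) = face_label x.
Proof.
case: x => [[[] i]|[[] s]].
- by rewrite can_face_white.
- rewrite can_face_bdry /=.
  have [ic|nic] := boolP (i \in cuts); last by rewrite /face_label ordSK.
  case: insubP => [s _ <- //|]; rewrite /hub_cut ic andbT => h.
  rewrite /face_label ordSK h /=.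
  have e : c2 = c1 by apply: ord_inj; lia.
  have n10 : (c1 == c0) = false by rewrite -val_eqE /=; lia.
  move: ic; rewrite in_cuts e orbb => /orP[] /eqP->.
    by rewrite /prev_cut eqxx e eqxx eq_sym n10.
  by rewrite /prev_cut n10 eqxx eq_sym n10.
- by rewrite can_face_spoke /face_label /= cut_of_next next_cutK ?spoke_in.
- by rewrite can_face_hub /face_label /= ordSK.
Qed.

Lemma can_card_faces : fcard (@face_step n G) G = if c1 < c2 then n else n.-1.
Proof.
have oppK := can_opp_involutive; have bI := can_bdry_inj.
have symf := fconnect_sym (face_step_inj oppK bI can_bdry_simple).
have white i : exists j, fconnect (@face_step n G) (inl (true, i) : G) (bdry G j).
  by exists (ord_pred i); rewrite -can_face_white fconnect1.
have hub s : exists j, fconnect (@face_step n G) (inr (false, s) : G) (bdry G j).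
  have [j hj] := white (ordS (prev_cut (cut_of s))); exists j.
  by apply: connect_trans hj; have := fconnect1 (@face_step n G) (inr (false, s) : G); rewrite can_face_hub.
rewrite (card_faces oppK bI can_bdry_simple); last first.
  case=> [[[] i]|[[] s]]; [exact: white|by exists i|..]; last exact: hub.
  have [j hj] := hub (insubd s (next_cut (cut_of s))); exists j.
  by apply: connect_trans hj; have := fconnect1 (@face_step n G) (inr (true, s) : G); rewrite can_face_spoke.
have inv x y : fconnect (@face_step n G) x y -> face_label x = face_label y.
  by move=> /iter_findex <-; elim: findex => //= m ->; rewrite face_label_step.
have rinj i j : froot (@face_step n G) (bdry G i) = froot (@face_step n G) (bdry G j) ->
    face_label (bdry G i) = face_label (bdry G j).
  by move=> /(rootP symf)/inv.
have [h|h] := boolP (c1 < c2).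
  rewrite card_imset ?card_ord // => i j /rinj; rewrite /face_label /= h /=; exact.
(* Without spokes one face passes between the two claws and meets the boundary after [c0] and after
   [c1]: two face steps lead from [bdry G c1] to [bdry G c0]. *)
have -> : [set froot (@face_step n G) (bdry G i) | i : 'I_n] =
    [set froot (@face_step n G) (bdry G i) | i in [set~ c1]].
  apply/setP => v; apply/imsetP/imsetP => [[i _ ->]|[i _ ->]]; last by exists i.
  have [->|ne] := eqVneq i c1; last by exists i; rewrite // !inE.
  exists c0; first by rewrite !inE -val_eqE /=; lia.
  have e : c2 = c1 by apply: ord_inj; lia.
  have n10 : (c1 == c0) = false by rewrite -val_eqE /=; lia.
  apply/(rootP symf); apply: (connect_trans (y := face_step (bdry G c1))); first exact: fconnect1.
  apply: (connect_trans (y := face_step (face_step (bdry G c1)))); first exact: fconnect1.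
  rewrite can_face_bdry /=; have [_ -> _] := cut_ins c0 c1 c2.
  by rewrite insubN ?/hub_cut ?(negbTE h) // can_face_white ordSK /prev_cut n10 eqxx.
rewrite card_in_imset; last first.
  move=> i j; rewrite !inE => /negbTE ni /negbTE nj /rinj.
  by rewrite /face_label /= ni nj !andbF.
by rewrite cardsC1 card_ord.
Qed.

Lemma can_plabic : is_hourglass_plabic G r.
Proof.
have r0 := r_gt0.
split.
- exact: can_opp_involutive.
- exact: can_opp_neq.
- exact: can_bdry_inj.
- exact: can_bdry_simple.
- by [].
- by [].
- move=> x; rewrite rotE; case: x => [[[] i]|[[] s]] //=.
  by case: ifP => // _; case: insub.
- by case=> [[[] i]|[[] s]].
- case=> [[b i]|[b s]] //=.
  by have := part_size_hub (spoke_hub s) (spoke_in s); lia.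
- by case=> [[b i]|[b s]].
- exact: can_degree.
- apply/(planarE can_opp_involutive can_opp_neq can_bdry_inj can_bdry_simple can_no_isolated).
    by lia.
  rewrite card_interior_vertices can_card_faces card_sum !card_prod card_bool card_ord.
  have [h|h] := boolP (c1 < c2); first by rewrite card_spoke //; lia.
  rewrite (eq_card0 (A := {: spoke})); first by lia.
  by move=> s; have := spoke_hub s; rewrite (negbTE h).
Qed.

Lemma can_contracted : contracted G.
Proof.
move=> x; rewrite is_bdryE => ix h2.
have white c : can_label x = inr (Some c) -> c \in cuts ->
    exists2 y, y \in vtx x & is_bdry (opp y : G).
  move=> e hc; exists (inl (true, c)); last by rewrite is_bdryE.
  by rewrite mem_vtxE e /= part_cut.
case: x ix h2 white => [[[] i]|[[] s]] //= _ h2 white.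
- exact: white erefl (part_in_cuts _ _ _ _).
- exact: white erefl (spoke_in s).
have : 3 <= #|vtx (inr (false, s) : G)|.
  rewrite -(card_spoke (spoke_hub s)) -(card_imset _ (_ : injective (fun t : spoke => (inr (false, t) : G)))).
    apply: subset_leq_card; apply/subsetP => _ /imsetP[t _ ->].
    by rewrite mem_vtxE.
  by move=> t u [].
by rewrite h2.
Qed.

(** A cycle contains no boundary edge, as these end in leaves. After a dart from the hub to a white
    vertex it could then only go back, and a dart towards the hub must be followed by such a
    dart. *)
Lemma can_forest : forest G.
Proof.
move=> c; apply/negP => /and3P[c0' cyc uc].
have next x : x \in c -> exists2 y, y \in c & (can_label (opp x) = can_label y) /\ y != opp x.
  move=> xc; exists (next c x); first by rewrite mem_next.
  by have := next_cycle cyc xc; rewrite /= vtxE => /andP[/eqP].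
have prev x : x \in c -> exists2 y, y \in c & (can_label (opp y) = can_label x) /\ x != opp y.
  move=> xc; exists (prev c x); first by rewrite mem_prev.
  by have := prev_cycle cyc xc; rewrite /= vtxE => /andP[/eqP].
have nb b i : (inl (b, i) : G) \notin c.
  apply/negP; case: b => xc.
    by have [y _ []] := next _ xc; case: y => [[[] j]|[[] s]] //= [->]; rewrite eqxx.
  have [y _ []] := prev _ xc; case: y => [[[] j]|[[] s]] //= [->]; by rewrite eqxx.
have nw s : (inr (false, s) : G) \notin c.
  apply/negP => xc; have [y yc []] := next _ xc.
  case: y yc => [[[] j]|[[] t]] //=; first by rewrite (negbTE (nb _ _)).
  by move=> _ [] /val_inj ->; rewrite eqxx.
case: c c0' next {cyc uc prev} nb nw => // x c _ next nb nw.
case: x next nb nw => [[b i]|[[] s]] next nb nw.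
- by have := nb b i; rewrite inE eqxx.
- have [y yc []] := next _ (mem_head _ _).
  case: y yc => [[[] j]|[[] t]] //=; last by rewrite (negbTE (nw _)).
- by have := nw s; rewrite inE eqxx.
Qed.
End Canonical.

(** * Trips in the canonical webs *)

Lemma modn_add_lt a x y : x < a -> y < a ->
  (x + y) %% a = if x + y < a then x + y else x + y - a.
Proof.
move=> hx hy; case: ltnP => h; first by rewrite modn_small.
by rewrite -{1}(subnK h) modnDr modn_small; lia.
Qed.

(* Positions along a trip that enters the interior black vertex through a spoke
   with offset o1 and weight w1 and leaves it through the spoke (o2, w2). *)
Section TripArithmetic.
Variables r a o1 w1 sz idx k1 o2 w2 k2 : nat.
Hypotheses (ha : 0 < a < r) (hsz : w1 + sz = r) (hidx : idx < sz) (hk1 : k1 < w1).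
Hypotheses (pos1 : k1 = (w1 + idx + a) %% r) (h1 : o1 + w1 <= r) (h2 : o2 + w2 <= r).
Hypotheses (hk2 : k2 < w2) (pos2 : o2 + k2 = (o1 + k1 + (r - a)) %% r).

Let pos1' : r <= w1 + idx + a /\ k1 + r = w1 + idx + a.
Proof. by move: pos1; rewrite modn_add_lt; [case: ltnP => h| |]; lia. Qed.

Let pos2' : o2 + k2 = o1 + w1 + idx \/ o2 + k2 + r = o1 + w1 + idx.
Proof.
case: pos1' => hw e; move: pos2; rewrite modn_add_lt; [case: ltnP => h| |]; lia.
Qed.

(** The turns by [a] at the white vertex and by [r - a] at the hub cancel: the new position at the
    hub is [o1 + w1 + idx] modulo [r]. As [idx < r - w1], it is outside the spoke of arrival. *)
Lemma trip_leaves_spoke : ~~ ((o1 == o2) && (w1 == w2)).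
Proof. by case: pos1' => hw e; case: pos2' => e2; lia. Qed.

(** [k2 + a] is [o1 + k1 - o2] modulo [r], the position of the strand of arrival counted from the
    second spoke; since the spokes are disjoint, it is beyond that spoke. *)
Lemma trip_exits : o1 + w1 <= o2 \/ o2 + w2 <= o1 -> w2 <= k2 + a < r.
Proof. by case: pos1' => hw e; case: pos2' => e2; lia. Qed.
End TripArithmetic.

Section Trips.
Variable r : nat.
Local Notation n := (2 * r).
Variables c0 c1 c2 : 'I_n.
Hypotheses (c01 : c0 < c1) (c12 : c1 <= c2) (hv : valid_cuts c0 c1 c2).
Local Notation cuts := (cuts c0 c1 c2).
Local Notation part := (part c0 c1 c2).
Local Notation part_size := (part_size c0 c1 c2).
Local Notation next_cut := (next_cut c0 c1 c2).
Local Notation prev_cut := (prev_cut c0 c1 c2).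
Local Notation spoke := {c : 'I_n | hub_cut c0 c1 c2 c}.
Local Notation G := (canonical_web c01 c12).
Local Notation label := (@can_label r c0 c1 c2).
Implicit Types (x y : G) (i j c : 'I_n) (s : spoke).

Definition weight c := r - part_size c.

Lemma part_size_leq c : c \in cuts -> 0 < part_size c <= r.
Proof.
move=> hc; apply/andP; split.
  by rewrite -(card_part c01 c12) //; apply/card_gt0P; exists c; rewrite inE part_cut.
have [h|h] := boolP (c1 < c2); first by have := part_size_hub c01 c12 hv h hc; lia.
by rewrite (part_size_claw c01 c12 hv h hc).
Qed.

(** The number of strands at the hub before the spoke of [c], counted clockwise from the spoke of
    [c0]. *)
Definition offset c :=
  if c == c0 then 0 else if c == c1 then weight c0 else weight c0 + weight c1.

Lemma offsetE : [/\ offset c0 = 0, offset c1 = weight c0 &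
  c1 < c2 -> offset c2 = weight c0 + weight c1 /\ weight c0 + weight c1 + weight c2 = r].
Proof.
have n10 : (c1 == c0) = false by rewrite -val_eqE /=; lia.
have n20 : (c2 == c0) = false by rewrite -val_eqE /=; lia.
rewrite /offset !eqxx n10 n20; split=> // h.
have -> : (c2 == c1) = false by rewrite -val_eqE /=; lia.
have := sum_part_size c01 c12 h; split=> //; rewrite /weight.
have [i0 i1 i2] := cut_ins c0 c1 c2.
have := part_size_leq i0; have := part_size_leq i1; have := part_size_leq i2; lia.
Qed.

Lemma offset_le c : c1 < c2 -> c \in cuts -> offset c + weight c <= r.
Proof.
move=> h; have [o0 o1 o2] := offsetE; have [e2 e3] := o2 h.
by rewrite in_cuts => /or3P[] /eqP->; lia.
Qed.

Lemma offset_disjoint c d : c1 < c2 -> c \in cuts -> d \in cuts -> c != d ->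
  offset c + weight c <= offset d \/ offset d + weight d <= offset c.
Proof.
move=> h; have [o0 o1 o2] := offsetE; have [e2 e3] := o2 h.
by rewrite !in_cuts => /or3P[] /eqP-> /or3P[] /eqP->; rewrite ?eqxx // => _; lia.
Qed.

Lemma offset_next c : c1 < c2 -> c \in cuts ->
  offset (next_cut c) = if offset c + weight c < r then offset c + weight c else 0.
Proof.
move=> h; have [o0 o1 o2] := offsetE; have [e2 e3] := o2 h.
have [i0 i1 i2] := cut_ins c0 c1 c2.
have := part_size_hub c01 c12 hv h i2; have := part_size_hub c01 c12 hv h i1.
have n1 : next_cut c1 = c2 by rewrite next_cut1 // h.
rewrite in_cuts => h1 h2 /or3P[] /eqP->; rewrite ?next_cut0 ?n1 ?next_cut2 //;
  rewrite /weight in o0 o1 e2 e3 *; case: ltnP; lia.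
Qed.

Definition index_in_part i :=
  let p := prev_cut (part i) in if i <= p then i + n - p.+1 else i - p.+1.

Lemma index_lt i : index_in_part i < part_size (part i).
Proof.
have hi := ltn_ord i; have h2 := ltn_ord c2.
have n10 : (c1 == c0) = false by rewrite -val_eqE /=; lia.
have n20 : (c2 == c0) = false by rewrite -val_eqE /=; lia.
rewrite /index_in_part; case: (partP c0 c1 c2 i) => -[h ->]; rewrite /prev_cut ?eqxx ?n10 ?n20.
- by rewrite part_size0; case: (leqP i c2); lia.
- by rewrite part_size1 //; case: (leqP i c0); lia.
- have -> : (c2 == c1) = false by rewrite -val_eqE /=; lia.
  have h12 : c1 < c2 by lia.
  by rewrite part_size2 //; case: (leqP i c1); lia.
- by rewrite part_size0; case: (leqP i c2); lia.
Qed.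

Lemma index_cut c : c \in cuts -> (index_in_part c).+1 = part_size c.
Proof.
have h2 := ltn_ord c2.
have n10 : (c1 == c0) = false by rewrite -val_eqE /=; lia.
have n20 : (c2 == c0) = false by rewrite -val_eqE /=; lia.
move=> hc; rewrite /index_in_part part_cut //; move: hc; rewrite in_cuts /prev_cut.
case: eqP => [->|n0]; first by rewrite part_size0; case: (leqP c0 c2); lia.
case: eqP => [->|n1] //=; first by rewrite part_size1 //; case: (leqP c1 c0); lia.
move/eqP=> e; subst c; have h : c1 < c2.
  by rewrite ltn_neqAle c12 andbT; apply/eqP => /ord_inj e; apply: n1; rewrite e.
by rewrite part_size2 //; case: (leqP c2 c1); lia.
Qed.

Lemma index_ordS i : i \notin cuts -> index_in_part (ordS i) = (index_in_part i).+1.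
Proof.
move=> nic; rewrite /index_in_part part_ordS // (negbTE nic).
have e := ordS_cases i.
have h2 := ltn_ord (prev_cut (part i)).
have : prev_cut (part i) != i by apply: contra nic => /eqP <-; exact: prev_cut_in.
rewrite -(inj_eq (@ord_inj n)) => ne.
by case: (leqP i _) => h1; case: (leqP (ordS i) _) => h3; lia.
Qed.

Lemma index_start c : c \in cuts -> index_in_part (ordS (prev_cut c)) = 0.
Proof.
move=> hc; rewrite /index_in_part part_start //.
set p := prev_cut c.
have e := ordS_cases p.
by case: leqP => h; lia.
Qed.

(** Numbers the [r] strands at an interior vertex clockwise, from the spoke at a white vertex and
    from the spoke of [c0] at the hub, so that [cw_strand] adds one modulo [r]. The value at
    boundary vertices is a dummy. *)
Definition strand_pos (t : strand G) : nat :=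
  match t.1 : can_dart c0 c1 c2 with
  | inl (true, i) => weight (part i) + index_in_part i
  | inl (false, _) => 0
  | inr (true, s) => t.2
  | inr (false, s) => offset (cut_of s) + t.2
  end.

Definition good_strand (t : strand G) := ~~ is_bdry t.1 && (t.2 < mult t.1).

Lemma strand_pos_lt t : good_strand t -> strand_pos t < r.
Proof.
case: t => x k /andP[]; rewrite is_bdryE /=.
case: x => [[[] i]|[[] s]] //= _ hk; rewrite /strand_pos /=.
- by have := index_lt i; have := part_size_leq (part_in_cuts c0 c1 c2 i); rewrite /weight; lia.
- by lia.
- by have := offset_le (spoke_hub s) (spoke_in s); rewrite /weight; lia.
Qed.

Lemma cw_strandP t : good_strand t -> [/\ good_strand (cw_strand t),
  label (cw_strand t).1 = label t.1 & strand_pos (cw_strand t) = (strand_pos t).+1 %% r].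
Proof.
move=> gt; have ht := strand_pos_lt gt; case: t gt ht => x k /andP[/= ib hk] ht.
have r0 : 0 < r by lia.
have lab : label (cw_strand (x, k)).1 = label x.
  by rewrite /cw_strand /=; case: ifP => //= _; rewrite label_rot.
suff [h e] : (cw_strand (x, k)).2 < mult (cw_strand (x, k)).1 /\
    strand_pos (cw_strand (x, k)) = (strand_pos (x, k)).+1 %% r.
  split=> //; rewrite /good_strand h andbT.
  rewrite /cw_strand /=; case: ifP => //= _.
  by rewrite (is_bdry_rot (can_bdry_simple c01 c12)).
move: ib hk ht; rewrite is_bdryE /cw_strand /=.
case: x {lab} => [[[] i]|[[] s]] //= _ hk; rewrite /strand_pos /= => ht.
- rewrite permE /=; have [ic|nic] := boolP (i \in cuts).
    have := index_cut ic; have := part_size_leq ic; rewrite part_cut // => hsz hidx.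
    have e : (weight i + index_in_part i).+1 = r by rewrite /weight; lia.
    rewrite e modnn; case: insubP => [s /andP[h _] es|] /=.
      by split=> //; have := part_size_hub c01 c12 hv (spoke_hub s) (spoke_in s); lia.
    rewrite /hub_cut ic andbT => h; split=> //.
    rewrite part_start // index_start // /weight (part_size_claw c01 c12 hv h ic); lia.
  rewrite /= part_ordS // (negbTE nic) index_ordS // addnS modn_small //.
  rewrite ltnNge leq_eqVlt ltnNge ht orbF; apply: contra nic => /eqP e.
  have hsz := part_size_leq (part_in_cuts c0 c1 c2 i).
  have hidx : (index_in_part i).+1 = part_size (part i) by move: e; rewrite /weight; lia.
  suff -> : i = part i by exact: part_in_cuts.
  have hidx' := index_cut (part_in_cuts c0 c1 c2 i).
  apply: ord_inj; move: hidx hidx'; rewrite /index_in_part (part_cut c01 c12 (part_in_cuts c0 c1 c2 i)).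
  have := ltn_ord i; have := ltn_ord (part i); have := ltn_ord (prev_cut (part i)).
  by case: (leqP i (prev_cut (part i))); case: (leqP (part i) (prev_cut (part i))); lia.
- have := part_size_hub c01 c12 hv (spoke_hub s) (spoke_in s).
  have := part_size_leq (spoke_in s) => h1 h2.
  case: (ltnP k.+1 _) => hk1 /=; first by rewrite modn_small //; lia.
  rewrite permE /= part_start ?spoke_in // index_start ?spoke_in // /weight.
  by split=> //; rewrite modn_small; lia.
- have h := spoke_hub s; have hs := spoke_in s.
  have := offset_le h hs; have := offset_next h hs; rewrite /weight => h1 h2.
  case: (ltnP k.+1 _) => hk1 /=; first by rewrite modn_small -?addnS //; lia.
  rewrite permE /= cut_of_next //; split.
    by have := part_size_hub c01 c12 hv h (next_cut_in c0 c1 c2 (cut_of s)); lia.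
  rewrite h1 addn0; have ek : k.+1 = r - part_size (cut_of s) by lia.
  rewrite -[(offset _ + k).+1]addnS ek; case: (ltnP (_ + _) r) => h3; first by rewrite modn_small.
  by rewrite (_ : _ + _ = r) ?modnn //; lia.
Qed.

Lemma iter_cw_strand a t : good_strand t -> [/\ good_strand (iter a (@cw_strand n G) t),
  label (iter a (@cw_strand n G) t).1 = label t.1 &
  strand_pos (iter a (@cw_strand n G) t) = (strand_pos t + a) %% r].
Proof.
move=> gt; elim: a => [|a [IH1 IH2 IH3]] /=.
  by split=> //; rewrite addn0 modn_small ?strand_pos_lt.
have [g1 g2 g3] := cw_strandP IH1; split=> //; first by rewrite g2.
by rewrite g3 IH3 addnS -addn1 modnDml addn1.
Qed.

Definition short_trip (p : seq G) :=
  exists i i', part i = part i' /\ p = [:: inl (false, i); inl (true, i')].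
Definition long_trip (p : seq G) := exists i s s' i',
  [/\ part i = cut_of s, part i' = cut_of s', cut_of s != cut_of s' &
      p = [:: inl (false, i); inr (true, s); inr (false, s'); inl (true, i')]].

(** With [strand_pos] a turn is an addition modulo [r]. By the arithmetic above, a trip entering the
    hub leaves it through another spoke, and at the next white vertex it turns into a boundary edge
    at once. *)
Lemma can_trip a i p : 0 < a < r -> is_trip (G := G) r a i p -> short_trip p \/ long_trip p.
Proof.
move=> ha [t [ft nbt lbt ->]].
have bd x : is_bdry (opp x : G) = if x is inl (true, _) then true else false.
  by rewrite is_bdryE; case: x => [[[] j]|[[] s]].
have lsz := part_size_leq (part_in_cuts c0 c1 c2 i).
have g0 : good_strand ((inl (true, i), 0) : strand G) by rewrite /good_strand is_bdryE.
case: t ft nbt lbt => [|s1 t] /=; first by rewrite /at_bdry bd.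
case/andP=> /eqP e1 ft /andP[_ nbt] lbt.
have := iter_cw_strand a g0; rewrite (_ : iter a _ _ = s1); last exact: e1.
case: s1 e1 ft nbt lbt => x1 k1 e1 ft nbt lbt [/andP[/= ib1 hk1] lab1 pos1].
rewrite /strand_pos /= in pos1.
have hidx := index_lt i.
have sw : weight (part i) + part_size (part i) = r by rewrite /weight; lia.
rewrite is_bdryE in ib1.
case: x1 e1 ib1 hk1 lab1 pos1 ft nbt lbt => [[[] i1]|[[] s1]] // e1 _ hk1 [lab1] pos1 ft nbt lbt.
  left; exists i, i1; split=> //; congr [:: _, _ & _].
  case: t ft nbt lbt => //= s2 t _ /andP[]; by rewrite /at_bdry bd.
right; have h := spoke_hub s1; have hs1 := spoke_in s1.
rewrite -lab1 in hidx sw pos1; rewrite /= in hk1.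
have hw1 : k1 < weight (cut_of s1) by exact: hk1.
case: t ft nbt lbt => [|s2 t] /=; first by rewrite /at_bdry bd.
case/andP=> /eqP e2 ft /andP[_ nbt] lbt.
have g1 : good_strand ((inr (false, s1), k1) : strand G) by rewrite /good_strand is_bdryE.
have := iter_cw_strand (r - a) g1; rewrite (_ : iter (r - a) _ _ = s2); last exact: e2.
case: s2 e2 ft nbt lbt => x2 k2 e2 ft nbt lbt [/andP[/= ib2 hk2] lab2 pos2].
rewrite is_bdryE in ib2.
case: x2 e2 ib2 hk2 lab2 pos2 ft nbt lbt => [[[] i2]|[[] s2]] // e2 _ hk2 _ pos2 ft nbt lbt.
rewrite /strand_pos /= in pos2 hk2.
have hs2 := spoke_in s2; have off1 := offset_le h hs1; have off2 := offset_le h hs2.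
have hw2 : k2 < weight (cut_of s2) by exact: hk2.
have ne : cut_of s1 != cut_of s2.
  apply: contra (trip_leaves_spoke ha sw hidx hw1 pos1 off1 off2 hw2 pos2) => /eqP->.
  by rewrite !eqxx.
have dis := offset_disjoint h hs1 hs2 ne.
case: t ft nbt lbt => [|s3 t] /=; first by rewrite /at_bdry bd.
case/andP=> /eqP e3 ft /andP[_ nbt] lbt.
have g2 : good_strand ((inr (true, s2), k2) : strand G) by rewrite /good_strand is_bdryE.
have := iter_cw_strand a g2; rewrite (_ : iter a _ _ = s3); last exact: e3.
case: s3 e3 ft nbt lbt => x3 k3 e3 ft nbt lbt [/andP[/= ib3 hk3] lab3 pos3].
rewrite /strand_pos /= in pos3.
have hk2a := trip_exits ha sw hidx hw1 pos1 off1 off2 hw2 pos2 dis.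
rewrite modn_small in pos3; last by case/andP: hk2a.
rewrite is_bdryE in ib3.
case: x3 e3 ib3 hk3 lab3 pos3 ft nbt lbt => [[[] i3]|[[] s3]] // e3 _ hk3 [lab3] pos3 ft nbt lbt; last first.
  by exfalso; move: hk3 pos3 hk2a; rewrite /= lab3 /weight; clear; lia.
exists i, s1, s2, i3; split=> //.
congr [:: _, _, _, _ & _].
by case: t ft nbt lbt => //= s4 t _ /andP[]; rewrite /at_bdry bd.
Qed.

(* A trip is a path of the tree, so its darts between two vertices are determined
   by these vertices. *)
Definition tree_path (A B : 'I_n + option 'I_n) : seq G :=
  let from_hub := match B with
    | inl i => if insub (part i) is Some s then [:: inr (false, s); inl (true, i)] else [::]
    | inr (Some c) => if insub c is Some s then [:: inr (false, s)] else [::]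
    | inr None => [::] end in
  let from_white c := match B with
    | inl i => if part i == c then [:: inl (true, i)]
       else if insub c is Some s then inr (true, s) :: from_hub else [::]
    | inr B' => if B' == Some c then [::]
       else if insub c is Some s then inr (true, s) :: from_hub else [::] end in
  match A with
  | inl i => inl (false, i) :: from_white (part i)
  | inr (Some c) => from_white c
  | inr None => from_hub
  end.

Lemma insub_cut_of s : insub (cut_of s) = Some s.
Proof. exact: valK. Qed.

Lemma infix_tree_path p x q : short_trip p \/ long_trip p -> infix (x :: q) p ->
  x :: q = tree_path (label x) (label (opp (last x q))).
Proof.
case=> [[i [i' [e ->]]]|[i [s [s' [i' [e e' ne ->]]]]]] /infixP[l1 [l2]].
  by case: l1 => [|a [|b [|c l1]]] //=; case: q => [|y [|z q]] //= [] *; subst => //=;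
    rewrite ?e ?eqxx.
have ne' : (cut_of s' == cut_of s) = false by rewrite eq_sym (negbTE ne).
by case: l1 => [|a [|b [|c [|d [|d' l1]]]]] //=; case: q => [|y [|z [|u [|v q]]]] //= [] *; subst => //=;
  rewrite ?e ?e' ?eqxx ?ne' ?insub_cut_of ?(inj_eq (@Some_inj _)) ?ne'.
Qed.

Lemma can_fully_reduced : fully_reduced G r.
Proof.
split; first exact: can_no_isolated.
- move=> a i p ha /(can_trip ha) [[j [j' [e ->]]]|[j [s [s' [j' [e e' ne ->]]]]]] /=.
    by rewrite !inE vtxE.
  by rewrite !inE !vtxE /= e' andbT; apply: contra ne => /eqP[->].
move=> a b i j p q ha hb _ /(can_trip ha) tp /(can_trip hb) tq x p1 y q1 ip iq ex ey.
rewrite (infix_tree_path tp ip) (infix_tree_path tq iq).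
by congr tree_path; apply/eqP; rewrite -vtxE; apply/eqP.
Qed.

Lemma can_web : forest_web G.
Proof.
split; last exact: can_forest.
by split; [exact: can_plabic|exact: can_contracted|exact: can_fully_reduced].
Qed.
End Trips.

(** * Strand matchings and isotopies *)

Section CanonicalMatching.
Variable r : nat.
Local Notation n := (2 * r).
Variables c0 c1 c2 : 'I_n.
Hypotheses (c01 : c0 < c1) (c12 : c1 <= c2) (hv : valid_cuts c0 c1 c2).
Local Notation cuts := (cuts c0 c1 c2).
Local Notation part := (part c0 c1 c2).
Local Notation part_size := (part_size c0 c1 c2).
Local Notation spoke := {c : 'I_n | hub_cut c0 c1 c2 c}.
Local Notation G := (canonical_web c01 c12).

Let W c : {set G} := vtx (inl (true, c) : G).

Let W_eq i c : c \in cuts -> (W i == W c) = (part i == c).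
Proof.
move=> hc; rewrite /W vtxE /= (part_cut c01 c12 hc).
by apply/eqP/eqP => [[]|->].
Qed.

Let white_verticesE : white_vertices G = [set W c | c in cuts].
Proof.
apply/setP => v; apply/imsetP/imsetP => [[x]|[c hc ->]]; last by exists (inl (true, c)).
case: x => [[[] i]|[[] s]] // _ ->.
  by exists (part i); [exact: part_in_cuts|rewrite vtx_part].
by exists (cut_of s); [exact: spoke_in|rewrite vtx_spoke].
Qed.

Let card_white_vertices : #|white_vertices G| = if c1 < c2 then 3 else 2.
Proof.
rewrite white_verticesE card_in_imset ?card_cuts // => c d hc hd /eqP.
by rewrite W_eq // part_cut // => /eqP.
Qed.

(** The spoke that avoids the white vertices of [u] and [v] is the one at the third cut [s], of
    multiplicity [r - part_size s]. *)
Lemma can_strand_matching M :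
  strand_matching G M <-> noncrossing_matching M /\ linked c0 c1 c2 M.
Proof.
have cnt c d : c \in cuts -> d \in cuts ->
    #|[set i | (bdry_nbr G i == W c) && (bdry_nbr G (M i) == W d)]| = links c0 c1 c2 M c d.
  move=> hc hd; apply: eq_card => i; rewrite !inE /bdry_nbr.
  by rewrite -![vtx _]/(W _) !W_eq.
split=> -[ncM h]; split=> //.
  move=> u v hu hv' nuv.
  have Wu : W u \in white_vertices G by rewrite white_verticesE imset_f.
  have Wv : W v \in white_vertices G by rewrite white_verticesE imset_f.
  have nW : W u != W v by rewrite W_eq // part_cut.
  have [] := h _ _ Wu Wv nW; rewrite cnt // card_white_vertices.
  case: ifP => [h12 _ h3 s hs su sv|_ h2 _]; last exact: h2.
  have hubs : hub_cut c0 c1 c2 s by rewrite /hub_cut h12.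
  pose t : spoke := Sub s hubs; have et : cut_of t = s by exact: SubK.
  rewrite (h3 erefl (inr (false, t) : G)) /= ?et //; first by rewrite /interior_black is_bdryE.
  by rewrite !inE vtx_spoke et !W_eq // !part_cut // negb_or su sv.
move=> u v; rewrite white_verticesE => /imsetP[c hc ->] /imsetP[d hd ->] nW.
have ncd : c != d by apply: contraNneq nW => ->.
rewrite cnt //; have := h _ _ hc hd ncd; rewrite /polygon_weight card_white_vertices.
case: ifP => h12 hl; split=> // _ x /andP[]; rewrite is_bdryE.
case: x => [[[] i]|[[] s]] //= _ _ ; rewrite !inE vtx_spoke !W_eq ?spoke_in //.
rewrite !part_cut ?spoke_in // negb_or => /andP[sc sd].
exact: hl (spoke_in s) sc sd.
Qed.
End CanonicalMatching.

Section Isotopy.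
Variables (n : nat).
Implicit Types G H : hgraph n.

Lemma isotopic_sym G H : isotopic G H -> isotopic H G.
Proof.
case=> f [[g fK gK] frot fopp fwm fb]; exists g; split.
- by exists f.
- by move=> x; apply: (can_inj fK); rewrite frot !gK.
- by move=> x; apply: (can_inj fK); rewrite fopp !gK.
- by move=> x; have [] := fwm (g x); rewrite gK => -> ->.
- by move=> i; rewrite -fb fK.
Qed.

Lemma isotopic_trans G H K : isotopic G H -> isotopic H K -> isotopic G K.
Proof.
case=> f [fbij frot fopp fwm fb] [g [gbij grot gopp gwm gb]]; exists (g \o f); split.
- exact: bij_comp.
- by move=> x /=; rewrite frot grot.
- by move=> x /=; rewrite fopp gopp.
- by move=> x /=; have [<- <-] := fwm x; exact: gwm.
- by move=> i /=; rewrite fb gb.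
Qed.

Lemma isotopic_is_bdry G H (f : G -> H) : injective f ->
  (forall i, f (bdry G i) = bdry H i) -> forall x, is_bdry (f x) = is_bdry x.
Proof.
move=> finj fb x; apply/is_bdryP/is_bdryP => -[i e]; exists i; last by rewrite e fb.
by apply: finj; rewrite e fb.
Qed.

Lemma vtx_morph G H (f : G -> H) : (forall x, f (rot G x) = rot H (f x)) ->
  forall x, vtx (f x) = f @: vtx x.
Proof.
move=> frot x; have it k : iter k (rot H) (f x) = f (iter k (rot G) x).
  by elim: k => //= k ->; rewrite frot.
apply/setP => y; apply/idP/imsetP => [|[z hz ->]].
  rewrite vtx_fconnect => /iter_findex <-; rewrite it.
  by exists (iter (findex (rot H) (f x) y) (rot G) x); rewrite // vtx_fconnect fconnect_iter.
by move: hz; rewrite !vtx_fconnect => /iter_findex <-; rewrite -it fconnect_iter.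
Qed.
End Isotopy.

Lemma isotopic_strand_matching r (G H : hgraph (2 * r)) M :
  isotopic G H -> strand_matching G M -> strand_matching H M.
Proof.
case=> f [fbij frot fopp fwm fb] [ncM h]; split=> //.
have finj := bij_inj fbij; have [g fK gK] := fbij.
have vf := vtx_morph frot; have bf := isotopic_is_bdry finj fb.
have Finj : injective (fun A : {set G} => f @: A) by exact: imset_inj.
have eW : white_vertices H = [set f @: (A : {set G}) | A in white_vertices G].
  apply/setP => v; apply/imsetP/imsetP => [[y wy ->]|[_ /imsetP[x wx ->] ->]].
    exists (vtx (g y)); last by rewrite -vf gK.
    by apply: imset_f; rewrite -topredE /= -(proj1 (fwm _)) gK.
  by exists (f x); rewrite ?vf // -topredE /= (proj1 (fwm _)).
have cW : #|white_vertices H| = #|white_vertices G| by rewrite eW card_imset.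
have nbrf i : bdry_nbr H i = f @: bdry_nbr G i by rewrite /bdry_nbr -fb -fopp vf.
move=> u v; rewrite eW => /imsetP[u0 hu ->] /imsetP[v0 hv ->] nuv.
have nuv0 : u0 != v0 by apply: contraNneq nuv => ->.
have e : #|[set i | (bdry_nbr H i == f @: u0) && (bdry_nbr H (M i) == f @: v0)]| =
    #|[set i | (bdry_nbr G i == u0) && (bdry_nbr G (M i) == v0)]|.
  by apply: eq_card => i; rewrite !inE !nbrf !(inj_eq Finj).
have [h2 h3] := h _ _ hu hv nuv0; rewrite /polygon_weight cW e; split=> // c3 y iy ny.
rewrite (h3 c3 (g y)).
- by rewrite -(proj2 (fwm _)) gK.
- by rewrite /interior_black -(proj1 (fwm _)) -bf gK.
- by move: ny; rewrite -{1}(gK y) -fopp vf !inE !(inj_eq Finj).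
Qed.

Lemma isotopic_Phi r (G H : hgraph (2 * r)) w : isotopic G H -> Phi G w -> Phi H w.
Proof.
move=> iso [T [M sM eT] pT]; exists T => //; exists M => //.
exact: isotopic_strand_matching sM.
Qed.

(** * Forest webs are canonical *)

Section Forest.
Variables (n : nat) (G : hgraph n).
Hypotheses (oppK : involutive (@opp n G)) (opp_neq : forall x : G, opp x != x).
Hypothesis acyclic : forest G.
Implicit Types (x y : G) (D : {set G}).

(** If every dart of [D] shared its vertex with another one, a walk in [D] could always continue
    without turning back, and would close up to a cycle. *)
Lemma forest_leaf D x0 : (forall x, x \in D -> opp x \in D) -> x0 \in D ->
  exists2 x, x \in D & forall y, y \in D -> vtx y = vtx x -> y = x.
Proof.
move=> Dopp Dx0.
suff /exists_inP[x xD /forall_inP h] :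
    [exists x in D, [forall y in D, (vtx y == vtx x) ==> (y == x)]].
  by exists x => // y yD /eqP e; apply/eqP; exact: (implyP (h y yD)).
apply: contraT; rewrite negb_exists_in => /forall_inP noleaf.
have {}noleaf x : x \in D -> exists2 y, y \in D & (vtx y == vtx x) && (y != x).
  move=> xD; apply/exists_inP; apply: contraR (noleaf x xD) => no.
  apply/forall_inP => y yD; apply/implyP => /eqP e; apply: contraR no => ne.
  by apply/exists_inP; exists y; rewrite // e eqxx.
pose f x := odflt x [pick y | [&& y \in D, vtx y == vtx (opp x) & y != opp x]].
have fP x : x \in D -> [/\ f x \in D, vtx (f x) = vtx (opp x) & f x != opp x].
  move=> xD; have [y yD /andP[e ne]] := noleaf _ (Dopp x xD).
  rewrite /f; case: pickP => [z /and3P[zD /eqP ez nz] //|/(_ y)].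
  by rewrite yD e ne.
have fD k x : x \in D -> iter k f x \in D.
  by move=> xD; elim: k => //= k IH; have [] := fP _ IH.
(* The return time is minimised over all starting darts, which makes the vertices of the shortest
   closed walk distinct. *)
pose P d := (0 < d) && [exists x in D, vtx (iter d f x) == vtx x].
have exP : exists d, P d.
  pose h (k : 'I_#|G|.+1) := iter k f x0.
  have : ~~ injectiveb h.
    apply/negP => /injectiveP hinj; have := max_card (mem (codom h)).
    by rewrite card_codom // card_ord ltnn.
  case/injectivePn => k [l nkl e].
  wlog kl : k l nkl e / k < l.
    move=> W; case: (ltngtP k l) => [|lk|/val_inj ekl]; first exact: W.
      by apply: (W l k) => //; rewrite eq_sym.
    by rewrite ekl eqxx in nkl.
  exists (l - k); rewrite /P subn_gt0 kl; apply/exists_inP; exists (h k); first exact: fD.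
  by rewrite /h -iterD subnK ?(ltnW kl) // -/(h l) -e.
case: (ex_minnP exP) => d /andP[d0 /exists_inP[x xD /eqP ed]] dmin.
have minP m y : y \in D -> 0 < m -> m < d -> vtx (iter m f y) != vtx y.
  move=> yD m0 md; apply/negP => e; have := dmin m; rewrite /P m0 /= leqNgt md.
  by move=> H; have := H (introT exists_inP (ex_intro2 _ _ y yD e)).
pose e := [rel y z : G | (vtx (opp y) == vtx z) && (z != opp y)].
have estep y : y \in D -> e y (f y) by move=> yD /=; have [_ -> ->] := fP y yD; rewrite eqxx.
have pathf m y : y \in D -> path e y (traject f (f y) m).
  elim: m y => //= m IH y yD; rewrite [(_ && _) && _]andbC IH ?(fD 1) //.
  exact: estep.
case/negP: (acyclic (traject f x d)); apply/and3P; split.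
- by case: d d0 {ed dmin minP}.
- case: d d0 ed dmin minP => // m _ ed dmin minP; rewrite /= rcons_path pathf //= last_traject.
  have zD := fD m x xD; have [_ vz nz] := fP _ zD.
  rewrite -vz -[f (iter m f x)]/(iter m.+1 f x) ed eqxx /=.
  (* The last dart is not the reverse of the first: for [d = 1] by [opp_neq], for [d = 2] by the
     choice of [f], and otherwise the walk from [f x] would return after [d - 2] steps. *)
  apply/eqP => ex; case: m ed dmin minP zD vz nz ex => [|m] ed dmin minP zD vz nz ex.
    by case/eqP: (opp_neq x); exact: esym ex.
  have eox : opp x = iter m f (f x) by rewrite {1}ex oppK iterSr.
  case: m ed dmin minP zD vz nz ex eox => [|m] ed dmin minP zD vz nz ex eox.
    by have [_ _] := fP x xD; rewrite eox eqxx.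
  have [fxD vfx _] := fP x xD.
  by have := minP m.+1 (f x) fxD isT (ltnW (ltnSn _)); rewrite -eox vfx eqxx.
- have key a b : a < b -> b < d -> vtx (iter a f x) != vtx (iter b f x).
    move=> ab bd; have := minP (b - a) (iter a f x) (fD a x xD) ltac:(lia) ltac:(lia).
    by rewrite -iterD subnK ?(ltnW ab) // eq_sym.
  apply/(uniqP (vtx x)) => a b; rewrite !inE size_map size_traject => ha hb.
  rewrite !(nth_map x) ?size_traject // !nth_traject // => e'.
  case: (ltngtP a b) => // h; first by have := key a b h hb; rewrite e' eqxx.
  by have := key b a h ha; rewrite e' eqxx.
Qed.

(** A forest has fewer edges than vertices, with two darts per edge; removing the edge at a leaf
    loses at least one vertex. *)
Lemma forest_edges D : (forall x, x \in D -> opp x \in D) -> D != set0 ->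
  #|D| < #|[set vtx x | x in D]|.*2.
Proof.
have [m] := ubnP #|D|; elim: m D => // m IH D hm Dopp /set0Pn[x0 Dx0].
have [x xD leaf] := forest_leaf Dopp Dx0.
pose D' := D :\ x :\ opp x.
have oxD := Dopp x xD.
have cD : #|D| = #|D'|.+2.
  by rewrite (cardsD1 x D) xD (cardsD1 (opp x)) !inE opp_neq oxD.
have vD : #|[set vtx y | y in D']|.+1 <= #|[set vtx y | y in D]|.
  rewrite [X in _ <= X](cardsD1 (vtx x)) imset_f // add1n ltnS.
  apply: subset_leq_card; apply/subsetP => v /imsetP[y].
  rewrite !inE => /and3P[yo yx yD] ->; rewrite imset_f // andbT.
  by apply: contra yx => /eqP/(leaf y yD) ->.
have [D0|nD0] := eqVneq D' set0.
  rewrite cD D0 cards0; suff : 2 <= #|[set vtx y | y in D]| by lia.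
  have ne : vtx x != vtx (opp x).
    by apply/eqP => e; have := opp_neq x; rewrite (leaf _ oxD (esym e)) eqxx.
  apply: leq_trans (_ : #|[set vtx x; vtx (opp x)]| <= _); first by rewrite cards2 ne.
  by apply: subset_leq_card; apply/subsetP => v; rewrite !inE => /orP[] /eqP->; rewrite imset_f.
have := IH D' ltac:(lia) _ nD0; rewrite cD => H.
have {}H : #|D'| < #|[set vtx y | y in D']|.*2.
  apply: H => y; rewrite !inE => /and3P[yo yx yD].
  rewrite (inj_eq (inv_inj oppK)) yx Dopp // andbT.
  by apply: contra yo => /eqP <-; rewrite oppK.
lia.
Qed.
End Forest.

(** * Counting the interior black vertices *)

Section ForestWeb.
Variables (r : nat) (G : hgraph (2 * r)).
Local Notation n := (2 * r).
Hypotheses (r_gt0 : 0 < r) (pG : is_hourglass_plabic G r) (cG : contracted G).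
Hypotheses (noiso : no_isolated_component G) (acyclic : forest G).
Implicit Types (x y : G) (i j : 'I_n).

Let oppK := opp_involutive pG.
Let opp_ne := Defs.opp_neq pG.

Definition hub_darts : {set G} := [set x | interior_black x].
Definition hub_vertices : {set {set G}} := [set vtx x | x in hub_darts].

Lemma white_vtx x y : y \in vtx x -> white y = white x.
Proof.
rewrite vtx_fconnect => /iter_findex <-; elim: findex => //= m <-.
exact: (white_rot pG).
Qed.

Lemma white_not_bdry x : white x -> ~~ is_bdry x.
Proof. by move=> wx; apply/negP => /is_bdryP[i e]; have := bdry_black pG i; rewrite -e wx. Qed.

Lemma opp_hub_white x : x \in hub_darts -> white (opp x).
Proof. by rewrite inE => /andP[wx _]; rewrite (white_opp pG). Qed.

Lemma mem_hub_vtx x y : y \in vtx x -> (y \in hub_darts) = (x \in hub_darts).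
Proof. by move=> h; rewrite !inE /interior_black (white_vtx h) (is_bdry_vtx (bdry_simple pG) h). Qed.

Lemma sum_by_vertex (P : pred G) (m : G -> nat) :
  (forall x y, y \in vtx x -> P y = P x) ->
  \sum_(x | P x) m x = \sum_(v in [set vtx x | x in P]) \sum_(x in v) m x.
Proof.
move=> hP; rewrite (partition_big (@vtx n G) (mem [set vtx x | x in P])); last first.
  by move=> x Px; apply: imset_f.
apply: eq_bigr => v /imsetP[x Px ->]; apply: eq_bigl => y; rewrite -vtx_eq.
by apply/andP/idP => [[]//|h]; split=> //; rewrite (hP _ _ h).
Qed.

Lemma card_white_vertices : #|white_vertices G| = #|hub_vertices|.+2.
Proof.
have sumw : \sum_(x : G | white x) mult x = #|white_vertices G| * r.
  apply: etrans (sum_by_vertex (P := @white n G) (@mult n G) white_vtx) _.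
  rewrite -sum_nat_const; apply: eq_bigr => v /imsetP[x wx ->].
  by have := interior_degree pG (white_not_bdry wx); rewrite /degree.
have sumh : \sum_(x in hub_darts) mult x = #|hub_vertices| * r.
  apply: etrans (sum_by_vertex (P := fun x => x \in hub_darts) (@mult n G) mem_hub_vtx) _.
  rewrite -sum_nat_const; apply: eq_bigr => v /imsetP[x hx ->].
  by move: hx; rewrite -topredE /= inE => /andP[_ /(interior_degree pG)].
have sumb : \sum_(x : G | is_bdry x) mult x = n.
  rewrite (eq_bigl (fun x => x \in [set bdry G i | i : 'I_n])).
    rewrite big_imset; last by move=> i j _ _; apply: bdry_inj pG _ _.
    by rewrite (eq_bigr (fun=> 1)) ?sum1_card ?card_ord // => i _; rewrite (bdry_mult pG).
  by move=> x; apply/is_bdryP/imsetP => [[i ->]|[i _ ->]]; exists i.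
have : \sum_(x : G | white x) mult x = \sum_(x : G | ~~ white x) mult x.
  rewrite (reindex_inj (inv_inj oppK)); apply: eq_big => x; rewrite ?(white_opp pG) // => _.
  exact: (mult_opp pG).
rewrite (bigID (fun x : G => is_bdry x) (fun x : G => ~~ white x)) /= sumw.
rewrite (eq_bigl (fun x : G => is_bdry x)); last first.
  move=> x; apply/andP/idP => [[]//|bx]; split=> //.
  by apply: contraTN bx; exact: white_not_bdry.
rewrite sumb (eq_bigl (fun x => x \in hub_darts)); last by move=> x; rewrite inE.
rewrite sumh -mulnDl => /eqP; rewrite eqn_pmul2r // => /eqP ->.
by rewrite addnC addn2.
Qed.

Lemma card_vtx1 x : ~~ is_bdry x -> vtx x = [set x] -> mult x = r.
Proof.
move=> /(interior_degree pG) e ex; apply: etrans e.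
by rewrite /degree ex big_set1.
Qed.

Lemma card_vtx_mult x : ~~ is_bdry x -> mult x = r -> vtx x = [set x].
Proof.
move=> /(interior_degree pG); rewrite /degree (bigD1 x) ?mem_vtx //= => e mx.
apply/setP => y; rewrite !inE; have [->|ne] := eqVneq y x; first exact: mem_vtx.
apply/negP => yx; move: e; rewrite (bigD1 y) ?yx //= mx.
by have := mult_gt0 pG y; lia.
Qed.

(** Two edges are excluded by [contracted], as the neighbours are white and hence not on the
    boundary. A single edge would have multiplicity [r], so its other end would have no further edge
    and the component would miss the boundary. *)
Lemma card_hub_vtx x : x \in hub_darts -> 3 <= #|vtx x|.
Proof.
move=> hx; have ow := opp_hub_white hx.
have [wx bx] : ~~ white x /\ ~~ is_bdry x by move: hx; rewrite inE => /andP.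
have h0 : 0 < #|vtx x| by apply/card_gt0P; exists x; rewrite mem_vtx.
have h2 : #|vtx x| != 2.
  apply/eqP => e; have [y yx] := cG bx e; apply/negP/white_not_bdry.
  by apply: opp_hub_white; rewrite (mem_hub_vtx yx).
suff h1 : #|vtx x| != 1 by lia.
apply/eqP => /eqP/cards1P[z ez].
have {}ez : vtx x = [set x] by rewrite ez; have := mem_vtx x; rewrite ez inE => /eqP <-.
have mx := card_vtx1 bx ez.
have oz := card_vtx_mult (white_not_bdry ow) (etrans (mult_opp pG x) mx).
have [i ci] := noiso x.
suff : bdry G i \in [set x; opp x].
  rewrite !inE => /orP[] /eqP e; first by move: bx; rewrite -e is_bdry_bdry.
  by move: ow; rewrite -e (negbTE (bdry_black pG i)).
have rfix y : vtx y = [set y] -> rot G y = y.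
  by move=> e; apply/set1P; rewrite -e vtx_eq vtx_rot.
have H p u : u \in [set x; opp x] ->
    path [rel y z | (z == rot G y) || (z == opp y)] u p -> last u p \in [set x; opp x].
  elim: p u => //= v p IH u uS /andP[huv]; apply: IH; move: uS huv; rewrite !inE.
  by case/orP=> /eqP-> /orP[] /eqP->; rewrite ?rfix // ?oppK ?eqxx ?orbT.
by case/connectP: ci => p hp ->; apply: H hp; rewrite !inE eqxx.
Qed.

Lemma sum_hub_vertices : \sum_(v in hub_vertices) #|v| = #|hub_darts|.
Proof.
rewrite -[RHS]sum1_card; apply/esym.
apply: etrans (sum_by_vertex (P := fun x => x \in hub_darts) (fun=> 1) mem_hub_vtx) _.
by apply: eq_bigr => v _; rewrite sum1_card.
Qed.

Lemma card_hub_darts_ge : 3 * #|hub_vertices| <= #|hub_darts|.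
Proof.
rewrite -sum_hub_vertices mulnC -sum_nat_const; apply: leq_sum => v /imsetP[x hx ->].
exact: card_hub_vtx.
Qed.

(** The edges at interior black vertices form a forest on these and the white vertices, at most
    [2 h + 2] vertices for [h] black ones. *)
Lemma card_hub_darts_lt : hub_darts != set0 -> #|hub_darts| < #|hub_vertices|.*2.+2.
Proof.
move=> /set0Pn[x0 hx0]; pose D := hub_darts :|: [set opp x | x in hub_darts].
have cD : #|D| = #|hub_darts|.*2.
  rewrite cardsU card_imset ?addnn; last exact: inv_inj.
  rewrite (_ : _ :&: _ = set0) ?cards0 ?subn0 //; apply/setP => x; rewrite !inE.
  apply/negP => /andP[/andP[wx _] /imsetP[y /opp_hub_white wy e]].
  by move: wx; rewrite e wy.
have Dopp x : x \in D -> opp x \in D.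
  rewrite !in_setU => /orP[hx|/imsetP[y hy ->]]; first by rewrite imset_f ?orbT.
  by rewrite oppK hy.
have D0 : D != set0 by apply/set0Pn; exists x0; rewrite inE hx0.
have := forest_edges oppK opp_ne acyclic Dopp D0; rewrite cD ltn_double => h.
apply: leq_trans h _.
apply: (@leq_trans (#|hub_vertices| + #|white_vertices G|)); last first.
  by rewrite card_white_vertices; lia.
apply: leq_trans (leq_card_setU _ _).
apply: subset_leq_card; apply/subsetP => v /imsetP[x]; rewrite !in_setU.
case/orP=> [hx ->|/imsetP[y hy ->] ->]; first by rewrite imset_f.
by rewrite (imset_f (@vtx n G) (opp_hub_white hy)) orbT.
Qed.

(** The two bounds [3 h <= #|hub_darts| < 2 h + 2] leave [h = 0], or [h = 1] with three edges. *)
Lemma forest_web_cases :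
  (forall x, ~~ interior_black x) /\ #|interior_vertices G| = 2 \/
  exists b, [/\ interior_black b, forall x, interior_black x = (x \in vtx b),
     #|vtx b| = 3 & #|interior_vertices G| = 4].
Proof.
have eI : #|interior_vertices G| = #|white_vertices G| + #|hub_vertices|.
  rewrite -[RHS](_ : #|white_vertices G :|: hub_vertices| = _).
    apply: eq_card => v; rewrite inE; apply/imsetP/orP => [[x]|].
      rewrite inE => ix ->; have [wx|wx] := boolP (white x); first by left; apply: imset_f.
      by right; apply: imset_f; rewrite inE /interior_black wx.
    case=> /imsetP[x hx ->]; exists x => //; rewrite inE; first exact: white_not_bdry.
    by move: hx; rewrite inE => /andP[].
  rewrite cardsU (_ : _ :&: _ = set0) ?cards0 ?subn0 //.
  apply/setP => v; rewrite !inE; apply/negP => /andP[/imsetP[x wx ->] /imsetP[y hy e]].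
  have := white_vtx (x := y) (y := x); rewrite -e mem_vtx => /(_ isT) ew.
  by move: hy; rewrite inE /interior_black -ew [white x]wx.
have := card_white_vertices; have := card_hub_darts_ge; have := card_hub_darts_lt.
have [h0|hn0] := eqVneq hub_darts set0.
  move=> _ _ cw; left; split.
    by move=> x; have := in_set0 x; rewrite -h0 inE => ->.
  rewrite eI cw (_ : #|hub_vertices| = 0) //.
  by rewrite /hub_vertices h0 imset0 cards0.
move=> /(_ isT) h1 h2 cw; right.
have c1 : #|hub_vertices| = 1.
  have /set0Pn[x hx] := hn0.
  have : 0 < #|hub_vertices| by apply/card_gt0P; exists (vtx x); apply: imset_f.
  lia.
have /set0Pn[b hb] := hn0; exists b.
have c3 : #|hub_darts| = 3 by lia.
have eB x : interior_black x = (x \in vtx b).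
  have hx : (x \in hub_darts) = interior_black x by rewrite inE.
  rewrite -hx; apply/idP/idP => [xh|/mem_hub_vtx->//].
  have /eqP/cards1P[v ev] := c1.
  have e (y : G) : y \in hub_darts -> vtx y = v.
    by move=> hy; apply/set1P; rewrite -ev imset_f.
  by rewrite vtx_eq !e.
split=> //.
- by move: hb; rewrite inE.
- by rewrite -c3; apply: eq_card => x; rewrite inE eB.
- by rewrite eI cw c1.
Qed.
End ForestWeb.

(** * Reconstruction of a forest web from its faces *)

Section Structure.
Variables (r : nat) (G : hgraph (2 * r)).
Local Notation n := (2 * r).
Hypotheses (r_gt0 : 0 < r) (pG : is_hourglass_plabic G r) (cG : contracted G).
Hypotheses (noiso : no_isolated_component G) (acyclic : forest G).
Implicit Types (x y : G) (i j : 'I_n).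

Let oppK := opp_involutive pG.
Let opp_ne := Defs.opp_neq pG.
Let bI : injective (@bdry n G) := bdry_inj pG.
Let bR := bdry_simple pG.

Let a i : G := opp (bdry G i).

Lemma opp_bdry_white i : white (a i).
Proof. by rewrite /a (white_opp pG) (bdry_black pG). Qed.

Lemma opp_bdry_inj : injective a.
Proof. by move=> i j /(inv_inj oppK)/bI. Qed.

Let a_int i : ~~ is_bdry (a i).
Proof. exact: (white_not_bdry pG (opp_bdry_white i)). Qed.

Lemma face_bdry i : face_step (bdry G i) = rot G (a i).
Proof. exact: closed_rot_int (a_int i). Qed.

Lemma face_opp_bdry i : face_step (a i) = bdry G (ord_pred i).
Proof. by rewrite /face_step /= oppK (closed_rot_bdry bI). Qed.

Lemma face_int x : ~~ is_bdry (opp x) -> face_step x = rot G (opp x).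
Proof. by move=> h; rewrite /face_step /= closed_rot_int. Qed.

Let symf := fconnect_sym (face_step_inj oppK bI bR).

Section Glue.
Variables c0 c1 c2 : 'I_n.
Hypotheses (c01 : c0 < c1) (c12 : c1 <= c2).
Local Notation cuts := (cuts c0 c1 c2).
Local Notation prev_cut := (prev_cut c0 c1 c2).
Local Notation next_cut := (next_cut c0 c1 c2).
Hypothesis noncut : forall i, i \notin cuts -> rot G (a i) = a (ordS i).
Hypothesis claw_cut : ~~ (c1 < c2) -> forall i, i \in cuts -> rot G (a i) = a (ordS (prev_cut i)).
Hypothesis hub_cuts : c1 < c2 -> forall c, c \in cuts ->
  [/\ rot G (rot G (a c)) = a (ordS (prev_cut c)),
      rot G (opp (rot G (a c))) = opp (rot G (a (next_cut c))) &
      ~~ is_bdry (opp (rot G (a c)))].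
Hypothesis all_darts : forall x, [\/ exists i, x = bdry G i, exists i, x = a i |
  c1 < c2 /\ exists2 c, c \in cuts & x = rot G (a c) \/ x = opp (rot G (a c))].

Let f (x : canonical_web c01 c12) : G :=
  match x : can_dart c0 c1 c2 with
  | inl (false, i) => bdry G i
  | inl (true, i) => a i
  | inr (true, s) => rot G (a (cut_of s))
  | inr (false, s) => opp (rot G (a (cut_of s)))
  end.

Let f_rot (x : canonical_web c01 c12) : f (rot (canonical_web c01 c12) x) = rot G (f x).
Proof.
rewrite rotE; case: x => [[[] i]|[[] s]] /=; last 1 first.
- have [_ -> _] := hub_cuts (spoke_hub s) (spoke_in s).
  by rewrite cut_of_next.
- have [ic|nic] := boolP (i \in cuts); last by rewrite noncut.
  case: insubP => [s _ es|] /=; first by rewrite -es.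
  by rewrite /hub_cut ic andbT => h; rewrite claw_cut.
- by rewrite bR.
- by have [-> _ _] := hub_cuts (spoke_hub s) (spoke_in s).
Qed.

Let f_opp (x : canonical_web c01 c12) : f (opp x) = opp (f x).
Proof. by case: x => [[[] i]|[[] s]] //=; rewrite /a ?oppK. Qed.

Let f_white (x : canonical_web c01 c12) : white (f x) = white x.
Proof.
case: x => [[[] i]|[[] s]] /=.
- exact: opp_bdry_white.
- exact: negbTE (bdry_black pG i).
- by rewrite (white_rot pG) opp_bdry_white.
- by rewrite (white_opp pG) (white_rot pG) opp_bdry_white.
Qed.

Let f_inj : injective f.
Proof.
have nb s i : opp (rot G (a (cut_of (s : {c : 'I_n | hub_cut c0 c1 c2 c})))) <> bdry G i.
  have [_ _] := hub_cuts (spoke_hub s) (spoke_in s).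
  by move=> /negP h e; apply: h; rewrite e is_bdry_bdry.
have nb' s i : rot G (a (cut_of (s : {c : 'I_n | hub_cut c0 c1 c2 c}))) <> a i.
  by move=> e; apply: (nb s i); rewrite e /a oppK.
move=> x y; have [exy|nxy] := eqVneq (white x) (white y); last first.
  by move=> e; case/eqP: nxy; rewrite -!f_white e.
case: x exy => [[[] i]|[[] s]]; case: y => [[[] j]|[[] t]] //= _.
- by move/opp_bdry_inj->.
- by move=> e; case: (nb' t i).
- by move/bI->.
- by move=> e; case: (nb t i).
- by move=> e; case: (nb' s j).
- by move/perm_inj/opp_bdry_inj/val_inj->.
- by move=> e; case: (nb s j).
- by move/(inv_inj oppK)/perm_inj/opp_bdry_inj/val_inj->.
Qed.

Let f_bij : bijective f.
Proof.
apply: inj_card_bij => //; rewrite -(card_codom f_inj).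
apply: subset_leq_card; apply/subsetP => x _; apply/codomP.
have [[i ->]|[i ->]|[h [c hc e]]] := all_darts x.
- by exists (inl (false, i)).
- by exists (inl (true, i)).
have hubc : hub_cut c0 c1 c2 c by rewrite /hub_cut h.
case: e => ->; [exists (inr (true, Sub c hubc))|exists (inr (false, Sub c hubc))] => /=;
  by rewrite [cut_of _]SubK.
Qed.

Let degree_cut c : c \in cuts ->
  r = part_size c0 c1 c2 c +
      \sum_(s : {c : 'I_n | hub_cut c0 c1 c2 c} | cut_of s == c) mult (rot G (a (cut_of s))).
Proof.
move=> hc; apply: etrans (esym (interior_degree pG (a_int c))) _.
rewrite /degree (_ : vtx (a c) = f @: vtx (inl (true, c) : canonical_web c01 c12)); last first.
  exact: (vtx_morph f_rot (inl (true, c))).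
rewrite big_imset; last by move=> x y _ _; apply: f_inj.
have m1 i : mult (f (inl (true, i))) = 1 by rewrite /= (mult_opp pG) (bdry_mult pG).
exact: (@sum_vtx_claw r c0 c1 c2 c01 c12 (fun d => mult (f d)) c hc m1).
Qed.

(** The hypotheses of the section describe the rotation only. The multiplicities follow from degree
    [r] at the white vertices, and their positivity gives [valid_cuts]. *)
Lemma glue_canonical : valid_cuts c0 c1 c2 /\ isotopic (canonical_web c01 c12) G.
Proof.
have [i0 i1 i2] := cut_ins c0 c1 c2.
have hubm c : c1 < c2 -> c \in cuts -> mult (rot G (a c)) = r - part_size c0 c1 c2 c /\ part_size c0 c1 c2 c < r.
  move=> h hc; have := degree_cut hc.
  have [s es ->] := sum_spokes (fun s => mult (rot G (a (cut_of s)))) h hc.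
  by rewrite es => e; have := mult_gt0 pG (rot G (a c)); lia.
split.
  rewrite /valid_cuts; case: ifPn => h.
    have [_ ] := hubm _ h i0; have [_ ] := hubm _ h i1; have [_ ] := hubm _ h i2.
    by rewrite part_size0 part_size1 // part_size2 //; lia.
  by have := degree_cut i1; rewrite sum_no_spokes // part_size1 //; lia.
exists f; split; [exact: f_bij|exact: f_rot|exact: f_opp| |by []].
move=> d; rewrite f_white; split=> //.
case: d => [[[] i]|[[] s]] /=.
- by rewrite (mult_opp pG) (bdry_mult pG).
- by rewrite (bdry_mult pG).
- exact: (hubm _ (spoke_hub s) (spoke_in s)).1.
- by rewrite (mult_opp pG); exact: (hubm _ (spoke_hub s) (spoke_in s)).1.
Qed.
End Glue.

Let faces_eq : #|interior_vertices G|.+1 + fcard (@face_step n G) G = #|G|./2.+2.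
Proof.
by apply/(planarE oppK opp_ne bI bR noiso); [lia|exact: planarity pG].
Qed.

Let fr i := froot (@face_step n G) (bdry G i).

Section Claws.
Hypotheses (nohub : forall x, ~~ interior_black x) (card_int : #|interior_vertices G| = 2).

Let claw_darts x : (exists i, x = bdry G i) \/ (exists i, x = a i).
Proof.
have bl y : ~~ white y -> exists i, y = bdry G i.
  by move=> wy; apply/is_bdryP; have := nohub y; rewrite /interior_black wy negbK.
have [wx|/bl] := boolP (white x); last by left.
have [|i e] := bl (opp x); first by rewrite (white_opp pG) wx.
by right; exists i; rewrite /a -e oppK.
Qed.

Let card_darts : #|G| = 4 * r.
Proof.
have -> : #|G| = #|codom (@bdry n G)| + #|codom a|.
  rewrite -(cardC (mem (codom (@bdry n G)))); congr (_ + _); apply: eq_card => x.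
  rewrite !inE; apply/idP/codomP => [nx|[i ->]]; last exact: a_int.
  have [[i e]|//] := claw_darts x; by move: nx; rewrite e codom_f.
rewrite !card_codom ?card_ord //; [lia|exact: opp_bdry_inj].
Qed.

Let rot_claw i : exists j, rot G (a i) = a j.
Proof.
have [[j e]|//] := claw_darts (rot G (a i)).
by have := opp_bdry_white i; rewrite -(white_rot pG) e (negbTE (bdry_black pG j)).
Qed.

Let tau i := odflt i [pick j | rot G (a i) == a j].

Let tauE i : rot G (a i) = a (tau i).
Proof.
by rewrite /tau; have [j e] := rot_claw i; case: pickP => [k /eqP->|/(_ j)] //; rewrite e eqxx.
Qed.

Let step2 i : face_step (face_step (bdry G i)) = bdry G (ord_pred (tau i)).
Proof. by rewrite face_bdry tauE face_opp_bdry. Qed.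

Let fr_step i : fr (ord_pred (tau i)) = fr i.
Proof.
apply/esym/(rootP symf); rewrite -step2.
exact: (fconnect_iter _ 2).
Qed.

Let card_fr : #|[set fr i | i : 'I_n]| = n.-1.
Proof.
have := faces_eq; rewrite card_int card_darts (card_faces oppK bI bR).
  move: #|_| => N; lia.
move=> x; have [[i ->]|[i ->]] := claw_darts x; first by exists i.
by exists (ord_pred i); rewrite -face_opp_bdry fconnect1.
Qed.

(** By [step2], two face steps from [bdry G i] lead to [bdry G (g i)]; the orbits of [g] correspond
    to the faces. *)
Let g i := ord_pred (tau i).

Let g_inj : injective g.
Proof.
move=> i j /ord_pred_inj e; apply: opp_bdry_inj; apply: (@perm_inj _ (rot G)).
by rewrite !tauE e.
Qed.

(** There is one face fewer than boundary points, so one pair of gaps shares a face and all others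
    are alone. As [g] permutes the gaps of each face, it is a transposition. *)
Let two_cuts : exists p q : 'I_n, [/\ p < q, g p = q, g q = p & forall i, i != p -> i != q -> g i = i].
Proof.
have : ~~ injectiveb fr.
  apply/negP => /injectiveP finj; have := card_fr; rewrite card_imset // card_ord; lia.
case/injectivePn => p [q npq e].
wlog pq : p q npq e / p < q.
  move=> W; case: (ltngtP p q) => [|qp|/val_inj epq]; first exact: W.
    by apply: (W q p) => //; rewrite eq_sym.
  by rewrite epq eqxx in npq.
have einj : {in [set~ q] &, injective fr}.
  apply/imset_injP; rewrite cardsC1 card_ord -card_fr; apply/eqP/eq_card => v.
  apply/imsetP/imsetP => [[i _ ->]|[i _ ->]]; first by exists i.
  have [->|ne] := eqVneq i q; last by exists i; rewrite // !inE.
  by exists p; rewrite // !inE.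
have gfix i : i != p -> i != q -> g i = i.
  move=> ip iq; have [eq|nq] := eqVneq (g i) q.
    have := fr_step i; rewrite -/(g i) eq -e => /einj; rewrite !inE npq iq => /(_ isT isT) epi.
    by rewrite epi eqxx in ip.
  by apply: einj; rewrite ?inE ?nq ?iq // /g fr_step.
(* Otherwise the face at [p] would consist of [bdry G p] and [a (tau p)] only, and [q] would not be
   on it. *)
have gpq : g p != p.
  apply/eqP => gp; have gq : g q = q.
    apply/eqP; apply: contraT => gq; have [gqp|ne] := eqVneq (g q) p.
      by have := g_inj (etrans gqp (esym gp)); move/eqP; rewrite eq_sym (negbTE npq).
    by have := g_inj (gfix _ ne gq); move/eqP; rewrite (negbTE gq).
  have : fconnect (@face_step n G) (bdry G p) (bdry G q) by apply/(rootP symf).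
  move=> /iter_findex; set k := findex _ _ _ => ek.
  have H m : iter m (@face_step n G) (bdry G p) = if odd m then a (tau p) else bdry G p.
    elim: m => //= m ->; case: (odd m) => /=; last by rewrite face_bdry tauE.
    by rewrite face_opp_bdry -/(g p) gp.
  move: ek; rewrite H; case: (odd k) => ek.
    by have := a_int (tau p); rewrite ek is_bdry_bdry.
  by move/bI: ek => ek; rewrite ek eqxx in npq.
have epq : g p = q.
  apply/eqP; apply: contraT => gq.
  by have := g_inj (gfix _ gpq gq); move/eqP; rewrite (negbTE gpq).
exists p, q; split=> //.
apply/eqP; apply: contraT => gqp.
have gqq : g q != q by apply/eqP => h; have := g_inj (etrans h (esym epq)); move/eqP; rewrite eq_sym (negbTE npq).
by have := g_inj (gfix _ gqp gqq); move/eqP; rewrite (negbTE gqq).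
Qed.

Lemma claws_canonical : exists c0 c1 c2 : 'I_n, exists (c01 : c0 < c1) (c12 : c1 <= c2),
  valid_cuts c0 c1 c2 /\ isotopic (canonical_web c01 c12) G.
Proof.
have [p [q [pq gp gq gfix]]] := two_cuts.
have tg i : tau i = ordS (g i) by rewrite /g ord_predK.
have nqp : (q == p) = false by rewrite -val_eqE /=; lia.
exists p, q, q, pq, (leqnn q); apply: glue_canonical.
- move=> i; rewrite in_cuts !negb_or => /and3P[ip iq _].
  by rewrite tauE tg gfix.
- move=> _ i; rewrite in_cuts orbb => /orP[] /eqP->; rewrite tauE tg /prev_cut.
    by rewrite eqxx gp.
  by rewrite nqp eqxx gq.
- by rewrite ltnn.
- by move=> x; have [h|h] := claw_darts x; [constructor 1|constructor 2].
Qed.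
End Claws.

Section Tripod.
Variable b : G.
Hypotheses (hubE : forall x, interior_black x = (x \in vtx b)).
Hypotheses (card_b : #|vtx b| = 3) (card_int : #|interior_vertices G| = 4).

Let hub_opp_white y : y \in vtx b -> white (opp y).
Proof. by rewrite -hubE => /andP[wy _]; rewrite (white_opp pG). Qed.

Let white_darts x : white x -> (exists i, x = a i) \/ exists2 y, y \in vtx b & x = opp y.
Proof.
move=> wx; have [/is_bdryP[i e]|ob] := boolP (is_bdry (opp x)).
  by left; exists i; rewrite /a -e oppK.
by right; exists (opp x); rewrite ?oppK // -hubE /interior_black (white_opp pG) wx ob.
Qed.

Let tripod_darts x : [\/ exists i, x = bdry G i, exists i, x = a i, x \in vtx b |
  exists2 y, y \in vtx b & x = opp y].
Proof.
have [/white_darts[h|h]|wx] := boolP (white x); [by constructor 2|by constructor 4|].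
have [/is_bdryP h|bx] := boolP (is_bdry x); first by constructor 1.
by constructor 3; rewrite -hubE /interior_black wx.
Qed.

(* Two edges from the interior black vertex to the same white vertex would form
   a cycle. *)
Let hub_opp_vtx y z : y \in vtx b -> z \in vtx b -> vtx (opp y) = vtx (opp z) -> y = z.
Proof.
move=> yb zb e; apply/eqP; apply: contraT => ne; case/negP: (acyclic [:: opp y; z]).
have vy : vtx y = vtx z by move: yb zb; rewrite !vtx_eq => /eqP-> /eqP->.
apply/and3P; split=> //=.
  by rewrite oppK vy eqxx eq_sym ne -e eqxx (inj_eq (inv_inj oppK)) ne.
rewrite inE andbT; apply/eqP => h.
have := white_vtx pG (x := opp y) (y := z); rewrite vtx_eq h eqxx => /(_ isT).
by rewrite (hub_opp_white yb); move: zb; rewrite -hubE => /andP[/negbTE->].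
Qed.

(** An edge that is alone at its white vertex has multiplicity [r], hence is alone at the black
    vertex too, which has three edges. *)
Let rot_opp_hub y : y \in vtx b -> rot G (opp y) != opp y.
Proof.
move=> yb; apply/eqP => e.
have ob := white_not_bdry pG (hub_opp_white yb).
have ev : vtx (opp y) = [set opp y].
  apply/setP => z; rewrite !inE vtx_fconnect; apply/idP/eqP => [/iter_findex <-|->]; last exact: connect0.
  by elim: findex => //= m ->.
have my := card_vtx1 pG ob ev; rewrite (mult_opp pG) in my.
have bdy : ~~ is_bdry y by move: yb; rewrite -hubE => /andP[].
have h1 : vtx y = [set y] := card_vtx_mult r_gt0 pG bdy my.
by have := card_b; move: yb; rewrite vtx_eq => /eqP <-; rewrite h1 cards1.
Qed.

Let rot_opp_hub_bdry y : y \in vtx b -> exists j, rot G (opp y) = a j.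
Proof.
move=> yb; have [|//|[z zb e]] := white_darts (x := rot G (opp y)).
  by rewrite (white_rot pG) hub_opp_white.
have := rot_opp_hub yb; rewrite e (hub_opp_vtx zb yb) ?eqxx //.
by rewrite -e vtx_rot.
Qed.

Let rot_hub y : y \in vtx b -> rot G y \in vtx b.
Proof. by move=> h; rewrite vtx_eq vtx_rot -vtx_eq. Qed.

Let face_hub y : y \in vtx b -> exists2 j, rot G (opp y) = a j &
  face_step (face_step y) = bdry G (ord_pred j).
Proof.
move=> yb; have [j e] := rot_opp_hub_bdry yb; exists j => //.
by rewrite (face_int (white_not_bdry pG (hub_opp_white yb))) e face_opp_bdry.
Qed.

Let face_opp_hub y : y \in vtx b -> face_step (opp y) = rot G y.
Proof.
move=> yb; rewrite face_int oppK //.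
by move: yb; rewrite -hubE => /andP[].
Qed.

Let card_darts : #|G| = 4 * r + 6.
Proof.
have cb : #|[pred x : G | ~~ white x]| = n + 3.
  rewrite -(cardID [pred x : G | is_bdry x]) -card_b; congr (_ + _).
    rewrite -[RHS]card_ord -(card_codom bI); apply: eq_card => x.
    rewrite !inE; apply/andP/codomP => [[_ /is_bdryP[i ->]]|[i ->]]; first by exists i.
    by rewrite is_bdry_bdry (bdry_black pG).
  by apply: eq_card => x; rewrite !inE -hubE /interior_black andbC.
have cw : #|[pred x : G | white x]| = #|[pred x : G | ~~ white x]|.
  rewrite -(card_image (inv_inj oppK) [pred x : G | white x]); apply: eq_card => x.
  apply/imageP/idP => [[y]|]; rewrite !inE => wx; first by move=> ->; rewrite (white_opp pG) wx.
  by exists (opp x); rewrite ?oppK // inE (white_opp pG).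
have e : #|[predC [pred x : G | white x]]| = n + 3 by rewrite -cb; apply: eq_card.
by rewrite -(cardC [pred x : G | white x]) e cw cb; lia.
Qed.

(** With 5 vertices on the sphere and [2 * r + 3] edges there are [2 * r] faces, as many as boundary
    points, and every face meets the boundary. *)
Let fr_inj : injective fr.
Proof.
have : #|[set fr i | i : 'I_n]| = n.
  have := faces_eq; rewrite card_int card_darts (card_faces oppK bI bR).
    move: #|_| => N; lia.
  have ab i : exists j, fconnect (@face_step n G) (a i) (bdry G j).
    by exists (ord_pred i); rewrite -face_opp_bdry fconnect1.
  have hb y : y \in vtx b -> exists j, fconnect (@face_step n G) y (bdry G j).
    move=> yb; have [j _ e] := face_hub yb; exists (ord_pred j); rewrite -e.
    exact: (fconnect_iter _ 2).
  move=> x; case: (tripod_darts x) => [[i ->]|[i ->]|xb|[y yb ->]].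
  - by exists i.
  - exact: ab.
  - exact: hb.
  - have [j hj] := hb _ (rot_hub yb); exists j; apply: connect_trans hj.
    by rewrite -face_opp_hub // fconnect1.
move=> e; have h : #|[set fr i | i : 'I_n]| == #|{: 'I_n}| by rewrite e card_ord.
by move=> i j; exact: (imset_injP h).
Qed.

(** A face has a single boundary gap by [fr_inj], so walking from [bdry G i] the next boundary dart
    is [bdry G i] again; it is reached after two face steps, or after four around the black
    vertex. *)
Let rot_bdry i : rot G (a i) = a (ordS i) \/
  exists y, [/\ y \in vtx b, rot G (a i) = opp y & rot G (opp (rot G y)) = a (ordS i)].
Proof.
have key j m : iter m (@face_step n G) (bdry G i) = bdry G (ord_pred j) -> j = ordS i.
  move=> e; have : fr i = fr (ord_pred j) by apply/(rootP symf); rewrite -e fconnect_iter.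
  by move/fr_inj ->; rewrite ord_predK.
have [|[j e]|[y yb e]] := white_darts (x := rot G (a i)).
- by rewrite (white_rot pG) opp_bdry_white.
- by left; rewrite e (key j 2) //= face_bdry e face_opp_bdry.
right; exists y; split=> //; have [j ej ef] := face_hub (rot_hub yb).
by rewrite ej (key j 4) //= face_bdry e face_opp_hub.
Qed.

Let hub_cut_set := [set i | opp (rot G (a i)) \in vtx b].

Let not_hub_cut i : i \notin hub_cut_set -> rot G (a i) = a (ordS i).
Proof.
by case: (rot_bdry i) => // -[y [yb e _]]; rewrite inE e oppK yb.
Qed.

Let hub_imset : [set opp (rot G (a i)) | i in hub_cut_set] = vtx b.
Proof.
apply/setP => y; apply/imsetP/idP => [[i]|yb]; first by rewrite inE => h ->.
have [z ez] : exists z, rot G z = opp y by exists ((rot G)^-1%g (opp y)); rewrite permKV.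
have wz : white z by rewrite -(white_rot pG) ez hub_opp_white.
case: (white_darts wz) => [[i e]|[t tb e]].
  by exists i; [rewrite inE -e ez oppK|rewrite -e ez oppK].
have ety : t = y by apply: hub_opp_vtx => //; rewrite -e -ez vtx_rot.
by have := rot_opp_hub yb; move: ez; rewrite e ety => ->; rewrite eqxx.
Qed.

Let card_hub_cuts : #|hub_cut_set| = 3.
Proof.
rewrite -card_b -hub_imset card_in_imset // => i j _ _.
by move/(inv_inj oppK)/perm_inj/opp_bdry_inj.
Qed.

Lemma tripod_canonical : exists c0 c1 c2 : 'I_n, exists (c01 : c0 < c1) (c12 : c1 <= c2),
  valid_cuts c0 c1 c2 /\ isotopic (canonical_web c01 c12) G.
Proof.
have [|c0 [c1 [c2 [c01 c12 eK]]]] := @set_cuts n hub_cut_set; first by rewrite card_hub_cuts.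
rewrite -/(cuts c0 c1 c2) in eK.
have h12 : c1 < c2.
  by have := card_hub_cuts; rewrite eK (card_cuts c01 c12); case: ifP.
exists c0, c1, c2, c01, c12.
have noncut i : i \notin cuts c0 c1 c2 -> rot G (a i) = a (ordS i).
  by rewrite -eK; exact: not_hub_cut.
have vpart i : vtx (a i) = vtx (a (part c0 c1 c2 i)).
  have [m] := ubnP (cut_dist c0 c1 c2 i); elim: m i => // m IH i hm.
  have [ic|nic] := boolP (i \in cuts c0 c1 c2); first by rewrite part_cut.
  rewrite -(vtx_rot (a i)) noncut // IH.
    by rewrite part_ordS // (negbTE nic).
  by have := cut_dist_ordS c01 c12 nic; lia.
have cutP c : c \in cuts c0 c1 c2 -> opp (rot G (a c)) \in vtx b /\
    rot G (opp (rot G (opp (rot G (a c))))) = a (ordS c).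
  rewrite -eK inE => hb; split=> //; case: (rot_bdry c) => [e|[y [yb e1 e2]]].
    by move: hb; rewrite e /a oppK -hubE /interior_black is_bdry_bdry andbF.
  by rewrite e1 oppK.
have hub_next c : c \in cuts c0 c1 c2 ->
    rot G (opp (rot G (a c))) = opp (rot G (a (next_cut c0 c1 c2 c))).
  move=> hc; have [h1 h2] := cutP c hc.
  have [h3 _] := cutP _ (next_cut_in c0 c1 c2 c).
  (* By the face in the gap after [c], the next spoke ends at the vertex of [a (ordS c)], the white
     vertex of the next part; acyclicity makes it the only spoke there. *)
  apply: hub_opp_vtx; rewrite ?rot_hub //.
  rewrite -vtx_rot h2 oppK vtx_rot vpart part_ordS // hc.
  by [].
apply: glue_canonical => //.
- by rewrite h12.
- move=> _ c hc; have [h1 _] := cutP c hc; split; last by move: h1; rewrite -hubE => /andP[].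
    have hp := prev_cut_in c0 c1 c2 c.
    have [_ <-] := cutP _ hp.
    by rewrite hub_next // prev_cutK // oppK.
  exact: hub_next.
- move=> x; case: (tripod_darts x) => [h|h|xb|[y yb ->]].
  + by constructor 1.
  + by constructor 2.
  + constructor 3; split=> //.
    have := xb; rewrite -hub_imset => /imsetP[c hc e].
    by exists c; [rewrite -eK|right].
  constructor 3; split=> //.
  have := yb; rewrite -hub_imset => /imsetP[c hc e].
  by exists c; [rewrite -eK|left; rewrite e oppK].
Qed.
End Tripod.

Lemma forest_web_canonical : exists c0 c1 c2 : 'I_n, exists (c01 : c0 < c1) (c12 : c1 <= c2),
  valid_cuts c0 c1 c2 /\ isotopic (canonical_web c01 c12) G.
Proof.
have [[h1 h2]|[b [_ h1 h2 h3]]] := forest_web_cases r_gt0 pG cG noiso acyclic.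
  exact: claws_canonical.
exact: tripod_canonical h1 h2 h3.
Qed.
End Structure.

(** * The bijection *)

Lemma rothe_lam_inj r (T T' : syt r) (w : 'S_r) :
  (forall i v, rothe w i v = (v < lam T i)) ->
  (forall i v, rothe w i v = (v < lam T' i)) ->
  forall k, T k ord0 = T' k ord0.
Proof.
move=> h h' k; rewrite -(rev_ordK k).
have [-> l1] := lamE T (rev_ord k); have [-> l2] := lamE T' (rev_ord k).
have e v : (v < lam T (rev_ord k)) = (v < lam T' (rev_ord k)) :> bool.
  have [lv|lv] := ltnP v r; last by lia.
  by rewrite -[v]/(val (Ordinal lv)) -h -h'.
by have := e (lam T (rev_ord k)); have := e (lam T' (rev_ord k)); lia.
Qed.

Lemma noncrossing_syt_openers r (M M' : 'I_(2 * r) -> 'I_(2 * r))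
  (ncM : noncrossing_matching M) (ncM' : noncrossing_matching M') :
  (forall k, noncrossing_syt ncM k ord0 = noncrossing_syt ncM' k ord0) ->
  forall i : 'I_(2 * r), (i < M i) = (i < M' i).
Proof.
move=> e; have eo k : opn M k = opn M' k.
  by apply/val_inj/succn_inj; have := e k; rewrite !matching_syt_col0.
move=> i; apply/idP/idP => h.
- have [k ->] := opn_surj (noncrossing_inv ncM) (noncrossing_neq ncM) h.
  by rewrite eo; exact: (opnP (noncrossing_inv ncM') (noncrossing_neq ncM')).
have [k ->] := opn_surj (noncrossing_inv ncM') (noncrossing_neq ncM') h.
by rewrite -eo; exact: (opnP (noncrossing_inv ncM) (noncrossing_neq ncM)).
Qed.

Lemma cuts_inj r (c0 c1 c2 d0 d1 d2 : 'I_(2 * r)) :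
  c0 < c1 -> c1 <= c2 -> d0 < d1 -> d1 <= d2 ->
  cuts c0 c1 c2 = cuts d0 d1 d2 -> [/\ c0 = d0, c1 = d1 & c2 = d2].
Proof.
move=> c01 c12 d01 d12 /setP e.
have k i : ((i == c0) || (i == c1) || (i == c2) :> bool) = ((i == d0) || (i == d1) || (i == d2)).
  by have := e i; rewrite !inE.
have e0 : c0 = d0 by apply/val_inj => /=; have := k c0; have := k d0; rewrite -!val_eqE /=; lia.
have e2 : c2 = d2 by apply/val_inj => /=; have := k c2; have := k d2; rewrite -!val_eqE /=; lia.
split=> //; apply/val_inj => /=; have := k c1; have := k d1; rewrite e0 e2 -!val_eqE /=.
by move: c01 c12; rewrite e0 e2; lia.
Qed.

Lemma can_Phi r (c0 c1 c2 : 'I_(2 * r)) (c01 : c0 < c1) (c12 : c1 <= c2) (w : 'S_r) :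
  Phi (canonical_web c01 c12) w <->
  exists M (ncM : noncrossing_matching M),
    linked c0 c1 c2 M /\ forall i v, rothe w i v = (v < lam (noncrossing_syt ncM) i).
Proof.
split=> [[T [M /can_strand_matching[ncM lM] eT] /pi_rothe hw]|[M [ncM [lM hw]]]].
  exists M, ncM; split=> //.
  by have <- : T = noncrossing_syt ncM by apply: syt_inj.
exists (noncrossing_syt ncM); last exact/pi_rothe.
by exists M => //; apply/can_strand_matching.
Qed.

(** Two matchings linked to the same cuts have the same openers, hence agree; so the tableau is
    unique, and with it [w]. *)
Lemma can_Phi_unique r (c0 c1 c2 : 'I_(2 * r)) (c01 : c0 < c1) (c12 : c1 <= c2) :
  valid_cuts c0 c1 c2 -> exists! w, Phi (canonical_web c01 c12) w.
Proof.
move=> hv; have [M [ncM /(short_arcs_linked c01 c12 ncM)[_ lM]]] := linked_exists c01 c12 hv.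
have [w /pi_rothe hw] := pi_exists (noncrossing_syt ncM); exists w; split.
  by apply/can_Phi; exists M, ncM.
move=> w' /can_Phi[M' [ncM' [lM' hw']]].
apply: (@pi_functional r (noncrossing_syt ncM)); apply/pi_rothe => //.
suff -> : noncrossing_syt ncM = noncrossing_syt ncM' by [].
have eM := openers_inj ncM ncM' (linked_openers c01 c12 hv ncM ncM' lM lM').
apply/syt_inj/matrixP => k c; rewrite !mxE; congr (nth 0 (map _ _) k).
by apply: eq_filter => i; rewrite eM.
Qed.

Lemma can_Phi_avoids r (c0 c1 c2 : 'I_(2 * r)) (c01 : c0 < c1) (c12 : c1 <= c2) (w : 'S_r) :
  valid_cuts c0 c1 c2 -> Phi (canonical_web c01 c12) w ->
  [/\ avoids w [:: 1; 3; 2], avoids w [:: 4; 3; 2; 1] & avoids w [:: 3; 2; 1; 4]].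
Proof.
move=> hv /can_Phi[M [ncM [lM hw]]].
have sM : #|short_arcs M| <= 3.
  by have [-> _] := linked_short_arcs c01 c12 ncM hv lM; rewrite card_cuts //; case: ifP.
split; [exact: rothe_avoids132 hw|exact: avoids_card_records hw sM|exact: avoids_3214 hw sM].
Qed.

(** The Rothe diagram of [w] gives the first column of the tableau, thus the openers, the matching
    and its short arcs, which are the cuts. *)
Lemma can_Phi_inj r (c0 c1 c2 d0 d1 d2 : 'I_(2 * r))
    (c01 : c0 < c1) (c12 : c1 <= c2) (d01 : d0 < d1) (d12 : d1 <= d2) (w : 'S_r) :
  valid_cuts c0 c1 c2 -> valid_cuts d0 d1 d2 ->
  Phi (canonical_web c01 c12) w -> Phi (canonical_web d01 d12) w ->
  canonical_web c01 c12 = canonical_web d01 d12.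
Proof.
move=> hc hd /can_Phi[M [ncM [lM hw]]] /can_Phi[M' [ncM' [lM' hw']]].
have eM := openers_inj ncM ncM' (noncrossing_syt_openers (rothe_lam_inj hw hw')).
have [sM _] := linked_short_arcs c01 c12 ncM hc lM.
have [sM' _] := linked_short_arcs d01 d12 ncM' hd lM'.
have [|e0 e1 e2] := cuts_inj c01 c12 d01 d12.
  by rewrite -sM -sM'; apply/setP => i; rewrite !inE eM.
subst d0 d1 d2; by rewrite (bool_irrelevance c01 d01) (bool_irrelevance c12 d12).
Qed.

Lemma forest_web_isotopic_canonical r (G : hgraph (2 * r)) : 0 < r -> forest_web G ->
  exists c0 c1 c2 : 'I_(2 * r), exists (c01 : c0 < c1) (c12 : c1 <= c2),
  valid_cuts c0 c1 c2 /\ isotopic (canonical_web c01 c12) G.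
Proof.
by move=> r_gt0 [[pG cG [noiso _ _]] acyclic]; exact: forest_web_canonical.
Qed.

Theorem theorem4p4 (r : nat) (r_ge1 : 1 <= r) :
  [/\ (* Phi is a well-defined function on forest webs up to isotopy *)
      (forall G : hgraph (2 * r), forest_web G -> exists! w, Phi G w) /\
      (forall (G H : hgraph (2 * r)) (w : 'S_r),
         forest_web G -> forest_web H -> isotopic G H -> Phi G w -> Phi H w),
      (* its values avoid the three patterns *)
      (forall (G : hgraph (2 * r)) (w : 'S_r), forest_web G -> Phi G w ->
         [/\ avoids w [:: 1; 3; 2], avoids w [:: 4; 3; 2; 1]
           & avoids w [:: 3; 2; 1; 4]]),
      (* injectivity *)
      (forall (G H : hgraph (2 * r)) (w : 'S_r),
         forest_web G -> forest_web H -> Phi G w -> Phi H w -> isotopic G H)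
    & (* surjectivity *)
      (forall w : 'S_r,
         avoids w [:: 1; 3; 2] -> avoids w [:: 4; 3; 2; 1] ->
         avoids w [:: 3; 2; 1; 4] ->
         exists2 G : hgraph (2 * r), forest_web G & Phi G w)].
Proof.
have can G := @forest_web_isotopic_canonical r G r_ge1.
split.
- split=> [G /can[c0 [c1 [c2 [c01 [c12 [hv iso]]]]]]|G H w _ _]; last exact: isotopic_Phi.
  have [w [hw uw]] := can_Phi_unique c01 c12 hv; exists w.
  split; first exact: isotopic_Phi iso hw.
  by move=> w' hw'; exact: uw _ (isotopic_Phi (isotopic_sym iso) hw').
- move=> G w /can[c0 [c1 [c2 [c01 [c12 [hv iso]]]]]] hw.
  exact: can_Phi_avoids hv (isotopic_Phi (isotopic_sym iso) hw).
- move=> G H w /can[c0 [c1 [c2 [c01 [c12 [hc isoG]]]]]].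
  move=> /can[d0 [d1 [d2 [d01 [d12 [hd isoH]]]]]] hG hH.
  have e := can_Phi_inj hc hd (isotopic_Phi (isotopic_sym isoG) hG)
    (isotopic_Phi (isotopic_sym isoH) hH).
  by apply: isotopic_trans (isotopic_sym isoG) _; rewrite e.
move=> w w132 w4321 w3214; have [M [ncM hw]] := avoids132_matching w132.
have sM := avoids_card_short_arcs w132 hw w4321 w3214.
have [c0 [c1 [c2 [c01 c12 eM]]]] := short_arcs_are_cuts r_ge1 ncM sM.
have [hv lM] := short_arcs_linked c01 c12 ncM eM.
exists (canonical_web c01 c12); first exact: can_web.
by apply/can_Phi; exists M, ncM.
Qed.
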